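(* Let $(\Omega,\mathcal{F},\mathbb{P})$ be a probability space on which is defined a standard Brownian motion $B=(B(t):t\ge0)$ (started at $0$). Then the process $\big(\tau_{\mathrm{frag}}(B,H^{\theta}(B)):\theta\ge 0\big)$ has the distribution of the reciprocal of a $\tfrac12$-stable subordinator: there is a $\tfrac12$-stable subordinator $(S_\theta)_{\theta\ge0}$ such that $\big(\tau_{\mathrm{frag}}(B,H^{\theta}(B))\big)_{\theta\ge0}$ has the same distribution (as a process indexed by $\theta\ge 0$) as $(1/S_\theta)_{\theta\ge0}$, with $1/0=\infty$. In particular, $\big(\tau_{\mathrm{frag}}(B,H^{\theta}(B)):\theta\ge 0\big)$ is (almost surely) a non-increasing, pure-jump process.
   Context: $W=C([0,\infty);\mathbb{R})$ is the space of continuous real-valued paths. The fragmentation time of $w_1,w_2\in W$ is $\tau_{\mathrm{frag}}(w_1,w_2):=\inf\{t\ge 0: w_1(t)\ne w_2(t)\}$, with $\inf\emptyset=\infty$. For $\theta\in\mathbb{R}$, the map $H^{\theta}:W\to W$ is $$(H^{\theta}(w))(t):=\begin{cases} w(t), & \text{if } t\le \sup\{s\ge 0: w(s)=\tfrac12\theta s\},\\ \theta t-w(t), & \text{otherwise.}\end{cases}$$ (If $w(0)=0$ the set in the supremum contains $0$; for other paths, if the set is empty its supremum is taken to be $-\infty$.) A $\tfrac12$-stable subordinator is a process $(S_\theta)_{\theta\ge0}$ with $S_0=0$, non-decreasing paths, and stationary independent increments such that, for some constant $c>0$, $\mathbb{E}[e^{-\lambda S_\theta}]=e^{-c\,\theta\sqrt{\lambda}}$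 for all $\lambda,\theta\ge 0$. Equality in distribution of processes means equality of all finite-dimensional distributions (as $[0,\infty]$-valued processes); no distinction is made between left- and right-continuous versions. A non-increasing process $(X_\theta)_{\theta\ge 0}$ that is finite for $\theta>0$ is pure-jump if its variation comes only from its jumps: for all $0<a<b$, $X_{a+}-X_{b-}=\sum_{u\in(a,b)}(X_{u-}-X_{u+})$, where $X_{u\pm}$ are the one-sided limits. *)

(* Defs.v *)
From HB Require Import structures.
From mathcomp Require Import all_boot all_order all_algebra.
From mathcomp Require Import all_classical all_reals all_analysis.
From mathcomp Require Import measurable_realfun.

Set Implicit Arguments.
Unset Strict Implicit.
Unset Printing Implicit Defensive.
Import Order.TTheory GRing.Theory Num.Theory.
Import numFieldNormedType.Exports.

Local Open Scope classical_set_scope.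
Local Open Scope ring_scope.

(* Functions of a time (or slope) parameter in [0, oo) are functions on all of
   R of which only the values on [0, oo) are ever constrained or used. *)

Section Paths.
Context {R : realType}.

(* The space W = C([0, oo); R). *)
Definition continuous_path (w : R -> R) : Prop :=
  {within [set t : R | 0 <= t], continuous w}.

Definition tau_frag (w1 w2 : R -> R) : \bar R :=
  ereal_inf [set t%:E | t in [set t : R | 0 <= t /\ w1 t != w2 t]].

(* [ereal_sup set0 = -oo], and the supremum is [+oo] on unbounded sets. *)
Definition last_crossing (theta : R) (w : R -> R) : \bar R :=
  ereal_sup [set s%:E | s in [set s : R | 0 <= s /\ w s = 2^-1 * theta * s]].

Definition reflect_path (theta : R) (w : R -> R) : R -> R :=
  fun t => if (t%:E <= last_crossing theta w)%E then w t else theta * t - w t.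

Definition nonincreasing_path (x : R -> \bar R) : Prop :=
  forall s t : R, 0 <= s -> s <= t -> (x t <= x s)%E.

Definition finite_path (x : R -> \bar R) : Prop :=
  forall t : R, 0 < t -> x t \is a fin_num.

(* Meant for nonincreasing paths that are finite on (0, oo): the one-sided
   limits then exist and the jumps are nonnegative, so that [esum] is the sum
   over the (uncountable) index set. *)
Definition pure_jump_path (x : R -> \bar R) : Prop :=
  forall a b : R, 0 < a -> a < b ->
    (lim (x t @[t --> a^'+]) - lim (x t @[t --> b^'-]) =
     \esum_(u in [set u : R | (a < u < b)%R])
        (lim (x t @[t --> u^'-]) - lim (x t @[t --> u^'+])))%E.

End Paths.

Section Processes.
Context {R : realType} {d : measure_display} {T : measurableType d}.
Variable P : probability T R.

Definition process {d' : measure_display} {E : measurableType d'}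
    (X : R -> T -> E) : Prop :=
  forall t : R, 0 <= t -> measurable_fun [set: T] (X t).

Definition mutually_independent {d' : measure_display} {E : measurableType d'}
    (n : nat) (X : 'I_n -> T -> E) : Prop :=
  forall A : 'I_n -> set E, (forall i, measurable (A i)) ->
    P (\bigcap_(i in [set: 'I_n]) (X i @^-1` A i)) =
    (\prod_(i < n) P (X i @^-1` A i))%E.

Definition independent_increments (X : R -> T -> R) : Prop :=
  forall (n : nat) (t : nat -> R), 0 <= t 0%N ->
    (forall i, (i < n)%N -> t i <= t i.+1) ->
    mutually_independent (fun (i : 'I_n) w => X (t i.+1) w - X (t i) w).

Definition stationary_increments (X : R -> T -> R) : Prop :=
  forall s h : R, 0 <= s -> 0 <= h ->
    forall A : set R, measurable A ->
      P [set w | A (X (s + h) w - X s w)] = P [set w | A (X h w - X 0 w)].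

(* [normal_prob] takes the standard deviation, not the variance. *)
Definition standard_brownian_motion (B : R -> T -> R) : Prop :=
  [/\ process B,
      forall w, continuous_path (B ^~ w),
      {ae P, forall w, B 0 w = 0},
      independent_increments B &
      forall s t : R, 0 <= s -> s < t ->
        forall A : set R, measurable A ->
          P [set w | A (B t w - B s w)] = normal_prob 0 (Num.sqrt (t - s)) A].

Definition half_stable_subordinator (S : R -> T -> R) : Prop :=
  [/\ process S,
      forall w, S 0 w = 0,
      forall (w : T) (s t : R), 0 <= s -> s <= t -> S s w <= S t w,
      stationary_increments S /\ independent_increments S &
      exists2 c : R, 0 < c &
        forall lambda theta : R, 0 <= lambda -> 0 <= theta ->
          'E_P[fun w => expR (- (lambda * S theta w))]%E =
          (expR (- (c * theta * Num.sqrt lambda)))%:E].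

End Processes.

(* Equality of all finite-dimensional distributions; the measurability that
   gives meaning to these distributions is included. *)
Definition same_process_distribution {R : realType}
    {d1 d2 d' : measure_display}
    {T1 : measurableType d1} {T2 : measurableType d2} {E : measurableType d'}
    (P1 : probability T1 R) (X : R -> T1 -> E)
    (P2 : probability T2 R) (Y : R -> T2 -> E) : Prop :=
  [/\ process X, process Y &
      forall (n : nat) (t : 'I_n -> R), (forall i, 0 <= t i) ->
      forall A : set (n.-tuple E), measurable A ->
        P1 [set w | A [tuple X (t i) w | i < n]] =
        P2 [set w | A [tuple Y (t i) w | i < n]]].

(* Main.v *)
Require Import Defs.
From HB Require Import structures.
From mathcomp Require Import all_boot all_order all_algebra.
From mathcomp Require Import all_classical all_reals all_analysis.
From mathcomp Require Import measurable_realfun.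
From mathcomp Require Import ring lra zify.

Set Implicit Arguments.
Unset Strict Implicit.
Unset Printing Implicit Defensive.
Import Order.TTheory GRing.Theory Num.Theory.
Import numFieldNormedType.Exports HBNNSimple.

Local Open Scope classical_set_scope.
Local Open Scope ring_scope.

(** Time inversion turns the theorem into a statement on first passage times.
    The path [W u = u (B (1/u) - B 0)] visits the level [th / 2] at time [u]
    exactly when [B] crosses the line of slope [th / 2] at time [1/u]. The
    fragmentation time of [B] and its reflection is the last crossing time
    ([tau_fragE]), so its reciprocal is the first time at which [W] visits
    [th / 2], and the first passage times of a Brownian motion above increasing
    levels form a 1/2-stable subordinator.

    What is used of [W] is only its exponential martingale
    [exp(c W u - c ^ 2 u / 2)], and the proof gets it directly from [B]. The
    value of this martingale at [u = 1/s] is [exp(c B s / s - c ^ 2 / (2 s))];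
    weighting the probability with it translates the path [B] after time [s] by
    [c], by the Cameron-Martin formula for one Gaussian variable and the
    independence of increments. This effect does not depend on [s], hence
    neither does the expectation of the weight against any function of the path
    after a later time: this is the martingale property of [W]
    ([reverse_tilt]). Optional stopping on finer and finer grids, with a
    coefficient [c] that changes at each passage ([stopped_exponent_mean]), then
    gives the joint Laplace transform of the increments of the passage times
    ([passage_oo_laplace]). It also shows that almost surely [W] passes every
    level and that passing a positive level takes a positive time.

    The reciprocals of the fragmentation times lie between the passage times
    above lower levels and above the level itself ([tau_le_passage] and
    [passage_le_tau]), so they have the same joint Laplace transforms
    ([subordinator_laplace]). Stationarity and independence of the increments
    follow from the uniqueness of Laplace transforms ([laplace_unique]), which
    is applied to one increment at a time ([laplace_mutually_independent]).

    For the jumps, let [t] be a one-sided limit of the fragmentation times in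
    the parameter. Then [B] is at time [t] on a line through the origin above
    which it never is later ([tau_limit_slope_record]). A given [t] almost
    surely does not have this property, since the path restarted at [t] is at
    some times above any line; by Fubini, almost surely the set of such [t]
    has Lebesgue measure 0 ([ae_negligible_slope_records]). But every value in
    the range of a monotone path lies in the interval of a jump or is a
    one-sided limit, so the jumps add up to the whole variation
    ([pure_jump_of_negligible]). *)

(** * Convergence of expectations *)

Section convergence_of_expectations.
Context {R : realType} {d : measure_display} {T : measurableType d}.
Variable P : probability T R.
Local Open Scope ereal_scope.

Lemma bounded_cvg_integral (f_ : nat -> T -> R) (f : T -> R) (M : R) :
  (forall n, measurable_fun [set: T] (f_ n)) -> measurable_fun [set: T] f ->
  (forall n x, `|f_ n x| <= M)%R ->
  {ae P, forall x, f_ ^~ x @ \oo --> f x} ->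
  \int[P]_x (f_ n x)%:E @[n --> \oo] --> \int[P]_x (f x)%:E.
Proof.
move=> mf_ mf fM cf.
have [] := @dominated_convergence _ _ _ P setT measurableT
  (fun n x => (f_ n x)%:E) (fun x => (f x)%:E) (fun=> M%:E).
- by move=> n; apply/measurable_EFinP.
- by apply/measurable_EFinP.
- by apply: filterS cf => x cf _; apply: cvg_EFin => //; exact: nearW.
- apply/integrableP; split; first exact: measurable_cst.
  by rewrite integral_cst//= probability_setT mule1 ltry.
- by apply: nearW => x n _; rewrite lee_fin.
- by [].
Qed.

(** Truncating [X_ n] at level [L] loses at most [X_ n ^ 2 / L], hence at most
    [C / L] in expectation, uniformly in [n]; the truncations are covered by
    bounded convergence. This is what makes optional stopping survive the
    passage from grids to continuous time. *)
Lemma L2_bounded_cvg_integral (X_ : nat -> T -> R) (X : T -> R) (M C c : R) :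
  (forall n, measurable_fun [set: T] (X_ n)) -> measurable_fun [set: T] X ->
  (forall n x, 0 <= X_ n x)%R -> (forall x, X x <= M)%R ->
  {ae P, forall x, X_ ^~ x @ \oo --> X x} ->
  (forall n, \int[P]_x (X_ n x)%:E = c%:E) ->
  (forall n, \int[P]_x (X_ n x ^+ 2)%:E <= C%:E) ->
  \int[P]_x (X x)%:E = c%:E.
Proof.
move=> mX_ mX X_0 XM cX EX EX2.
have C0 : (0 <= C)%R.
  rewrite -lee_fin; apply: le_trans (EX2 0%N).
  by apply: integral_ge0 => x _; rewrite lee_fin sqr_ge0.
have mmin L n : measurable_fun [set: T] (fun x => Num.min (X_ n x) L).
  by apply: measurable_minr => //; exact: measurable_cst.
have key (L : R) : (0 < L)%R -> (M <= L)%R ->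
    \int[P]_x (X x)%:E <= c%:E /\ c%:E <= \int[P]_x (X x)%:E + (C / L)%:E.
  move=> L0 ML.
  have cvgL : \int[P]_x (Num.min (X_ n x) L)%:E @[n --> \oo] -->
      \int[P]_x (X x)%:E.
    apply: (@bounded_cvg_integral _ _ L) => //.
      move=> n x; rewrite ger0_norm; first by rewrite ge_min lexx orbT.
      by rewrite le_min X_0 ltW.
    apply: filterS cX => x cx.
    rewrite -[X in _ --> X](@min_l _ _ (X x) L) ?(le_trans (XM x))//.
    apply: (@cvg_comp _ _ _ (X_ ^~ x) (fun y : R^o => Num.min y L) _ _ _ cx).
    by apply: (@continuous_min _ _ id (cst L)); [exact: cvg_id|exact: cvg_cst].
  split.
    apply: (cvge_to_le cvgL); apply: nearW => n; rewrite -(EX n).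
    apply: ge0_le_integral => //.
    - by move=> x _; rewrite lee_fin le_min X_0 ltW.
    - exact/measurable_EFinP.
    - exact/measurable_EFinP.
    - by move=> x _; rewrite lee_fin ge_min lexx.
  have cvgL' : \int[P]_x (Num.min (X_ n x) L)%:E + (C / L)%:E @[n --> \oo] -->
      \int[P]_x (X x)%:E + (C / L)%:E.
    by apply: cvgeD => //; [rewrite fin_num_adde_defl|exact: cvg_cst].
  apply: (cvge_to_ge cvgL').
  apply: nearW => n; rewrite -(EX n).
  apply: (@le_trans _ _
    (\int[P]_x ((Num.min (X_ n x) L)%:E + (L^-1)%:E * (X_ n x ^+ 2)%:E))).
    apply: ge0_le_integral => //.
    - by move=> x _; rewrite lee_fin.
    - exact/measurable_EFinP.
    - apply: emeasurable_funD; first exact/measurable_EFinP.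
      apply: emeasurable_funM; first exact: measurable_cst.
      by apply/measurable_EFinP; exact: measurable_funX.
    - move=> x _; rewrite -EFinM -EFinD lee_fin.
      have [XL|LX] := leP (X_ n x) L.
        by rewrite lerDl mulr_ge0 ?sqr_ge0 ?invr_ge0 ?ltW.
      rewrite (@le_trans _ _ (L^-1 * X_ n x ^+ 2)%R)//.
        by rewrite mulrC ler_pdivlMr// expr2 ler_pM// ltW.
      by rewrite lerDr ltW.
  rewrite ge0_integralD//; first last.
  - apply: emeasurable_funM; first exact: measurable_cst.
    by apply/measurable_EFinP; exact: measurable_funX.
  - by move=> x _; rewrite mule_ge0 ?lee_fin ?sqr_ge0 ?invr_ge0 ?(ltW L0).
  - exact/measurable_EFinP.
  - by move=> x _; rewrite lee_fin le_min X_0 ltW.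
  rewrite leeD2l// ge0_integralZl//; first last.
  - by rewrite lee_fin invr_ge0 ltW.
  - by move=> x _; rewrite lee_fin sqr_ge0.
  - by apply/measurable_EFinP; exact: measurable_funX.
  by rewrite mulrC EFinM lee_wpmul2l// lee_fin invr_ge0 ltW.
have [L0 ML] : (0 < Num.max 1 M)%R /\ (M <= Num.max 1 M)%R.
  by rewrite lt_max ltr01 le_max lexx orbT.
have [le1 _] := key _ L0 ML.
apply/eqP; rewrite eq_le le1/=; apply/lee_addgt0Pr => e e0.
pose L := (Num.max (Num.max 1 M) (C / e))%R.
have LL : (0 < L)%R by rewrite /L lt_max L0.
have [|_ /le_trans] := key L LL; first by rewrite /L le_max ML.
apply; rewrite leeD2l// lee_fin ler_pdivrMr// mulrC -ler_pdivrMr//.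
by rewrite /L le_max lexx orbT.
Qed.

End convergence_of_expectations.

(** * Laws with densities *)

Section densities.
Context {R : realType} {d : measure_display} {T : measurableType d}.
Variable mu : {measure set T -> \bar R}.
Local Open Scope ereal_scope.

(** With the identity into a coarser sigma-algebra as [X], this is the
    restriction to that sigma-algebra of the measure of density [g]. *)
Definition weighted_law {d'} {T' : measurableType d'} (g : T -> \bar R)
  (mg : measurable_fun [set: T] g) (g0 : forall x, 0 <= g x) (X : T -> T')
  (mX : measurable_fun [set: T] X) (A : set T') : \bar R :=
  \int[mu]_(x in X @^-1` A) g x.

Section weighted_law_is_measure.
Context {d' : measure_display} {T' : measurableType d'}.
Variables (g : T -> \bar R) (mg : measurable_fun [set: T] g).
Variables (g0 : forall x, 0 <= g x) (X : T -> T').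
Variable mX : measurable_fun [set: T] X.

Let weighted0 : weighted_law mg g0 mX set0 = 0.
Proof. by rewrite /weighted_law preimage_set0 integral_set0. Qed.

Let weighted_ge0 A : 0 <= weighted_law mg g0 mX A.
Proof. exact: integral_ge0. Qed.

Let weighted_sigma_additive : semi_sigma_additive (weighted_law mg g0 mX).
Proof.
move=> /= A mA tA mUA; rewrite /weighted_law preimage_bigcup.
rewrite ge0_integral_bigcup//=.
- by apply: is_cvg_ereal_nneg_natsum_cond => n _ _; exact: integral_ge0.
- by move=> k; rewrite -[X in measurable X]setTI; exact: mX.
- exact: measurable_funTS.
- apply/trivIsetP => i j _ _ ij; rewrite -preimage_setI.
  by move/trivIsetP : tA => /(_ i j I I ij) ->; rewrite preimage_set0.
Qed.

HB.instance Definition _ := isMeasure.Build _ _ _ (weighted_law mg g0 mX)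
  weighted0 weighted_ge0 weighted_sigma_additive.

End weighted_law_is_measure.

Lemma integral_weighted_law {d'} {T' : measurableType d'} (g : T -> R)
    (mg : measurable_fun [set: T] (EFin \o g)) (g0 : forall x, 0 <= (EFin \o g) x)
    (X : T -> T') (mX : measurable_fun [set: T] X) (f : T' -> R) :
  measurable_fun [set: T'] f -> (forall y, (0 <= f y)%R) ->
  \int[weighted_law mg g0 mX]_y (f y)%:E = \int[mu]_x (f (X x) * g x)%:E.
Proof.
move=> mf f0.
have mg' : measurable_fun [set: T] g by apply/measurable_EFinP.
have g0' x : (0 <= g x)%R by have := g0 x; rewrite lee_fin.
have mEf : measurable_fun [set: T'] (EFin \o f) by exact/measurable_EFinP.
pose h := nnsfun_approx measurableT mEf.
have mhr n (r : R) : measurable (h n @^-1` [set r]) by exact: measurable_sfunP.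
have mXA A : measurable A -> measurable (X @^-1` A).
  by move=> mA; rewrite -[X in measurable X]setTI; exact: mX.
have step n : \int[mu]_x (h n (X x) * g x)%:E =
    \int[weighted_law mg g0 mX]_y (h n y)%:E.
  transitivity (\sum_(r \in range (h n))
      (r%:E * \int[mu]_(x in X @^-1` (h n @^-1` [set r])) (g x)%:E)).
    transitivity (\int[mu]_x (\sum_(r \in range (h n))
        (r * \1_(h n @^-1` [set r]) (X x) * g x)%:E)).
      apply: eq_integral => x _.
      rewrite {1}(fimfunE (h n)) fsumEFin; last exact: (fimfunP (h n)).
      by congr EFin; rewrite mulr_fsuml.
    have mI r : measurable_fun [set: T] (fun x => \1_(h n @^-1` [set r]) (X x) : R).
      by apply: measurableT_comp => //; exact: measurable_indic.
    rewrite ge0_integral_fsum//; last 2 first.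
    - move=> r; apply/measurable_EFinP; apply: measurable_funM => //.
      by apply: measurable_funM => //; exact: mI.
    - move=> r x _; rewrite lee_fin mulr_ge0//.
      by have := nnfun_muleindic_ge0 (h n) r (X x); rewrite lee_fin.
    apply: eq_fsbigr => r; rewrite inE => -[x0 _ r_def].
    have r0 : (0 <= r)%R by rewrite -r_def.
    under eq_integral do rewrite -mulrA EFinM.
    rewrite ge0_integralZl//; last 2 first.
    - by apply/measurable_EFinP; apply: measurable_funM => //; exact: mI.
    - by move=> x _; rewrite lee_fin mulr_ge0.
    congr (_ * _); rewrite [RHS]integral_mkcond; apply: eq_integral => x _.
    by rewrite epatch_indic EFinM muleC.
  under [RHS]eq_integral => y _.
    rewrite {1}(fimfunE (h n)) -fsumEFin; last exact: (fimfunP (h n)).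
    over.
  rewrite ge0_integral_fsum//; last 2 first.
  - by move=> r; apply/measurable_EFinP; exact: measurable_funM.
  - by move=> r y _; exact: nnfun_muleindic_ge0.
  apply: eq_fsbigr => r; rewrite inE => -[x0 _ r_def].
  have r0 : (0 <= r)%R by rewrite -r_def.
  under [RHS]eq_integral do rewrite EFinM.
  rewrite ge0_integralZl//; last first.
    by apply/measurable_EFinP; exact: measurable_indic.
  by rewrite integral_indic// setIT.
have cvgh y : (h n y)%:E @[n --> \oo] --> (f y)%:E.
  by apply: cvg_nnsfun_approx => // z _; rewrite lee_fin.
have ndh y : {homo h ^~ y : a b / (a <= b)%N >-> (a <= b)%R}.
  by move=> a b ab; exact/lefP/nd_nnsfun_approx.
transitivity (lim (\int[mu]_x (h n (X x) * g x)%:E @[n --> \oo])).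
  transitivity (lim (\int[weighted_law mg g0 mX]_y (h n y)%:E @[n --> \oo])).
    rewrite -monotone_convergence//.
    - by apply: eq_integral => y _; apply/esym/cvg_lim.
    - by move=> n; exact/measurable_EFinP.
    - by move=> n y _; rewrite lee_fin.
    - by move=> y _ a b ab; rewrite lee_fin; exact: ndh.
  by congr (lim (_ @ \oo)); apply/funext => n; rewrite step.
rewrite -monotone_convergence//.
- apply: eq_integral => x _; apply/cvg_lim => //.
  under eq_fun do rewrite EFinM.
  by rewrite EFinM; apply: cvgeZr.
- move=> n; apply/measurable_EFinP; apply: measurable_funM => //.
  exact: measurableT_comp.
- by move=> n x _; rewrite lee_fin mulr_ge0.
- by move=> x _ a b ab; rewrite lee_fin ler_wpM2r//; exact: ndh.
Qed.

(** Uniqueness of measures on a pi-system. The conclusion says that [g1] and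
    [g2] have the same conditional expectation given the sigma-algebra generated
    by [G]; martingale properties are used below in this form, so that no
    conditional expectation has to be constructed. *)
Lemma eq_integral_weighted (G : set (set T)) (g1 g2 : T -> R) :
  G `<=` measurable -> setI_closed G -> G [set: T] ->
  measurable_fun [set: T] g1 -> measurable_fun [set: T] g2 ->
  (forall x, (0 <= g1 x)%R) -> (forall x, (0 <= g2 x)%R) ->
  \int[mu]_x (g1 x)%:E < +oo ->
  (forall E, G E -> \int[mu]_(x in E) (g1 x)%:E = \int[mu]_(x in E) (g2 x)%:E) ->
  forall f : g_sigma_algebraType G -> R, measurable_fun setT f ->
  (forall x, (0 <= f x)%R) ->
  \int[mu]_x (f x * g1 x)%:E = \int[mu]_x (f x * g2 x)%:E.
Proof.
move=> Gm GI GT mg1 mg2 g10 g20 g1oo eqG f mf f0.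
have /measurable_EFinP mg1' := mg1; have /measurable_EFinP mg2' := mg2.
have g10' x : 0 <= (EFin \o g1) x by rewrite lee_fin.
have g20' x : 0 <= (EFin \o g2) x by rewrite lee_fin.
have mid : measurable_fun [set: T] (id : T -> g_sigma_algebraType G).
  move=> _ Y mY; rewrite setTI preimage_id; apply: (smallest_sub _ Gm) mY.
  exact: sigma_algebra_measurable.
rewrite -(integral_weighted_law mg1' g10' mid)//.
rewrite -(integral_weighted_law mg2' g20' mid)//.
apply: eq_measure_integral => /= A mA _.
apply: (@g_sigma_algebra_measure_unique _ _ _ G Gm (fun=> setT) _ _
  (weighted_law mg1' g10' (@measurable_id _ T setT))
  (weighted_law mg2' g20' (@measurable_id _ T setT))) => //.
by rewrite bigcup_const.
Qed.

End densities.

(** * Uniqueness of Laplace transforms *)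

Section laplace_transform.
Context {R : realType}.
Local Open Scope ereal_scope.

Lemma bounded_integrable {d} {T : measurableType d} (P : probability T R)
    (f : T -> R) (M : R) :
  measurable_fun [set: T] f -> (forall x, `|f x| <= M)%R ->
  P.-integrable [set: T] (EFin \o f).
Proof.
move=> mf fM; apply: measurable_bounded_integrable => //.
  by rewrite [X in X < _](_ : _ = 1) ?ltry//; exact: probability_setT.
exists M; split; first exact: num_real.
by move=> y My x _ /=; rewrite (le_trans (fM x))// ltW.
Qed.

Lemma bernoulli_ineq (t : R) (n : nat) :
  (0 <= t <= 1 -> 1 - n%:R * t <= (1 - t) ^+ n)%R.
Proof.
move=> /andP[t0 t1]; elim: n => [|n IH]; first by rewrite mul0r subr0 expr0.
have : ((1 - n%:R * t) * (1 - t) <= (1 - t) ^+ n.+1)%R.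
  by rewrite exprSr ler_wpM2r// subr_ge0.
apply: le_trans; rewrite -natr1 -subr_ge0.
rewrite [leRHS](_ : _ = n%:R * t ^+ 2)%R; last by ring.
by rewrite mulr_ge0 ?sqr_ge0.
Qed.

(** [threshold l n x] is close to 1 when [exp(-l x) < 1/2] and close to 0 when
    [exp(-l x) >= 1/2]: it is the probability that none of [n 2^n] independent
    trials, of success probability [exp(-l x)^n] each, succeeds.  It is also a
    polynomial in [exp(-l x)], hence its expectations are read off the Laplace
    transform. *)
Definition threshold (l : R) (n : nat) (x : R) : R :=
  ((1 - expR (- (l * x)) ^+ n) ^+ (n * 2 ^ n)%N)%R.

Lemma threshold_ge0_le1 (l : R) n x : (0 <= l -> 0 <= x ->
  0 <= threshold l n x <= 1)%R.
Proof.
move=> l0 x0; have e1 : (expR (- (l * x)) ^+ n <= 1)%R.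
  by rewrite exprn_ile1 ?expR_ge0// -expR0 ler_expR oppr_le0 mulr_ge0.
rewrite /threshold exprn_ge0 ?subr_ge0//= exprn_ile1 ?subr_ge0//.
Qed.

Lemma threshold_cvg0 (l x : R) : (0 <= l -> 0 <= x -> 2^-1 <= expR (- (l * x)) ->
  threshold l n x @[n --> \oo] --> (0 : R))%R.
Proof.
move=> l0 x0 hx.
apply: (@squeeze_cvgr _ _ _ _ (fun=> 0%R) (fun n => n.+1%:R^-1)%R).
- near=> n; have /andP[-> _]/= := threshold_ge0_le1 n l0 x0.
  apply: (@le_trans _ _ (expR (- n%:R))); last first.
    rewrite expRN lef_pV2 ?posrE ?expR_gt0 ?ltr0n//.
    by rewrite -natr1 addrC expR_ge1Dx.
  apply: (@le_trans _ _ (expR (- (2^-1 ^+ n)) ^+ (n * 2 ^ n))%R).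
    rewrite lerXn2r ?nnegrE ?expR_ge0//.
      rewrite subr_ge0 exprn_ile1 ?expR_ge0//.
      by rewrite -expR0 ler_expR oppr_le0 mulr_ge0.
    rewrite (le_trans _ (expR_ge1Dx _))// lerD2l lerN2.
    by rewrite lerXn2r ?nnegrE ?expR_ge0.
  rewrite -expRM_natr natrM natrX mulrCA mulNr exprVn mulVf ?mulrN1//.
- exact: cvg_cst.
- exact: cvg_harmonic.
Unshelve. all: by end_near. Qed.

Lemma threshold_cvg1 (l x : R) : (0 <= l -> 0 <= x -> expR (- (l * x)) < 2^-1 ->
  threshold l n x @[n --> \oo] --> (1 : R))%R.
Proof.
move=> l0 x0 hx.
pose r := (2 * expR (- (l * x)))%R.
have r1 : (r < 1)%R by rewrite /r -ltr_pdivlMl// mulr1.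
have r0 : (0 < r)%R by rewrite mulr_gt0 ?expR_gt0.
pose D := (- ln r)%R.
have D0 : (0 < D)%R by rewrite oppr_gt0 ln_lt0// r0.
have rE n : (r ^+ n = (expR (n%:R * D))^-1)%R.
  by rewrite -expRN -mulrN opprK expRM_natl lnK.
have nr : (n%:R * r ^+ n @[n --> \oo] --> (0 : R))%R.
  apply: (@squeeze_cvgr _ _ _ _ (fun=> 0%R)
    (fun n => 4 / D ^+ 2 * n.+1%:R^-1)%R).
  - near=> n; rewrite mulr_ge0 ?exprn_ge0// ?(ltW r0)//=.
    rewrite rE ler_pdivrMr ?expR_gt0// mulrAC ler_pdivlMr ?ltr0n//.
    apply: (@le_trans _ _ (4 / D ^+ 2 * ((n%:R * D) ^+ 2 / 2)))%R; last first.
      rewrite ler_wpM2l ?divr_ge0 ?sqr_ge0//.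
      have := @expR_ge1Dxn _ (n%:R * D)%R 1 _; rewrite (_ : 2`! = 2)%N// => h.
      by apply: le_trans (h _); rewrite ?lerDr// mulr_ge0// ltW.
    have -> : (4 / D ^+ 2 * ((n%:R * D) ^+ 2 / 2) = 2 * n%:R ^+ 2 :> R)%R.
      by field; rewrite gt_eqF.
    rewrite -natrX -!natrM ler_nat; case: (n) => [//|m].
    by rewrite mulnS -mulnn mul2n -addnn leq_add// leq_pmulr.
  - exact: cvg_cst.
  - rewrite -[X in _ --> X](mulr0 (4 / D ^+ 2)%R).
    by apply: cvgM; [exact: cvg_cst|exact: cvg_harmonic].
apply: (@squeeze_cvgr _ _ _ _ (fun n => 1 - n%:R * r ^+ n)%R (fun=> 1%R)).
- near=> n; have /andP[_ ->]/= := threshold_ge0_le1 n l0 x0.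
  rewrite andbT.
  have t01 : (0 <= expR (- (l * x)) ^+ n <= 1)%R.
    rewrite exprn_ge0 ?expR_ge0//= exprn_ile1 ?expR_ge0//.
    by rewrite -expR0 ler_expR oppr_le0 mulr_ge0.
  apply: le_trans (bernoulli_ineq _ t01).
  by rewrite /r exprMn natrM natrX mulrA.
- by rewrite -[X in _ --> X]subr0; apply: cvgB => //; exact: cvg_cst.
- exact: cvg_cst.
Unshelve. all: by end_near. Qed.

(** The tails [X > x0] are limits of the functions [threshold l n] of [X] with
    [l = ln 2 / x0], whose expectations are combinations of values of the
    Laplace transform; for [x0 = 0] the functions [1 - exp(-n X)] do.  The
    weights [Z] and [Z'] serve to identify joint laws, one coordinate at a
    time. *)
Lemma laplace_unique {d d'} {T : measurableType d} {T' : measurableType d'}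
    (P : probability T R) (Q : probability T' R)
    (X Z : T -> R) (X' Z' : T' -> R) :
  measurable_fun [set: T] X -> measurable_fun [set: T] Z ->
  measurable_fun [set: T'] X' -> measurable_fun [set: T'] Z' ->
  (forall x, 0 <= X x)%R -> (forall x, 0 <= X' x)%R ->
  (forall x, 0 <= Z x <= 1)%R -> (forall x, 0 <= Z' x <= 1)%R ->
  (forall l : R, (0 <= l)%R ->
    \int[P]_x (Z x * expR (- (l * X x)))%:E =
    \int[Q]_x (Z' x * expR (- (l * X' x)))%:E) ->
  forall A : set R, measurable A ->
    \int[P]_(x in X @^-1` A) (Z x)%:E = \int[Q]_(x in X' @^-1` A) (Z' x)%:E.
Proof.
move=> mX mZ mX' mZ' X0 X'0 Z01 Z'01 eqL.
have eq01 (l y : R) : (0 <= l -> 0 <= y -> 0 <= expR (- (l * y)) <= 1)%R.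
  by move=> l0 y0; rewrite expR_ge0 -expR0 ler_expR oppr_le0 mulr_ge0.
(* The auxiliary facts range over all probability spaces: each is applied
   once on the side of [P] and once on the side of [Q]. *)
have mE dd (U : measurableType dd) (Y : U -> R) (l : R) :
    measurable_fun setT Y -> measurable_fun setT (fun x => expR (- (l * Y x))%R).
  move=> mY; apply: measurableT_comp => //; apply: measurableT_comp => //.
  exact: measurable_funM.
have mW dd (U : measurableType dd) (Y W : U -> R) (l l' : R) n :
    measurable_fun setT Y -> measurable_fun setT W ->
    measurable_fun setT (fun x => W x * (expR (- (l' * Y x)) *
      (1 - expR (- (l * Y x))) ^+ n))%R.
  move=> mY mWW; apply: measurable_funM => //.
  apply: measurable_funM; first exact: mE.
  by apply: measurable_funX; apply: measurable_funB => //; exact: mE.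
have iW dd (U : measurableType dd) (m : probability U R) (Y W : U -> R) (l l' : R) n :
    measurable_fun setT Y -> measurable_fun setT W ->
    (forall x, 0 <= Y x)%R -> (forall x, 0 <= W x <= 1)%R ->
    (0 <= l)%R -> (0 <= l')%R ->
    m.-integrable [set: U] (EFin \o (fun x => W x * (expR (- (l' * Y x)) *
      (1 - expR (- (l * Y x))) ^+ n))%R).
  move=> mY mWW Y0 W01 l0 l'0; apply: (@bounded_integrable _ _ _ _ 1).
    exact: mW.
  move=> x; have /andP[w0 w1] := W01 x; have /andP[e0 e1] := eq01 _ _ l0 (Y0 x).
  have /andP[e0' e1'] := eq01 _ _ l'0 (Y0 x).
  rewrite ger0_norm ?mulr_ge0 ?exprn_ge0 ?subr_ge0//.
  rewrite mulr_ile1 ?mulr_ge0 ?exprn_ge0 ?subr_ge0//.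
  rewrite mulr_ile1 ?exprn_ge0 ?subr_ge0// exprn_ile1 ?subr_ge0//.
have poly n : forall l l' : R, (0 <= l)%R -> (0 <= l')%R ->
    \int[P]_x (Z x * (expR (- (l' * X x)) * (1 - expR (- (l * X x))) ^+ n))%:E =
    \int[Q]_x (Z' x * (expR (- (l' * X' x)) * (1 - expR (- (l * X' x))) ^+ n))%:E.
  elim: n => [|n IH] l l' l0 l'0.
    under eq_integral do rewrite expr0 mulr1.
    by under [RHS]eq_integral do rewrite expr0 mulr1; exact: eqL.
  have E dd (U : measurableType dd) (m : probability U R) (Y W : U -> R) :
    measurable_fun setT Y -> measurable_fun setT W ->
    (forall x, 0 <= Y x)%R -> (forall x, 0 <= W x <= 1)%R ->
    \int[m]_x (W x * (expR (- (l' * Y x)) * (1 - expR (- (l * Y x))) ^+ n.+1))%:E =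
    \int[m]_x (W x * (expR (- (l' * Y x)) * (1 - expR (- (l * Y x))) ^+ n))%:E -
    \int[m]_x (W x * (expR (- ((l' + l) * Y x)) * (1 - expR (- (l * Y x))) ^+ n))%:E.
    move=> mY mWW Y0 W01.
    rewrite -integralB//; [|exact: iW|apply: iW => //; exact: addr_ge0].
    apply: eq_integral => x _; rewrite -EFinB; congr EFin.
    by rewrite mulrDl opprD expRD exprS; ring.
  rewrite (E _ _ P X Z mX mZ X0 Z01) (E _ _ Q X' Z' mX' mZ' X'0 Z'01).
  by congr (_ - _); apply: IH => //; exact: addr_ge0.
have tail_lim dd (U : measurableType dd) (m : probability U R) (Y W : U -> R)
    (f : nat -> R -> R) (c : R) :
    measurable_fun setT Y -> measurable_fun setT W ->
    (forall x, 0 <= Y x)%R -> (forall x, 0 <= W x <= 1)%R ->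
    (forall n, measurable_fun setT (fun x => W x * f n (Y x))%R) ->
    (forall n y, 0 <= y -> 0 <= f n y <= 1)%R ->
    (forall y, (0 <= y)%R -> f n y @[n --> \oo] --> ((c < y)%R%:R : R)) ->
    \int[m]_x (W x * f n (Y x))%:E @[n --> \oo] -->
    \int[m]_(x in Y @^-1` `]c, +oo[) (W x)%:E.
  move=> mY mWW Y0 W01 mf f01 cf.
  have mA : measurable (Y @^-1` `]c, +oo[).
    by rewrite -[X in measurable X]setTI; exact: mY.
  rewrite [X in _ --> X](_ : _ = \int[m]_x (W x * \1_(Y @^-1` `]c, +oo[) x)%:E).
    apply: (@bounded_cvg_integral _ _ _ _ _ _ 1) => //.
    - by apply: measurable_funM => //; exact: measurable_indic.
    - move=> n x; have /andP[w0 w1] := W01 x; have /andP[g0 g1] := f01 n _ (Y0 x).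
      by rewrite ger0_norm ?mulr_ge0// mulr_ile1.
    - apply: aeW => x; apply: cvgM; first exact: cvg_cst.
      rewrite indicE (_ : (x \in _) = (c < Y x)%R); first exact: cf.
      apply/idP/idP; first by rewrite inE/= in_itv/= andbT.
      by move=> h; rewrite inE/= in_itv/= andbT.
  rewrite integral_mkcond; apply: eq_integral => x _.
  by rewrite epatch_indic -EFinM.
have tail (c : R) : \int[P]_(x in X @^-1` `]c, +oo[) (Z x)%:E =
    \int[Q]_(x in X' @^-1` `]c, +oo[) (Z' x)%:E.
  have [c0|c0|c0] := ltgtP c 0%R.
  - have all dd (U : measurableType dd) (Y : U -> R) :
        (forall x, 0 <= Y x)%R -> Y @^-1` `]c, +oo[ = setT.
      move=> Y0; apply/seteqP; split => // x _ /=.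
      by rewrite in_itv/= andbT (lt_le_trans c0).
    rewrite !all//; have := eqL 0%R (lexx _).
    under eq_integral do rewrite mul0r oppr0 expR0 mulr1.
    by under [RHS]eq_integral do rewrite mul0r oppr0 expR0 mulr1.
  - pose l := (ln 2 / c)%R.
    have l0 : (0 <= l)%R by rewrite divr_ge0 ?ln_ge0 ?ler1n// ltW.
    have mT dd (U : measurableType dd) (Y W : U -> R) n :
        measurable_fun setT Y -> measurable_fun setT W ->
        measurable_fun setT (fun x => W x * threshold l n (Y x))%R.
      move=> mY mWW; apply: measurable_funM => //; apply: measurable_funX.
      by apply: measurable_funB => //; apply: measurable_funX; exact: mE.
    have ct y : (0 <= y)%R ->
        threshold l n y @[n --> \oo] --> ((c < y)%R%:R : R).
      move=> y0; have ly : (2^-1 = expR (- (l * c)))%R.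
        by rewrite /l divfK ?gt_eqF// expRN lnK// posrE.
      have [cy|yc] := ltP c y.
        apply: threshold_cvg1 => //; rewrite ly ltr_expR ltrN2 ltr_pM2l//.
        by rewrite divr_gt0// ln_gt0// ltr1n.
      by apply: threshold_cvg0 => //; rewrite ly ler_expR lerN2 ler_wpM2l.
    have t01 n y : (0 <= y -> 0 <= threshold l n y <= 1)%R.
      exact: threshold_ge0_le1.
    have L1 := tail_lim _ _ P X Z (threshold l) c mX mZ X0 Z01
      (fun n => mT _ _ _ _ n mX mZ) t01 ct.
    have L2 := tail_lim _ _ Q X' Z' (threshold l) c mX' mZ' X'0 Z'01
      (fun n => mT _ _ _ _ n mX' mZ') t01 ct.
    suff eqn : (fun n => \int[P]_x (Z x * threshold l n (X x))%:E) =
        (fun n => \int[Q]_x (Z' x * threshold l n (X' x))%:E).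
      by rewrite eqn in L1; exact: (cvg_unique _ L1 L2).
    apply/funext => n; have nl0 : (0 <= n%:R * l)%R by rewrite mulr_ge0.
    have := poly (n * 2 ^ n)%N _ 0%R nl0 (lexx _).
    have tE y : (expR (- (0 * y)) * (1 - expR (- (n%:R * l * y))) ^+ (n * 2 ^ n) =
        threshold l n y)%R.
      by rewrite mul0r oppr0 expR0 mul1r -mulrA -mulrN expRM_natl.
    under eq_integral do rewrite tE.
    by under [RHS]eq_integral do rewrite tE.
  - pose f (n : nat) (y : R) := (1 - expR (- (n%:R * y)))%R.
    have mT dd (U : measurableType dd) (Y W : U -> R) n :
        measurable_fun setT Y -> measurable_fun setT W ->
        measurable_fun setT (fun x => W x * f n (Y x))%R.
      move=> mY mWW; apply: measurable_funM => //.
      by apply: measurable_funB => //; exact: mE.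
    have f01 n y : (0 <= y -> 0 <= f n y <= 1)%R.
      move=> y0; have /andP[e0 e1] := eq01 n%:R y (ler0n _ _) y0.
      by rewrite subr_ge0 e1/= lerBlDr lerDl.
    have cf y : (0 <= y)%R -> f n y @[n --> \oo] --> ((c < y)%R%:R : R).
      rewrite c0 /f le_eqVlt => /predU1P[<-|y0].
        rewrite ltxx; under eq_fun do rewrite mulr0 oppr0 expR0 subrr.
        exact: cvg_cst.
      rewrite y0 -[X in _ --> X]subr0; apply: cvgB; first exact: cvg_cst.
      under eq_fun do rewrite -mulrN expRM_natl.
      apply: cvg_expr; rewrite ger0_norm ?expR_ge0//.
      by rewrite -expR0 ltr_expR oppr_lt0.
    have L1 := tail_lim _ _ P X Z f c mX mZ X0 Z01 (fun n => mT _ _ _ _ n mX mZ)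
      f01 cf.
    have L2 := tail_lim _ _ Q X' Z' f c mX' mZ' X'0 Z'01
      (fun n => mT _ _ _ _ n mX' mZ') f01 cf.
    suff eqn : (fun n => \int[P]_x (Z x * f n (X x))%:E) =
        (fun n => \int[Q]_x (Z' x * f n (X' x))%:E).
      by rewrite eqn in L1; exact: (cvg_unique _ L1 L2).
    apply/funext => n; have n0 : (0 <= n%:R :> R)%R by [].
    have := poly 1%N _ 0%R n0 (lexx _).
    have tE y : (expR (- (0 * y)) * (1 - expR (- (n%:R * y))) ^+ 1 = f n y)%R.
      by rewrite mul0r oppr0 expR0 mul1r expr1.
    under eq_integral do rewrite tE.
    by under [RHS]eq_integral do rewrite tE.
move=> A mA.
have /measurable_EFinP mEZ := mZ; have /measurable_EFinP mEZ' := mZ'.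
have EZ0 x : 0 <= (EFin \o Z) x by rewrite lee_fin; have /andP[] := Z01 x.
have EZ'0 x : 0 <= (EFin \o Z') x by rewrite lee_fin; have /andP[] := Z'01 x.
have mG : @RGenOInfty.G R `<=` measurable by move=> _ [x ->].
apply: (@g_sigma_algebra_measure_unique _ _ _ (@RGenOInfty.G R) mG
  (fun k => `](- k%:R)%R, +oo[%classic) _ _
  (weighted_law P mEZ EZ0 mX) (weighted_law Q mEZ' EZ'0 mX')) => //.
- by move=> k; exists (- k%:R)%R.
- apply/seteqP; split => // x _; exists (Num.truncn `|x|).+1 => //=.
  by rewrite in_itv/= andbT ltrNl (le_lt_trans (ler_norm _))// normrN truncnS_gt.
- move=> _ _ [x ->] [y ->]; exists (Num.max x y).
  by apply/seteqP; split=> z /=; rewrite !in_itv/= !andbT gt_max => /andP.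
- by move=> _ [x ->]; exact: tail.
- move=> k /=; rewrite /weighted_law (@le_lt_trans _ _ 1)// ?ltry//.
  apply: (@le_trans _ _ (\int[P]_x 1)); last first.
    by rewrite integral_cst//= mul1e probability_le1.
  apply: (@le_trans _ _ (\int[P]_x (Z x)%:E)).
    apply: ge0_subset_integral => //.
    by rewrite -[X in measurable X]setTI; exact: mX.
  by apply: ge0_le_integral => // x _; rewrite lee_fin; have /andP[] := Z01 x.
- have mA' : (@RGenOInfty.G R).-sigma.-measurable A by rewrite -RGenOInfty.measurableE.
  exact: mA'.
Qed.

End laplace_transform.

(** * Tilted Gaussian laws *)

Section gaussian_shift.
Context {R : realType}.
Local Notation mu := (@lebesgue_measure R).

Lemma integral_normal_prob (m s : R) (f : R -> R) :
  measurable_fun [set: R] f -> (forall x, 0 <= f x) ->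
  (\int[normal_prob m s]_x (f x)%:E = \int[mu]_x (f x * normal_pdf m s x)%:E)%E.
Proof.
move=> mf f0.
have mpdf : measurable_fun [set: R] (EFin \o normal_pdf m s).
  by apply/measurable_EFinP; exact: measurable_normal_pdf.
have pdf0 x : (0 <= (EFin \o normal_pdf m s) x)%E.
  by rewrite lee_fin normal_pdf_ge0.
rewrite -(integral_weighted_law mu mpdf pdf0 (@measurable_id _ (measurableTypeR R) setT))//.
Qed.

Lemma lebesgue_measure_translation (c : R) (A : set R) : measurable A ->
  pushforward mu ((fun x => x + c)%R : _ -> measurableTypeR R) A = mu A.
Proof.
move=> mA; apply/esym/lebesgue_measure_unique => //=; first exact: measurable_funD.
move=> mc _ [[a b]] _ <-; rewrite /pushforward.
rewrite (_ : _ @^-1` _ = `]a - c, b - c]%classic).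
  by rewrite /= !lebesgue_measure_itv/= !lte_fin ltrBlDr subrK -!EFinB opprB addrA subrK.
by apply/seteqP; split => x /=; rewrite !in_itv/= ltrBlDr lerBrDr.
Qed.

Lemma ge0_integral_translation (f : R -> R) (c : R) :
  measurable_fun [set: R] f -> (forall x, 0 <= f x) ->
  (\int[mu]_x (f (x + c))%:E = \int[mu]_x (f x)%:E)%E.
Proof.
move=> mf f0.
have mc : measurable_fun setT ((fun x => x + c)%R : _ -> measurableTypeR R).
  exact: measurable_funD.
transitivity (\int[pushforward mu ((fun x => x + c)%R : _ -> measurableTypeR R)]_x
    (f x)%:E)%E.
  rewrite ge0_integral_pushforward//; first exact/measurable_EFinP.
  by move=> y _; rewrite lee_fin.
by apply: eq_measure_integral => //= A mA _; exact: lebesgue_measure_translation.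
Qed.

Lemma ge0_integral_reflection (f : R -> R) :
  measurable_fun [set: R] f -> (forall x, 0 <= f x) ->
  (\int[mu]_x (f (- x))%:E = \int[mu]_x (f x)%:E)%E.
Proof.
move=> mf f0.
transitivity (\int[pushforward mu (-%R : _ -> measurableTypeR R)]_x (f x)%:E)%E.
  rewrite ge0_integral_pushforward//; first exact/measurable_EFinP.
  by move=> y _; rewrite lee_fin.
by apply: eq_measure_integral => //= A mA _; exact: lebesgue_measureN.
Qed.

(** The exponential martingale [exp(c W - c^2 u / 2)] of [W = x / v] at time
    [u = 1 / v]. *)
Definition tilt (c v x : R) : R := expR (c * (x / v) - c ^+ 2 / (2 * v)).

Lemma tilt_ge0 c v x : 0 <= tilt c v x. Proof. exact: expR_ge0. Qed.

Lemma measurable_tilt c v : measurable_fun [set: R] (tilt c v).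
Proof.
apply: measurableT_comp => //; apply: measurable_funB => //.
by apply: measurable_funM => //; exact: measurable_funM.
Qed.

(** Completing the square: tilting a centred Gaussian translates it. *)
Lemma normal_pdf_tilt (c v x : R) : 0 < v ->
  normal_pdf 0 (Num.sqrt v) x * tilt c v x = normal_pdf 0 (Num.sqrt v) (x - c).
Proof.
move=> v0; rewrite !normal_pdfE ?gt_eqF ?sqrtr_gt0//.
rewrite -mulrA; congr (_ * _).
rewrite /normal_fun /tilt -expRD sqr_sqrtr ?ltW//; congr expR.
by field; rewrite gt_eqF.
Qed.

Lemma normal_prob_tilt (c v : R) (A : set R) : 0 < v -> measurable A ->
  (\int[normal_prob 0 (Num.sqrt v)]_x (\1_A x * tilt c v x)%:E =
   normal_prob 0 (Num.sqrt v) [set x | A (x + c)%R])%E.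
Proof.
move=> v0 mA.
have mAc : measurable [set x | A (x + c)].
  have mc : measurable_fun [set: R] (fun x : R => x + c) by exact: measurable_funD.
  by rewrite -[X in measurable X]setTI; exact: mc.
have mIA : measurable_fun [set: R] (\1_A : R -> R) by exact: measurable_indic.
rewrite integral_normal_prob//; last 2 first.
- by apply: measurable_funM => //; exact: measurable_tilt.
- by move=> x; rewrite mulr_ge0 ?tilt_ge0.
rewrite /normal_prob [RHS]integral_mkcond.
transitivity (\int[mu]_x (\1_A x * normal_pdf 0 (Num.sqrt v) (x - c)%R)%:E)%E.
  by apply: eq_integral => x _; rewrite -normal_pdf_tilt// mulrAC mulrA.
rewrite -(ge0_integral_translation c); last 2 first.
- apply: measurable_funM => //.
  apply: (measurableT_comp (measurable_normal_pdf 0 (Num.sqrt v))).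
  exact: measurable_funB.
- by move=> x; rewrite mulr_ge0 ?normal_pdf_ge0.
apply: eq_integral => x _; rewrite epatch_indic /= addrK EFinM muleC.
by congr (_ * _)%E; rewrite !indicE.
Qed.

(** A centred Gaussian is symmetric, by the symmetry of Lebesgue measure. *)
Lemma normal_probN (s : R) (A : set R) : s != 0 -> measurable A ->
  normal_prob 0 s [set x | A (- x)] = normal_prob 0 s A.
Proof.
move=> s0 mA.
have mAc : measurable [set x : R | A (- x)].
  have mc : measurable_fun [set: R] (-%R : R -> R) by exact: oppr_measurable.
  by rewrite -[X in measurable X]setTI; exact: mc.
rewrite /normal_prob [LHS]integral_mkcond [RHS]integral_mkcond.
transitivity (\int[mu]_x (\1_A x * normal_pdf 0 s x)%:E)%E; last first.
  by apply: eq_integral => x _; rewrite epatch_indic /= muleC.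
rewrite -ge0_integral_reflection; last 2 first.
- apply: measurable_funM; first exact: measurable_indic.
  exact: measurable_normal_pdf.
- by move=> x; rewrite mulr_ge0 ?normal_pdf_ge0.
apply: eq_integral => x _; rewrite epatch_indic /= [RHS]EFinM [LHS]muleC.
by rewrite !normal_pdfE// /normal_fun !subr0 sqrrN !indicE.
Qed.

End gaussian_shift.

Section reverse_martingale.
Context {R : realType} {d : measure_display} {T : measurableType d}.
Variable P : probability T R.

(** Cameron-Martin for one Gaussian variable [X] independent of the event [C]:
    under the tilted measure [X] is translated and [C] is unaffected. *)
Lemma tilt_shift_indep (X : T -> R) (C : set T) (v c : R) :
  measurable_fun [set: T] X -> measurable C -> 0 < v ->
  (forall A : set R, measurable A ->
    P (X @^-1` A `&` C) = (normal_prob 0 (Num.sqrt v) A * P C)%E) ->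
  forall A : set R, measurable A ->
    (\int[P]_(w in X @^-1` A `&` C) (tilt c v (X w))%:E =
     P ([set w | A (X w + c)%R] `&` C))%E.
Proof.
move=> mX mC v0 XC A mA.
have mXA B : measurable B -> measurable (X @^-1` B).
  by move=> mB; rewrite -[_ @^-1` _]setTI; exact: mX.
have mI : measurable_fun [set: T] (EFin \o (\1_C : T -> R)).
  by apply/measurable_EFinP; exact: measurable_indic.
have I0 x : (0 <= (EFin \o (\1_C : T -> R)) x)%E by rewrite lee_fin.
have mAc : measurable [set x | A (x + c)].
  have mc : measurable_fun [set: R] (fun x : R => x + c) by exact: measurable_funD.
  by rewrite -[X in measurable X]setTI; exact: mc.
have mf : measurable_fun [set: R] (fun x => \1_A x * tilt c v x : R).
  by apply: measurable_funM; [exact: measurable_indic|exact: measurable_tilt].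
transitivity (\int[P]_w ((\1_A (X w) * tilt c v (X w)) * \1_C w)%:E)%E.
  rewrite integral_mkcond; apply: eq_integral => w _.
  rewrite epatch_indic /= -EFinM indicI/=; congr EFin.
  by rewrite (_ : \1_A (X w) = \1_(X @^-1` A) w)//; ring.
have f0 y : 0 <= \1_A y * tilt c v y by rewrite mulr_ge0 ?tilt_ge0.
rewrite -(@integral_weighted_law _ _ _ P _ (measurableTypeR R) (\1_C) mI I0 X mX
  (fun y => \1_A y * tilt c v y) mf f0).
pose p : {nonneg R} := NngNum (fine_ge0 (measure_ge0 P C)).
transitivity (\int[mscale p (normal_prob 0 (Num.sqrt v))]_y (\1_A y * tilt c v y)%:E)%E.
  apply: eq_measure_integral => /= B mB _.
  rewrite /weighted_law integral_indic//; last exact: mXA.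
  by rewrite setIC; have := XC B mB => /= ->; rewrite /mscale/= fineK ?fin_num_measure// muleC.
rewrite ge0_integral_mscale//; last 2 first.
- exact/measurable_EFinP.
- by move=> y _; rewrite lee_fin mulr_ge0 ?tilt_ge0.
transitivity (p%:num%:E * normal_prob 0 (Num.sqrt v) [set x | A (x + c)%R])%E.
  by congr (_ * _)%E; exact: normal_prob_tilt.
rewrite (_ : [set w | _] = X @^-1` [set x | A (x + c)])//.
by rewrite XC//= fineK ?fin_num_measure// muleC.
Qed.

(** The same when only one summand [X] is tilted and the sum [X + Y] is
    observed: tilting [X] amounts to translating the pair [(X, Y)], hence the
    sum, by the same amount [c], whatever the variance of [X]. *)
Lemma tilt_shift_sum (X Y : T -> R) (C : set T) (v c : R) :
  measurable_fun [set: T] X -> measurable_fun [set: T] Y -> measurable C -> 0 < v ->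
  (forall A A' : set R, measurable A -> measurable A' ->
    P (X @^-1` A `&` (Y @^-1` A' `&` C)) =
    (normal_prob 0 (Num.sqrt v) A * P (Y @^-1` A' `&` C))%E) ->
  forall A : set R, measurable A ->
    (\int[P]_(w in [set w | A (X w + Y w)%R] `&` C) (tilt c v (X w))%:E =
     P ([set w | A (X w + Y w + c)%R] `&` C))%E.
Proof.
move=> mX mY mC v0 XYC A mA.
have mXA B : measurable B -> measurable (X @^-1` B).
  by move=> mB; rewrite -[_ @^-1` _]setTI; exact: mX.
have mYA B : measurable B -> measurable (Y @^-1` B).
  by move=> mB; rewrite -[_ @^-1` _]setTI; exact: mY.
have mXY : measurable_fun [set: T] (fun w => (X w, Y w)) by exact: measurable_fun_pair.
have mXcY : measurable_fun [set: T] (fun w => (X w + c, Y w)).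
  by apply: measurable_fun_pair => //; exact: measurable_funD.
have mg1 : measurable_fun [set: T]
    (EFin \o (fun w => tilt c v (X w) * \1_C w : R)).
  apply/measurable_EFinP; apply: measurable_funM; last exact: measurable_indic.
  exact: (measurableT_comp (measurable_tilt c v)).
have g10 x : (0 <= (EFin \o (fun w => tilt c v (X w) * \1_C w : R)%R) x)%E.
  by rewrite lee_fin mulr_ge0 ?tilt_ge0.
have mg2 : measurable_fun [set: T] (EFin \o (\1_C : T -> R)).
  by apply/measurable_EFinP; exact: measurable_indic.
have g20 x : (0 <= (EFin \o (\1_C : T -> R)) x)%E by rewrite lee_fin.
pose m1 := weighted_law P mg1 g10 mXY.
pose m2 := weighted_law P mg2 g20 mXcY.
have m1E D : measurable D -> m1 D =
    (\int[P]_(w in [set w | D (X w, Y w)] `&` C) (tilt c v (X w))%:E)%E.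
  move=> mD; rewrite /m1 /weighted_law integral_mkcondr.
  by apply: eq_integral => w _; rewrite epatch_indic /= EFinM.
have m2E D : measurable D -> m2 D = P ([set w | D (X w + c, Y w)%R] `&` C).
  move=> mD; rewrite /m2 /weighted_law integral_indic//.
    by rewrite setIC.
  by rewrite -[X in measurable X]setTI; exact: (mXcY measurableT D mD).
have eqm D : measurable D -> m1 D = m2 D.
  move=> mD.
  pose G : set (set (R * R)) := [set A1 `*` A2 | A1 in measurable & A2 in measurable].
  have Gm : G `<=` measurable.
    by move=> _ [A1 mA1 [A2 mA2 <-]]; exact: measurableX.
  apply: (@g_sigma_algebra_measure_unique _ _ _ G Gm (fun=> setT) _ _ m1 m2) => //.
  - by move=> _; exists setT => //; exists setT => //; rewrite setXTT.
  - by rewrite bigcup_const.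
  - move=> _ _ [A1 mA1 [A2 mA2 <-]] [B1 mB1 [B2 mB2 <-]].
    exists (A1 `&` B1); first exact: measurableI.
    by exists (A2 `&` B2); [exact: measurableI|rewrite setXI].
  - move=> _ [A1 mA1 [A2 mA2 <-]]; have mA12 := measurableX mA1 mA2.
    apply: etrans (m1E _ mA12) _; apply: etrans (esym (m2E _ mA12)).
    rewrite (_ : [set w | (A1 `*` A2) (X w, Y w)] `&` C =
      X @^-1` A1 `&` (Y @^-1` A2 `&` C)); last by rewrite setIA.
    rewrite (tilt_shift_indep c mX _ v0)//.
    + by rewrite setIA.
    + by apply: measurableI => //; exact: mYA.
    + by move=> A' mA'; rewrite XYC.
  - move=> k; rewrite [ltLHS]m1E// (_ : _ `&` C = X @^-1` setT `&` (Y @^-1` setT `&` C)).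
      rewrite (tilt_shift_indep c mX _ v0)//.
      + by rewrite (le_lt_trans (probability_le1 _ _)) ?ltry// preimage_setT !setTI.
      + by rewrite preimage_setT setTI.
      + by move=> A' mA'; rewrite XYC.
    by rewrite !preimage_setT !setTI.
  - by move: mD; rewrite measurable_prod_measurableType.
have mD : measurable [set z : R * R | A (z.1 + z.2)].
  have ma : measurable_fun [set: R * R] (fun z : R * R => z.1 + z.2).
    by apply: measurable_funD.
  by rewrite -[X in measurable X]setTI; exact: ma.
have := eqm _ mD; rewrite m1E// m2E//= => ->.
by congr (P (_ `&` _)); apply/seteqP; split => w /=; rewrite addrAC.
Qed.

End reverse_martingale.

(** * The exponential martingale of the time-inverted path *)

Section brownian_time_reversal.
Context {R : realType} {d : measure_display} {T : measurableType d}.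
Variable P : probability T R.
Variable B : R -> T -> R.
Hypothesis hB : standard_brownian_motion P B.

Let mB t : 0 <= t -> measurable_fun [set: T] (B t).
Proof. by case: hB => h _ _ _ _; exact: h. Qed.

Let mBB s t : 0 <= s -> 0 <= t -> measurable_fun [set: T] (fun w => B t w - B s w).
Proof. by move=> s0 t0; apply: measurable_funB; exact: mB. Qed.

Let mpre s t (A : set R) : 0 <= s -> 0 <= t -> measurable A ->
  measurable ((fun w => B t w - B s w) @^-1` A).
Proof. by move=> s0 t0 mA; rewrite -[_ @^-1` _]setTI; exact: mBB. Qed.

Definition incr (q : nat -> R) (i : nat) (w : T) : R := B (q i.+1) w - B (q i) w.

Definition incr_rect (q : nat -> R) (k : nat) (A : nat -> set R) : set T :=
  \bigcap_(i in `I_k) incr q i @^-1` A i.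

Definition incr_rects (q : nat -> R) (k : nat) : set (set T) :=
  [set E | exists2 A : nat -> set R, (forall i, measurable (A i)) &
                                     E = incr_rect q k A].

Let grid_ge0 (q : nat -> R) k : 0 <= q 0%N ->
  (forall i, (i < k)%N -> q i <= q i.+1) ->
  forall i, (i <= k)%N -> 0 <= q i.
Proof.
move=> q0 qi; elim => [//|i IH] ik.
by rewrite (le_trans (IH (ltnW ik)))// qi.
Qed.

Lemma measurable_incr_rect (q : nat -> R) k (A : nat -> set R) :
  0 <= q 0%N -> (forall i, (i < k)%N -> q i <= q i.+1) ->
  (forall i, measurable (A i)) -> measurable (incr_rect q k A).
Proof.
move=> q0 qi mA; apply: bigcap_measurableType => i /= ik; apply: mpre => //.
  exact: (grid_ge0 q0 qi (ltnW ik)).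
exact: (grid_ge0 q0 qi ik).
Qed.

Lemma incr_rect_prob (q : nat -> R) k (A : nat -> set R) :
  0 <= q 0%N -> (forall i, (i < k)%N -> q i <= q i.+1) ->
  (forall i, measurable (A i)) ->
  P (incr_rect q k A) =
  (\prod_(i < k) P (incr q i @^-1` A i))%E.
Proof.
case: hB => _ _ _ indep _ q0 qi mA.
rewrite -(indep k q q0 qi (fun i => A i) (fun i => mA i)); congr (P _).
apply/seteqP; split => w h i /=; first by move=> _; exact: (h i (ltn_ord i)).
by move=> ik; exact: (h (Ordinal ik) I).
Qed.

Lemma incr_rectS (q : nat -> R) k (A : nat -> set R) :
  incr_rect q k.+1 A =
  incr q 0 @^-1` A 0%N `&`
  incr_rect (q \o S) k (A \o S).
Proof.
apply/seteqP; split=> w.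
  by move=> h; split=> [|i ik]; [exact: (h 0%N)|exact: (h i.+1)].
by move=> [h0 h] [|i] ik //; exact: (h i).
Qed.

Lemma incr_rect_head (q : nat -> R) k (A : nat -> set R) :
  0 <= q 0%N -> (forall i, (i < k.+1)%N -> q i <= q i.+1) ->
  (forall i, measurable (A i)) ->
  P (incr_rect q k.+1 A) =
  (P (incr q 0 @^-1` A 0%N) *
   P (incr_rect (q \o S) k (A \o S)))%E.
Proof.
move=> q0 qi mA; rewrite incr_rect_prob// incr_rect_prob//.
- by rewrite big_ord_recl.
- by rewrite /= (grid_ge0 q0 qi).
- by move=> i ik; exact: qi.
- by move=> i; exact: mA.
Qed.

Lemma integral_tilt (s c : R) : 0 < s ->
  (\int[P]_w (tilt c s (B s w - B 0 w))%:E = 1)%E.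
Proof.
move=> s0.
have C0 : forall A : set R, measurable A ->
    P ((fun w => B s w - B 0 w) @^-1` A `&` setT) =
    (normal_prob 0 (Num.sqrt s) A * P setT)%E.
  move=> A mA; rewrite setIT probability_setT mule1.
  by rewrite -[X in Num.sqrt X]subr0; case: hB => _ _ _ _ <-.
have mX : measurable_fun setT (fun w => B s w - B 0 w).
  by apply: mBB => //; exact: ltW.
have := tilt_shift_indep c mX measurableT s0 C0 measurableT.
rewrite preimage_setT !setTI => ->.
by rewrite -[RHS](@probability_setT _ _ _ P); congr (P _); exact/seteqP.
Qed.

(** The exponential martingale of the time-inverted path [u B(1/u)], read in
    the original time: as [s] decreases, [tilt c s (B s)] is a martingale for
    the sigma-algebras of the future after [s].  Indeed tilting by it
    translates the whole future of [B] after [s] by [c], whatever [s]. *)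
Lemma reverse_tilt (q : nat -> R) (k : nat) (s c : R) :
  q 0%N = 0 -> 0 < s -> s < q 1%N ->
  (forall i, (i < k.+1)%N -> q i <= q i.+1) ->
  forall f : g_sigma_algebraType (incr_rects q k.+1) -> R,
  measurable_fun setT f -> (forall w, 0 <= f w) ->
  (\int[P]_w (f w * tilt c s (B s w - B 0 w))%:E =
   \int[P]_w (f w * tilt c (q 1%N) (B (q 1%N) w - B 0 w))%:E)%E.
Proof.
move=> q0 s0 sq1 qi f mf f0.
have normal u v (A : set R) : 0 <= u -> u < v -> measurable A ->
    P [set w | A (B v w - B u w)] = normal_prob 0 (Num.sqrt (v - u)) A.
  by move=> u0 uv mA; case: hB => _ _ _ _ h; exact: h.
have q10 : 0 < q 1%N := lt_trans s0 sq1.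
have q00 : 0 <= q 0%N by rewrite q0.
have mtilt u : 0 <= u ->
    measurable_fun [set: T] (fun w => tilt c u (B u w - B 0 w)).
  move=> u0; apply: (measurableT_comp (measurable_tilt c u)).
  exact: mBB.
have eqG E : incr_rects q k.+1 E ->
    (\int[P]_(w in E) (tilt c s (B s w - B 0 w))%:E =
     \int[P]_(w in E) (tilt c (q 1%N) (B (q 1%N) w - B 0 w))%:E)%E.
  move=> [A mA ->]; rewrite incr_rectS /incr q0.
  set C := incr_rect (q \o S) k (A \o S).
  have mC : measurable C.
    apply: measurable_incr_rect => //; first by rewrite /= ltW.
      by move=> i ik; exact: qi.
    by move=> i; exact: mA.
  pose X w := B s w - B 0 w; pose Y w := B (q 1%N) w - B s w.
  have XY w : B (q 1%N) w - B 0 w = X w + Y w by rewrite /X /Y; ring.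
  have mX : measurable_fun setT X by apply: mBB => //; exact: ltW.
  have mY : measurable_fun setT Y by apply: mBB => //; exact: ltW.
  transitivity (P ([set w | A 0%N (X w + Y w + c)%R] `&` C)).
    rewrite (_ : _ @^-1` A 0%N = [set w | A 0%N (X w + Y w)]); last first.
      by apply/seteqP; split => w /=; rewrite XY.
    apply: (tilt_shift_sum c mX mY mC s0) => // A1 A2 mA1 mA2.
    pose q' i := if i is j.+1 then (if j is l.+1 then q l.+1 else s) else 0.
    pose A' i := if i is j.+1 then (if j is l.+1 then A l.+1 else A2) else A1.
    have q'i i : (i < k.+2)%N -> q' i <= q' i.+1.
      by case: i => [|[|i]] //= ik; [rewrite ltW|rewrite ltW|exact: qi].
    have mA' i : measurable (A' i) by case: i => [|[|i]]; [exact: mA1|exact: mA2|exact: mA].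
    have -> : Y @^-1` A2 `&` C = incr_rect (q' \o S) k.+1 (A' \o S).
      by rewrite incr_rectS; congr (_ `&` _).
    have -> : X @^-1` A1 `&` incr_rect (q' \o S) k.+1 (A' \o S) =
        incr_rect q' k.+2 A' by rewrite [RHS]incr_rectS.
    rewrite incr_rect_head//=; congr (_ * _)%E.
    by rewrite /incr/= -[X in Num.sqrt X]subr0 -normal.
  have -> : [set w | A 0%N (X w + Y w + c)] =
      [set w | A 0%N (B (q 1%N) w - B 0 w + c)].
    by apply/seteqP; split => w /=; rewrite XY.
  apply/esym; apply: (tilt_shift_indep c _ mC q10) => //.
    by apply: mBB => //; exact: ltW.
  move=> A1 mA1.
  pose A' i := if i is j.+1 then A j.+1 else A1.
  have mA' i : measurable (A' i) by case: i => [|i]; [exact: mA1|exact: mA].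
  rewrite (_ : _ `&` C = incr_rect q k.+1 A'); last first.
    by rewrite incr_rectS /incr q0.
  rewrite incr_rect_head// /incr q0; congr (_ * _)%E.
  by rewrite -[X in Num.sqrt X]subr0 -normal.
have GT : incr_rects q k.+1 [set: T].
  exists (fun=> setT) => //; apply/seteqP; split => // w _ i _ //.
apply: (@eq_integral_weighted _ _ _ P (incr_rects q k.+1)) => //.
- by move=> _ [A mA ->]; exact: measurable_incr_rect.
- move=> _ _ [A mA ->] [A' mA' ->]; exists (fun i => A i `&` A' i).
    by move=> i; exact: measurableI.
  apply/seteqP; split => w.
    by move=> [h h'] i ik; split; [exact: h|exact: h'].
  by move=> h; split => i ik; have [] := h i ik.
- by apply: mtilt; exact: ltW.
- by apply: mtilt; exact: ltW.
- by move=> w; exact: tilt_ge0.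
- by move=> w; exact: tilt_ge0.
- by rewrite integral_tilt ?ltry.
Qed.

End brownian_time_reversal.

Section discrete_martingale.
Context {R : realType} {d : measure_display} {T : measurableType d}.
Variable P : probability T R.
Variable B : R -> T -> R.
Hypothesis hB : standard_brownian_motion P B.

(** The time-inverted path; since [0^-1 = 0], it vanishes at time 0. *)
Definition inverted (u : R) (w : T) : R := u * (B u^-1 w - B 0 w).
Local Notation W := inverted.

Lemma inverted0 w : W 0 w = 0. Proof. by rewrite /inverted mul0r. Qed.

Lemma measurable_inverted u : 0 <= u -> measurable_fun [set: T] (W u).
Proof.
case: hB => mB _ _ _ _ u0; apply: measurable_funM => //.
by apply: measurable_funB; apply: mB => //; rewrite invr_ge0.
Qed.

Lemma tilt_inverted c u w : u != 0 ->
  tilt c u^-1 (B u^-1 w - B 0 w) = expR (c * W u w - c ^+ 2 * u / 2).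
Proof. by move=> u0; congr expR; rewrite /W; field. Qed.

Section grid.
Variables (h : R) (h0 : 0 < h).

(** The instants [1/(l h)] for [l = k, ..., 1], in increasing order after 0:
    for the time-inverted path they are the grid times [l h], run backwards. *)
Definition grid_times (k i : nat) : R :=
  if i is 0 then 0 else ((k.+1 - i)%:R * h)^-1.

(** The sigma-algebra of the first [k] grid values of the time-inverted path,
    presented by rectangles in the increments of [B] after time [1/(k h)]. *)
Definition grid_events (k : nat) : set (set T) :=
  incr_rects B (grid_times k) k.
Local Notation filt k := (g_sigma_algebraType (grid_events k)).

Lemma grid_times_nd k i : (i < k)%N -> grid_times k i <= grid_times k i.+1.
Proof.
case: i => [|i] ik /=; first by rewrite invr_ge0 mulr_ge0// ltW.
rewrite !subSS lef_pV2 ?posrE ?mulr_gt0 ?ltr0n ?subn_gt0//; last exact: ltnW.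
by rewrite ler_pM2r// ler_nat leq_sub2l.
Qed.

Lemma measurable_grid_incr k i : (i < k)%N ->
  measurable_fun setT (incr B (grid_times k) i : filt k -> R).
Proof.
move=> ik _ A mA; rewrite setTI; apply: sub_sigma_algebra.
exists (fun j => if j == i then A else setT).
  by move=> j; case: ifP.
apply/seteqP; split => w /=.
  by move=> Aw j jk /=; case: eqP => // ->.
by move=> /(_ i ik) /=; rewrite eqxx.
Qed.

Lemma measurable_grid_inverted k l : (l <= k)%N ->
  measurable_fun setT (W (l%:R * h) : filt k -> R).
Proof.
case: l => [|l] lk.
  rewrite mul0r (_ : W 0 = cst 0); first exact: measurable_cst.
  by apply/funext => w; rewrite inverted0.
have tele n : (n <= k)%N -> measurable_fun setT
    ((fun w => B (grid_times k n) w - B 0 w) : filt k -> R).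
  elim: n => [_|n IH nk].
    rewrite (_ : (fun w => _) = cst 0); first exact: measurable_cst.
    by apply/funext => w; rewrite /= subrr.
  rewrite (_ : (fun w => _) = (fun w => incr B (grid_times k) n w +
      (B (grid_times k n) w - B 0 w))); last first.
    by apply/funext => w; rewrite /incr addrA subrK.
  apply: measurable_funD; first exact: measurable_grid_incr.
  by apply: IH; exact: ltnW.
apply: measurable_funM; first exact: measurable_cst.
have -> : (l.+1%:R * h)^-1 = grid_times k (k - l).
  rewrite /grid_times; case E : (k - l)%N => [|m]; first by lia.
  by congr (_%:R * h)^-1; lia.
by apply: tele; exact: leq_subr.
Qed.

(** One step of the exponential martingale of the time-inverted path, tested
    against nonnegative functions of its past. *)
Lemma grid_martingale k c (f : filt k -> R) :
  measurable_fun setT f -> (forall w, 0 <= f w) ->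
  (\int[P]_w (f w * expR (c * W (k.+1%:R * h) w - c ^+ 2 * (k.+1%:R * h) / 2))%:E =
   \int[P]_w (f w * expR (c * W (k%:R * h) w - c ^+ 2 * (k%:R * h) / 2))%:E)%E.
Proof.
have kh j : j.+1%:R * h != 0 by rewrite mulf_neq0 ?gt_eqF.
have kh0 j : 0 < (j.+1%:R * h)^-1 by rewrite invr_gt0 mulr_gt0.
have mexp j : measurable_fun [set: T]
    (fun w => expR (c * W (j%:R * h) w - c ^+ 2 * (j%:R * h) / 2)).
  apply: measurableT_comp => //; apply: measurable_funB => //.
  apply: measurable_funM => //; apply: measurable_inverted.
  by rewrite mulr_ge0// ltW.
case: k f => [|k] f mf f0.
  apply: (@eq_integral_weighted _ _ _ P (grid_events 0) _ _) => //.
  - by move=> _ [A _ ->]; rewrite /incr_rect bigcap_mkord big_ord0.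
  - move=> _ _ [A _ ->] [A' _ ->]; exists (fun=> setT) => //.
    by rewrite /incr_rect !bigcap_mkord !big_ord0 setTI.
  - by exists (fun=> setT) => //; rewrite /incr_rect bigcap_mkord big_ord0.
  - under eq_integral do rewrite -tilt_inverted//.
    by rewrite (integral_tilt hB)// ltry.
  - move=> _ [A _ ->]; rewrite /incr_rect bigcap_mkord big_ord0.
    under eq_integral do rewrite -tilt_inverted//.
    rewrite (integral_tilt hB)//; under eq_integral => w _.
      by rewrite mul0r inverted0 !mulr0 mul0r subr0 expR0; over.
    by rewrite integral_cst//= mul1e probability_setT.
have := @reverse_tilt _ _ _ P B hB (grid_times k.+1) k (k.+2%:R * h)^-1 c erefl.
rewrite /= subSS subn0; move=> /(_ (kh0 _)) H.
under eq_integral do rewrite -tilt_inverted//.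
under [RHS]eq_integral do rewrite -tilt_inverted//.
apply: H => //.
  by rewrite ltf_pV2 ?posrE ?mulr_gt0// ltr_pM2r// ltr_nat.
by move=> i ik; exact: grid_times_nd.
Qed.

End grid.
End discrete_martingale.

Section grid_exponential.
Context {R : realType} {d : measure_display} {T : measurableType d}.
Variable P : probability T R.
Variable B : R -> T -> R.
Hypothesis hB : standard_brownian_motion P B.
Variables (h : R) (h0 : 0 < h).
Local Notation W := (inverted B).
Local Notation filt k := (g_sigma_algebraType (grid_events B h k)).

Lemma measurable_filt k (f : T -> R) :
  measurable_fun setT (f : filt k -> R) -> measurable_fun [set: T] f.
Proof.
move=> mf _ A mA; rewrite setTI.
have := mf measurableT A mA; rewrite setTI.
apply: smallest_sub; first exact: sigma_algebra_measurable.
move=> _ [A' mA' ->]; apply: (measurable_incr_rect hB) => //.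
exact: (grid_times_nd h0).
Qed.

(* [J l] selects, among [q] coefficients, the one in force during step [l]; it
   is a function of the grid values up to [l]. *)
Variables (J : nat -> T -> nat) (q : nat).
Hypothesis Jq : forall l w, (J l w < q)%N.
Hypothesis mJ : forall l k, (l <= k)%N -> forall j,
  measurable_fun setT ((fun w => (J l w == j)%:R) : filt k -> R).

(** The exponent of the stochastic exponential with the predictable coefficient
    [mu (J l)]. *)
Definition grid_exponent (mu : nat -> R) (N : nat) (w : T) : R :=
  \sum_(l < N) (mu (J l w) * (W (l.+1%:R * h) w - W (l%:R * h) w) -
                mu (J l w) ^+ 2 * h / 2).

Let J_decomp (g : nat -> R) l w : g (J l w) = \sum_(j < q) (J l w == j)%:R * g j.
Proof.
rewrite (bigD1 (Ordinal (Jq l w)))//= eqxx mul1r big1 ?addr0// => i ij.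
case: eqP => [E|]; last by rewrite mul0r.
by move: ij; rewrite -val_eqE /= -E eqxx.
Qed.

Let mgJ (g : nat -> R) l k : (l <= k)%N ->
  measurable_fun setT ((fun w => g (J l w)) : filt k -> R).
Proof.
move=> lk; rewrite (_ : (fun w => _) = (fun w => \sum_(j < q) (J l w == j)%:R * g j)).
  apply: measurable_sum => j; apply: measurable_funM => //.
  exact: mJ.
by apply/funext => w; rewrite J_decomp.
Qed.

Lemma measurable_grid_exponent mu N :
  measurable_fun setT (grid_exponent mu N : filt N -> R).
Proof.
apply: measurable_sum => l; have lN := ltn_ord l.
apply: measurable_funB.
  apply: measurable_funM; first by apply: mgJ; exact: ltnW.
  by apply: measurable_funB; apply: measurable_grid_inverted => //; exact: ltnW.
apply: measurable_funM => //; apply: measurable_funM => //.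
by apply: measurable_funX; apply: mgJ; exact: ltnW.
Qed.

(** On each of the finitely many events [J N = j] the last step is a step of the
    exponential martingale with the constant coefficient [mu j]. *)
Lemma grid_exponent_mean (mu : nat -> R) N :
  (\int[P]_w (expR (grid_exponent mu N w))%:E = 1)%E.
Proof.
elim: N => [|N IH].
  under eq_integral do rewrite /grid_exponent big_ord0 expR0.
  by rewrite integral_cst//= mul1e probability_setT.
have mE : measurable_fun setT ((fun w => expR (grid_exponent mu N w)) : filt N -> R).
  by apply: measurableT_comp => //; exact: measurable_grid_exponent.
pose D j w := expR (mu j * W (N.+1%:R * h) w - mu j ^+ 2 * (N.+1%:R * h) / 2).
pose D' j w := expR (mu j * W (N%:R * h) w - mu j ^+ 2 * (N%:R * h) / 2).
pose f j w := (J N w == j)%:R * expR (grid_exponent mu N w) / D' j w.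
have mf j : measurable_fun setT (f j : filt N -> R).
  apply: measurable_funM; first by apply: measurable_funM => //; exact: mJ.
  rewrite (_ : (fun w => _) = (fun w =>
    expR (- (mu j * W (N%:R * h) w - mu j ^+ 2 * (N%:R * h) / 2)))); last first.
    by apply/funext => w; rewrite expRN.
  apply: measurableT_comp => //; apply: measurableT_comp => //.
  apply: measurable_funB => //; apply: measurable_funM => //.
  exact: measurable_grid_inverted.
have f0 j w : 0 <= f j w by rewrite !mulr_ge0 ?invr_ge0 ?expR_ge0.
have mD j n : measurable_fun [set: T]
    (fun w => expR (mu j * W (n%:R * h) w - mu j ^+ 2 * (n%:R * h) / 2)).
  apply: measurableT_comp => //; apply: measurable_funB => //.
  apply: measurable_funM => //; apply: (measurable_inverted hB).
  by rewrite mulr_ge0// ltW.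
have mfT j := measurable_filt (mf j).
transitivity (\int[P]_w (\sum_(j < q) (f j w * D j w)%:E))%E.
  apply: eq_integral => w _; rewrite sumEFin; congr EFin.
  have -> : grid_exponent mu N.+1 w = grid_exponent mu N w +
      (mu (J N w) * (W (N.+1%:R * h) w - W (N%:R * h) w) - mu (J N w) ^+ 2 * h / 2).
    by rewrite /grid_exponent big_ord_recr.
  rewrite expRD.
  rewrite (J_decomp (fun j => expR (mu j * (W (N.+1%:R * h) w - W (N%:R * h) w) -
    mu j ^+ 2 * h / 2))).
  rewrite mulr_sumr; apply: eq_bigr => j _.
  rewrite /f /D /D' -expRN mulrCA -[RHS]mulrA -[RHS]mulrA; congr (_ * (_ * _)).
  by rewrite -expRD -natr1; congr expR; ring.
rewrite ge0_integral_sum//; last 2 first.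
- move=> j; apply/measurable_EFinP; apply: measurable_funM => //; exact: mD.
- by move=> j w _; rewrite lee_fin mulr_ge0 ?expR_ge0.
transitivity (\sum_(j < q) \int[P]_w (f j w * D' j w)%:E)%E.
  by apply: eq_bigr => j _; apply: (grid_martingale hB h0).
rewrite -ge0_integral_sum//; last 2 first.
- move=> j; apply/measurable_EFinP; apply: measurable_funM => //; exact: mD.
- by move=> j w _; rewrite lee_fin mulr_ge0 ?expR_ge0.
rewrite -IH; apply: eq_integral => w _; rewrite sumEFin; congr EFin.
rewrite [RHS](_ : _ = \sum_(j < q) (J N w == j)%:R * expR (grid_exponent mu N w)).
  by apply: eq_bigr => j _; rewrite /f mulfVK// gt_eqF ?expR_gt0.
exact: (J_decomp (fun=> expR (grid_exponent mu N w)) N w).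
Qed.

(** Squaring the stochastic exponential amounts to doubling the coefficient
    [mu], up to a factor [exp(mu^2 h)] per step. *)
Lemma grid_exponent_square_le (mu : nat -> R) (M : R) N :
  (forall j, `|mu j| <= M) ->
  (\int[P]_w (expR (grid_exponent mu N w) ^+ 2)%:E <=
   (expR (M ^+ 2 * (N%:R * h)))%:E)%E.
Proof.
move=> muM; have m2 := @grid_exponent_mean (fun j => 2 * mu j) N.
have mE mu' : measurable_fun [set: T] (fun w => expR (grid_exponent mu' N w)).
  apply: measurableT_comp => //.
  exact: measurable_filt (@measurable_grid_exponent mu' N).
rewrite -[leRHS]mule1 -m2 -ge0_integralZl//; last exact/measurable_EFinP.
apply: ge0_le_integral => //.
- by apply/measurable_EFinP; exact: measurable_funX.
- by apply/measurable_EFinP; apply: measurable_funM.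
move=> w _; rewrite -EFinM lee_fin -expRM_natr -expRD ler_expR.
rewrite /grid_exponent mulr_suml.
have -> : M ^+ 2 * (N%:R * h) = \sum_(l < N) M ^+ 2 * h.
  by rewrite [RHS]sumr_const card_ord -[RHS]mulr_natl; ring.
rewrite -big_split/=; apply: ler_sum => l _.
have : mu (J l w) ^+ 2 <= M ^+ 2.
  by rewrite -(real_normK (num_real (mu (J l w)))) lerXn2r ?nnegrE// (le_trans _ (muM 0%N)).
move=> muM2; have : 0 <= (M ^+ 2 - mu (J l w) ^+ 2) * h.
  by rewrite mulr_ge0 ?subr_ge0// ltW.
move=> H; rewrite -subr_ge0; move: H.
by congr (_ <= _); field.
Qed.

End grid_exponential.

(** * First passage times *)

Section first_passage.
Context {R : realType}.
Implicit Types (W : R -> R) (a h K u : R).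

(** The clause at index 0 declares nonpositive levels passed at time 0; a
    sequence of levels may then start at 0. *)
Fixpoint below W h a (l : nat) : bool :=
  if l is l'.+1 then below W h a l' && (W (l%:R * h) <= a) else 0 < a.

(** The first index at which the level is passed, capped at [N]: as many
    indices come before it as there are indices with the level not passed. *)
Definition grid_passage W h a (N : nat) : nat :=
  (\sum_(l < N) below W h a l)%N.

Lemma below_leq W h a l l' : (l <= l')%N -> below W h a l' -> below W h a l.
Proof.
elim: l' => [|l' IH]; first by rewrite leqn0 => /eqP ->.
by rewrite leq_eqVlt => /predU1P[-> //|]; rewrite ltnS => ll' /andP[/(IH ll')].
Qed.

Lemma below_le_level W h a a' l : a <= a' -> below W h a l -> below W h a' l.
Proof.
move=> aa'; elim: l => [|l IH] /=; first by move=> /lt_le_trans; exact.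
by move=> /andP[/IH -> /le_trans]; exact.
Qed.

Lemma grid_passage_le W h a N : (grid_passage W h a N <= N)%N.
Proof.
rewrite /grid_passage -[leqRHS]muln1 -[in leqRHS](card_ord N) -sum_nat_const.
by apply: leq_sum => i _; exact: leq_b1.
Qed.

Lemma grid_passageE W h a N : (grid_passage W h a N < N)%N ->
  ~~ below W h a (grid_passage W h a N).
Proof.
elim: N => [//|N IH]; rewrite /grid_passage big_ord_recr/= -/(grid_passage W h a N).
case: (boolP (below W h a N)) => bN /=.
  have -> : grid_passage W h a N = N.
    rewrite /grid_passage (eq_bigr (fun=> 1%N)); first by rewrite sum1_card card_ord.
    by move=> i _; rewrite (below_leq (ltnW (ltn_ord i)) bN).
  by rewrite addn1 ltnn.
rewrite addn0 ltnS leq_eqVlt => /predU1P[->//|]; exact: IH.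
Qed.

Lemma below_grid_passage W h a N l : (l < grid_passage W h a N)%N -> below W h a l.
Proof.
elim: N => [|N IH]; rewrite /grid_passage ?big_ord0// big_ord_recr/=.
rewrite -/(grid_passage W h a N).
case: (boolP (below W h a N)) => bN /=; last by rewrite addn0; exact: IH.
rewrite addn1 ltnS => lN; apply: below_leq bN.
by rewrite (leq_trans lN)// grid_passage_le.
Qed.

Lemma grid_passage_small W h a N l : ~~ below W h a l -> (grid_passage W h a N <= l)%N.
Proof. by move=> bl; rewrite leqNgt; apply: contra bl => /below_grid_passage. Qed.

(** The increments up to the passage telescope. *)
Lemma sum_below_incr W h a N : W 0 = 0 ->
  \sum_(l < N) (below W h a l)%:R * (W (l.+1%:R * h) - W (l%:R * h)) =
  W ((grid_passage W h a N)%:R * h).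
Proof.
move=> W0; elim: N => [|N IH]; first by rewrite /grid_passage !big_ord0 mul0r W0.
rewrite big_ord_recr/= IH /grid_passage big_ord_recr/= -/(grid_passage W h a N).
case: (boolP (below W h a N)) => bN /=; last by rewrite mul0r addr0 addn0.
have -> : grid_passage W h a N = N.
  rewrite /grid_passage (eq_bigr (fun=> 1%N)); first by rewrite sum1_card card_ord.
  by move=> i _; rewrite (below_leq (ltnW (ltn_ord i)) bN).
by rewrite mul1r addn1 addrC subrK.
Qed.

(** The cap [K] makes the passage time bounded, as optional stopping needs. *)
Definition passage W a K : R :=
  if a <= 0 then 0 else inf ([set u | 0 < u < K /\ a < W u] `|` [set K]).

(** The value is 0, the infimum of the empty set, on the paths that never exceed
    the positive level [a]; they form a negligible event. *)
Definition passage_oo W a : R :=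
  if a <= 0 then 0 else inf [set u | 0 < u /\ a < W u].

Lemma passageE W a K : 0 < a ->
  passage W a K = inf ([set u | 0 < u < K /\ a < W u] `|` [set K]).
Proof. by move=> a0; rewrite /passage leNgt a0. Qed.

Lemma passage_ooE W a : 0 < a -> passage_oo W a = inf [set u | 0 < u /\ a < W u].
Proof. by move=> a0; rewrite /passage_oo leNgt a0. Qed.

Let has_infK W a K : 0 < K -> has_inf ([set u | 0 < u < K /\ a < W u] `|` [set K]).
Proof.
move=> K0; split; first by exists K; right.
by exists 0 => u [[/andP[/ltW]]|->] //; exact: ltW.
Qed.

Lemma passage_ge0 W a K : 0 < K -> 0 <= passage W a K.
Proof.
move=> K0; rewrite /passage; case: ifPn => // _; apply: lb_le_inf.
  by exists K; right.
by move=> u [[/andP[/ltW]]|->] //; exact: ltW.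
Qed.

Lemma passage_leK W a K : 0 < K -> passage W a K <= K.
Proof.
move=> K0; rewrite /passage; case: ifPn => [_|_]; first exact: ltW.
by apply: ge_inf; [case: (has_infK W a K0)|right].
Qed.

Lemma passage_le W a K u : 0 < K -> 0 < u -> u < K -> a < W u -> passage W a K <= u.
Proof.
move=> K0 u0 uK au; rewrite /passage; case: ifPn => [_|_]; first exact: ltW.
by apply: ge_inf; [case: (has_infK W a K0)|left; split => //; apply/andP].
Qed.

Lemma passage_level_le W a a' K : 0 < K -> a <= a' -> passage W a K <= passage W a' K.
Proof.
move=> K0 aa'; have [a0|a0] := leP a 0.
  by rewrite {1}/passage a0 passage_ge0.
rewrite [leRHS]passageE ?(lt_le_trans a0)//.
apply: lb_le_inf; first by exists K; right.
move=> u [[/andP[u0 uK] au]|->]; last exact: passage_leK.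
by apply: passage_le => //; exact: le_lt_trans au.
Qed.

Lemma passage_oo_eq W a K u : 0 < u -> u < K -> a < W u ->
  passage W a K = passage_oo W a.
Proof.
move=> u0 uK au; have K0 := lt_trans u0 uK.
have [a0|a0] := leP a 0; first by rewrite /passage /passage_oo a0.
have li : has_inf [set u | 0 < u /\ a < W u].
  by split; [exists u|exists 0 => v [/ltW]].
rewrite passage_ooE//; apply/eqP; rewrite eq_le; apply/andP; split.
  apply: lb_le_inf; first by exists u.
  move=> v [v0 av]; have [vK|Kv] := ltP v K; first exact: passage_le.
  by rewrite (le_trans (passage_leK _ _ K0)).
rewrite passageE//; apply: lb_le_inf; first by exists K; right.
move=> v [[/andP[v0 vK] av]|->]; first by apply: ge_inf => //; case: li.
by rewrite (le_trans _ (ltW uK))//; apply: ge_inf => //; case: li.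
Qed.

Section continuous_path.
Variables (W : R -> R).
Hypothesis cW : forall u, 0 < u -> {for u, continuous W}.

Let cont_gt u a : 0 < u -> a < W u ->
  exists2 e, 0 < e & forall v, `|u - v| < e -> a < W v.
Proof.
move=> u0 au; have /cvgr_gt /(_ a au) /nbhs_ballP[e /= e0 H] := cW u0.
by exists e.
Qed.

Let cont_lt u a : 0 < u -> W u < a ->
  exists2 e, 0 < e & forall v, `|u - v| < e -> W v < a.
Proof.
move=> u0 au; have /cvgr_lt /(_ a au) /nbhs_ballP[e /= e0 H] := cW u0.
by exists e.
Qed.

Lemma passage_value_le a K : 0 < K -> 0 < a -> 0 < passage W a K ->
  W (passage W a K) <= a.
Proof.
move=> K0 a0 T0; rewrite leNgt; apply/negP => /(cont_gt T0)[e e0 He].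
set t := passage W a K in T0 He.
pose v := Num.max (t / 2) (t - e / 2).
have vt : v < t by rewrite /v gt_max; apply/andP; split; lra.
have v0 : 0 < v by rewrite /v lt_max; apply/orP; left; lra.
have vte : t - e / 2 <= v by rewrite /v le_max lexx orbT.
have : passage W a K <= v.
  apply: passage_le => //; first by rewrite (lt_le_trans vt)// passage_leK.
  by apply: He; rewrite ger0_norm; lra.
by rewrite leNgt vt.
Qed.

Lemma passage_value_ge a K : 0 < K -> 0 < a -> 0 < passage W a K ->
  passage W a K < K -> a <= W (passage W a K).
Proof.
move=> K0 a0 T0 TK; rewrite leNgt; apply/negP => /(cont_lt T0)[e e0 He].
set t := passage W a K in T0 TK He.
pose e' := Num.min e (K - t).
have e'0 : 0 < e' by rewrite /e' lt_min e0 subr_gt0.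
have tE : t = inf ([set u | 0 < u < K /\ a < W u] `|` [set K]).
  exact: passageE.
have [u Su ut] := inf_adherent e'0 (has_infK W a K0).
have tu : t <= u by rewrite tE; apply: ge_inf => //; case: (has_infK W a K0).
have [ue uK] : u < t + e /\ u < K.
  have e'e : e' <= e by rewrite /e' ge_min lexx.
  have e'K : e' <= K - t by rewrite /e' ge_min lexx orbT.
  by rewrite -tE in ut; split; lra.
case: Su => [[_ au]|/= uE]; last by rewrite uE ltxx in uK.
have : W u < a by apply: He; rewrite ler0_norm; lra.
by move=> /(lt_trans au); rewrite ltxx.
Qed.

(** The grid passage times, for grids of mesh [K / m.+1], converge to the
    passage time: they are never before it, and a time with a value above [a]
    has, by continuity, a grid time with such a value just before it. *)
Lemma grid_passage_cvg a K : 0 < K ->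
  (grid_passage W (K / m.+1%:R) a m.+1)%:R * (K / m.+1%:R) @[m --> \oo] -->
  passage W a K.
Proof.
move=> K0; have h0 m : 0 < K / m.+1%:R by rewrite divr_gt0.
have Nh m : m.+1%:R * (K / m.+1%:R) = K by rewrite mulrC divfK.
have [a0|a0] := leP a 0.
  rewrite /passage a0 (_ : (fun _ => _) = cst 0); first exact: cvg_cst.
  apply/funext => m; rewrite (_ : grid_passage _ _ _ _ = 0%N) ?mul0r//.
  by apply/eqP; rewrite -leqn0; apply: grid_passage_small; rewrite /= -leNgt.
set t := passage W a K.
have tE : t = inf ([set u | 0 < u < K /\ a < W u] `|` [set K]).
  exact: passageE.
have lower m : t <= (grid_passage W (K / m.+1%:R) a m.+1)%:R * (K / m.+1%:R).
  have := grid_passage_le W (K / m.+1%:R) a m.+1.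
  set k := grid_passage _ _ _ _; rewrite leq_eqVlt => /predU1P[->|km].
    by rewrite Nh passage_leK.
  have := grid_passageE km; rewrite -/k.
  case kE : k => [|k'] /=; first by rewrite a0.
  have -> /= : below W (K / m.+1%:R) a k' by apply: (@below_grid_passage _ _ _ m.+1); rewrite -/k kE.
  rewrite -ltNge => aW; apply: passage_le => //; first by rewrite mulr_gt0.
  by rewrite -[ltRHS](Nh m) ltr_pM2r// ltr_nat -kE.
apply/cvgrPdist_le => e e0.
have [u Su ut] := inf_adherent e0 (has_infK W a K0); rewrite -tE in ut.
case: Su => [[/andP[u0 uK] au]|/= uE]; last first.
  near=> m; rewrite ler0_norm ?subr_le0// opprB.
  have : (grid_passage W (K / m.+1%:R) a m.+1)%:R * (K / m.+1%:R) <= K.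
    by rewrite -[leRHS](Nh m) ler_pM2r// ler_nat grid_passage_le.
  move=> le; rewrite uE in ut.
  by rewrite lerBlDr (le_trans le)// addrC ltW.
have [r r0 Hr] := cont_gt u0 au.
near=> m; rewrite ler0_norm ?subr_le0// opprB.
set h := K / m.+1%:R.
have x0 : 0 < Num.min r u by rewrite lt_min r0.
have hr : h < Num.min r u.
  rewrite /h ltr_pdivrMr ?ltr0n// -ltr_pdivrMl//.
  rewrite (@lt_trans _ _ m%:R) ?ltr_nat//; near: m; exact: nbhs_infty_gtr.
have [hr1 hu] : h < r /\ h < u.
  by split; apply: (lt_le_trans hr); rewrite ge_min lexx ?orbT.
pose l := Num.truncn (u / h).
have uh0 : 0 <= u / h by rewrite divr_ge0// ?ltW// /h.
have /andP[lu ul] := truncn_itv uh0.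
have hpos : 0 < h := h0 m.
have {}lu : (Num.truncn (u / h))%:R * h <= u by rewrite -ler_pdivlMr.
have {}ul : u < (Num.truncn (u / h))%:R * h + h.
  by rewrite -[X in _ + X]mul1r -mulrDl natr1 -ltr_pdivrMr.
suff Hu : (grid_passage W h a m.+1)%:R * h <= u.
  by rewrite lerBlDr (le_trans Hu)// addrC ltW.
apply: (le_trans _ lu); rewrite ler_pM2r//.
rewrite ler_nat; apply: grid_passage_small.
case lE : (Num.truncn (u / h)) ul => [|l'] ul; first by move: ul; rewrite mul0r add0r ltNge ltW.
rewrite /= negb_and -ltNge; apply/orP; right.
apply: Hr; rewrite -lE ger0_norm.
  by rewrite (le_lt_trans _ hr1)// lerBlDr addrC ltW// lE.
by rewrite subr_ge0.
Unshelve. all: by end_near. Qed.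

Lemma inverted_passage_cvg a K : W 0 = 0 -> 0 < K -> (0 < a -> 0 < passage W a K) ->
  W ((grid_passage W (K / m.+1%:R) a m.+1)%:R * (K / m.+1%:R)) @[m --> \oo] -->
  W (passage W a K).
Proof.
move=> W0 K0 T0; have [a0|a0] := leP a 0; last first.
  apply: continuous_cvg; first by apply: cW; exact: T0.
  exact: grid_passage_cvg.
rewrite /passage a0 (_ : (fun _ => _) = cst (W 0)); first exact: cvg_cst.
apply/funext => m; rewrite (_ : grid_passage _ _ _ _ = 0%N) ?mul0r//.
by apply/eqP; rewrite -leqn0; apply: grid_passage_small; rewrite /= -leNgt.
Qed.

End continuous_path.
End first_passage.

Section levels.
Context {R : realType}.

(** The coefficient in force once [J] of the levels [a 0 <= ... <= a n] are
    passed: [mu j] between the passages above [a j] and [a j.+1], and 0 before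
    the first and after the last passage. *)
Definition coefficient (mu : nat -> R) (n J : nat) : R :=
  if (0 < J <= n)%N then mu J.-1 else 0.

(** Here [b j] stands for: level [a j] is not passed yet. *)
Lemma coefficient_count (mu : nat -> R) (n : nat) (b : nat -> bool) :
  (forall j, (j < n)%N -> b j -> b j.+1) ->
  coefficient mu n (\sum_(j < n.+1) ~~ b j)%N =
  \sum_(j < n) mu j * ((b j.+1)%:R - (b j)%:R).
Proof.
elim: n => [|n IH] bS.
  by rewrite big_ord0 big_ord_recr big_ord0/= /coefficient; case: (b 0%N).
have bS' j : (j < n)%N -> b j -> b j.+1 by move=> jn; apply: bS; exact: ltnW.
have bn m j : (j <= m <= n.+1)%N -> b j -> b m.
  elim: m => [|m IHm]; first by rewrite leqn0 => /andP[/eqP ->].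
  rewrite leq_eqVlt => /andP[/predU1P[-> //|jm] mn] bj.
  by apply: bS => //; apply: IHm => //; rewrite -ltnS jm ltnW.
have none m : ~~ b m -> (m <= n.+1)%N -> (\sum_(j < m.+1) ~~ b j = m.+1)%N.
  move=> bm mn; rewrite (eq_bigr (fun=> 1%N)); first by rewrite sum1_card card_ord.
  move=> j _; rewrite [X in nat_of_bool X](_ : _ = true)//; apply: contra bm.
  by apply: bn; rewrite mn andbT -ltnS ltn_ord.
have zero m : ~~ b m -> (m <= n.+1)%N ->
    \sum_(j < m) mu j * ((b j.+1)%:R - (b j)%:R) = 0.
  move=> bm mn; rewrite big1// => j _.
  have /negbTE -> : ~~ b j.+1 by apply: contra bm; apply: bn; rewrite ltn_ord.
  have /negbTE -> : ~~ b j.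
    by apply: contra bm; apply: bn; rewrite mn andbT ltnW// ltn_ord.
  by rewrite subrr mulr0.
have [bn1|bn1] := boolP (b n.+1); last first.
  by rewrite zero// none// /coefficient ltnn andbF.
rewrite big_ord_recr/= bn1 addn0 [RHS]big_ord_recr/= -IH// bn1.
have [bn0|bn0] := boolP (b n).
  rewrite subrr mulr0 addr0 /coefficient.
  have Jn : (\sum_(j < n.+1) ~~ b j <= n)%N.
    rewrite big_ord_recr/= bn0 addn0 -[leqRHS]muln1 -[in leqRHS](card_ord n).
    by rewrite -sum_nat_const; apply: leq_sum => i _; exact: leq_b1.
  by rewrite Jn (leq_trans Jn).
by rewrite none// /coefficient !ltnn andbF/= leqnn/= add0r subr0 mulr1.
Qed.

End levels.

Section level_exponent.
Context {R : realType} {d : measure_display} {T : measurableType d}.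
Variable P : probability T R.
Variable B : R -> T -> R.
Hypothesis hB : standard_brownian_motion P B.
Local Notation path w := (fun u => inverted B u w).

Section fixed_grid.
Variables (h : R) (h0 : 0 < h).
Local Notation filt k := (g_sigma_algebraType (grid_events B h k)).

Lemma measurable_below (a : R) l k : (l <= k)%N ->
  measurable_fun setT ((fun w => (below (path w) h a l)%:R) : filt k -> R).
Proof.
elim: l => [|l IH] lk; first exact: measurable_cst.
rewrite (_ : (fun w => _) = (fun w => (below (path w) h a l)%:R *
    \1_(`]-oo, a]%classic : set R) (inverted B (l.+1%:R * h) w))).
  apply: measurable_funM; first by apply: IH; exact: ltnW.
  apply: measurableT_comp; first exact: measurable_indic.
  exact: measurable_grid_inverted.
apply/funext => w /=; rewrite indicE.
rewrite (_ : (_ \in _) = (inverted B (l.+1%:R * h) w <= a)).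
  by case: (below _ _ _ _) => /=; rewrite ?mul1r ?mul0r.
by apply/idP/idP; rewrite inE/= in_itv.
Qed.

Variables (a : nat -> R) (n : nat).
Hypothesis a_nd : forall j, (j < n)%N -> a j <= a j.+1.

Definition levels_passed (l : nat) (w : T) : nat :=
  (\sum_(j < n.+1) ~~ below (path w) h (a j) l)%N.

Lemma levels_passed_lt l w : (levels_passed l w < n.+2)%N.
Proof.
rewrite ltnS -[leqRHS]muln1 -[in leqRHS](card_ord n.+1) -sum_nat_const.
by apply: leq_sum => i _; exact: leq_b1.
Qed.

Lemma measurable_levels_passed l k : (l <= k)%N -> forall j,
  measurable_fun setT ((fun w => (levels_passed l w == j)%:R) : filt k -> R).
Proof.
move=> lk j.
rewrite (_ : (fun w => _) = (fun w => \1_([set (j%:R : R)])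
    (\sum_(i < n.+1) (1 - (below (path w) h (a i) l)%:R)))).
  apply: measurableT_comp; first exact: measurable_indic.
  apply: measurable_sum => i; apply: measurable_funB => //.
  exact: measurable_below.
apply/funext => w /=; rewrite indicE; congr (nat_of_bool _)%:R.
rewrite (_ : \sum_(i < n.+1) _ = (levels_passed l w)%:R).
  by apply/idP/idP; rewrite inE/=; [move=> /eqP ->|move=> /eqP; rewrite eqr_nat].
rewrite /levels_passed natr_sum; apply: eq_bigr => i _.
by case: (below _ _ _ _) => /=; rewrite ?subrr ?subr0.
Qed.

(** The coefficient being constant between passages, the stochastic integral
    telescopes between them. *)
Lemma levels_exponentE (mu tau : nat -> R) N w :
  (forall j, tau j = (grid_passage (path w) h (a j) N)%:R * h) ->
  grid_exponent B h levels_passed (coefficient mu n) N w =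
  \sum_(j < n) (mu j * (path w (tau j.+1) - path w (tau j)) -
                mu j ^+ 2 * (tau j.+1 - tau j) / 2).
Proof.
move=> tauE'; rewrite /grid_exponent.
pose b l j := below (path w) h (a j) l.
have bS l j : (j < n)%N -> b l j -> b l j.+1.
  by move=> jn; apply: below_le_level; exact: a_nd.
have sq l : coefficient mu n (levels_passed l w) ^+ 2 =
    coefficient (fun j => mu j ^+ 2) n (levels_passed l w).
  by rewrite /coefficient; case: ifP => // _; rewrite expr0n.
have tauE j : tau j = \sum_(l < N) (b l j)%:R * h.
  by rewrite tauE' /grid_passage natr_sum mulr_suml.
have WE j : path w (tau j) = \sum_(l < N) (b l j)%:R *
    (inverted B (l.+1%:R * h) w - inverted B (l%:R * h) w).
  by rewrite tauE' (@sum_below_incr _ (path w))// inverted0.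
under eq_bigr do rewrite sq !(coefficient_count _ (bS _)).
rewrite big_split/= [RHS]big_split/=; congr (_ + _).
  under eq_bigr do rewrite mulr_suml.
  rewrite exchange_big/=; apply: eq_bigr => j _.
  rewrite !WE -sumrB mulr_sumr; apply: eq_bigr => l _.
  by rewrite -mulrA -mulrBl.
rewrite !sumrN; congr (- _).
under eq_bigr do rewrite -mulrA mulr_suml.
rewrite exchange_big/=; apply: eq_bigr => j _.
rewrite !tauE -sumrB mulr_sumr mulr_suml; apply: eq_bigr => l _.
by rewrite -mulrBl !mulrA.
Qed.

End fixed_grid.
End level_exponent.

Lemma cvg_sum_ord {R : realType} (n : nat) (f : nat -> nat -> R) (l : nat -> R) :
  (forall j, (j < n)%N -> f j m @[m --> \oo] --> l j) ->
  \sum_(j < n) f j m @[m --> \oo] --> \sum_(j < n) l j.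
Proof.
elim: n => [|n IH] fl.
  rewrite big_ord0 (_ : (fun m => _) = cst 0); first exact: cvg_cst.
  by apply/funext => m; rewrite big_ord0.
rewrite big_ord_recr/= (_ : (fun m => _) =
  (fun m => \sum_(j < n) f j m + f n m)); last first.
  by apply/funext => m; rewrite big_ord_recr.
by apply: cvgD; [apply: IH => j jn; apply: fl; exact: ltnW|exact: fl].
Qed.

Lemma continuous_path_pos {R : realType} (x : R -> R) (t : R) :
  continuous_path x -> 0 < t -> {for t, continuous x}.
Proof.
move=> cx t0; have sub : `]0, +oo[%classic `<=` [set t : R | 0 <= t].
  by move=> z /=; rewrite in_itv/= andbT => /ltW.
have := continuous_subspaceW sub cx.
rewrite continuous_open_subspace; last exact: interval_open.
by apply; rewrite inE/= in_itv/= andbT.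
Qed.

Section passage_times.
Context {R : realType} {d : measure_display} {T : measurableType d}.
Variable P : probability T R.
Variable B : R -> T -> R.
Hypothesis hB : standard_brownian_motion P B.
Local Notation path w := (fun u => inverted B u w).

Lemma inverted_continuous w u : 0 < u -> {for u, continuous (path w)}.
Proof.
move=> u0; case: hB => _ cB _ _ _.
have cv : {for u^-1, continuous (B ^~ w)}.
  by apply: (continuous_path_pos (cB w)); rewrite invr_gt0.
apply: cvgM; first exact: cvg_id.
apply: cvgB; last exact: cvg_cst.
have un0 : u != 0 by rewrite gt_eqF.
exact: (cvg_comp _ _ (inv_continuous un0) cv).
Qed.

Lemma measurable_grid_passage (h a : R) N : 0 < h ->
  measurable_fun [set: T] (fun w => (grid_passage (path w) h a N)%:R : R).
Proof.
move=> h0.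
rewrite (_ : (fun w => _) = (fun w => \sum_(l < N) (below (path w) h a l)%:R)).
  apply: measurable_sum => l; apply: (measurable_filt hB h0 (k := l)).
  exact: measurable_below.
by apply/funext => w; rewrite /grid_passage natr_sum.
Qed.

Lemma measurable_passage (a K : R) : 0 < K ->
  measurable_fun [set: T] (fun w => passage (path w) a K).
Proof.
move=> K0; apply: (@measurable_fun_cvg _ _ _ _ (fun m w =>
  (grid_passage (path w) (K / m.+1%:R) a m.+1)%:R * (K / m.+1%:R))).
  move=> m; apply: measurable_funM => //.
  by apply: measurable_grid_passage; rewrite divr_gt0.
by move=> w _; apply: grid_passage_cvg => // u u0; exact: inverted_continuous.
Qed.

Definition level_exponent (a mu : nat -> R) (n : nat) (K : R) (w : T) : R :=
  \sum_(j < n) (mu j * (path w (passage (path w) (a j.+1) K) -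
                        path w (passage (path w) (a j) K)) -
    mu j ^+ 2 * (passage (path w) (a j.+1) K - passage (path w) (a j) K) / 2).

(** A weak form of the continuity of the time-inverted path at time 0. *)
Definition immediately_below (w : T) := forall a, 0 < a -> 0 < passage (path w) a 1.

Lemma passage_gt0 w a K : immediately_below w -> 0 < a -> 0 < K ->
  0 < passage (path w) a K.
Proof.
move=> iw a0 K0; have t0 := iw a a0.
apply: (@lt_le_trans _ _ (Num.min (Num.min (passage (path w) a 1) 1) K)).
  by rewrite !lt_min t0 ltr01 K0.
rewrite [leRHS]passageE//; apply: lb_le_inf; first by exists K; right.
move=> u [[/andP[u0 uK] au]|/= ->]; last by rewrite ge_min lexx orbT.
have [u1|u1] := ltP u 1; last by rewrite !ge_min u1 orbT.
by rewrite !ge_min (passage_le ltr01 u0 u1 au).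
Qed.

Lemma grid_level_exponent_cvg (a mu : nat -> R) n K w :
  immediately_below w -> 0 < K -> (forall j, (j < n)%N -> a j <= a j.+1) ->
  grid_exponent B (K / m.+1%:R) (levels_passed B (K / m.+1%:R) a n)
    (coefficient mu n) m.+1 w @[m --> \oo] --> level_exponent a mu n K w.
Proof.
move=> iw K0 a_nd.
pose tau (m j : nat) : R := (grid_passage (path w) (K / m.+1%:R) (a j) m.+1)%:R * (K / m.+1%:R).
rewrite (_ : (fun m => _) = (fun m => \sum_(j < n)
    (mu j * (path w (tau m j.+1) - path w (tau m j)) -
     mu j ^+ 2 * (tau m j.+1 - tau m j) / 2))); last first.
  by apply/funext => m; exact: (levels_exponentE a_nd).
have cW u : 0 < u -> {for u, continuous (path w)} by exact: inverted_continuous.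
have ctau j : tau m j @[m --> \oo] --> passage (path w) (a j) K.
  exact: grid_passage_cvg.
have cWtau j : path w (tau m j) @[m --> \oo] --> path w (passage (path w) (a j) K).
  apply: (inverted_passage_cvg cW) => //; first exact: inverted0.
  by move=> a0; exact: passage_gt0.
apply: (@cvg_sum_ord _ n (fun j m => mu j * (path w (tau m j.+1) - path w (tau m j)) -
     mu j ^+ 2 * (tau m j.+1 - tau m j) / 2)
  (fun j => mu j * (path w (passage (path w) (a j.+1) K) -
                        path w (passage (path w) (a j) K)) -
    mu j ^+ 2 * (passage (path w) (a j.+1) K - passage (path w) (a j) K) / 2)) => j _.
apply: cvgB; first by apply: cvgM; [exact: cvg_cst|exact: cvgB].
by apply: cvgM; [apply: cvgM; [exact: cvg_cst|exact: cvgB]|exact: cvg_cst].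
Qed.

Lemma grid_level_mean (a mu : nat -> R) n K m : 0 < K ->
  (\int[P]_w (expR (grid_exponent B (K / m.+1%:R)
    (levels_passed B (K / m.+1%:R) a n) (coefficient mu n) m.+1 w))%:E = 1)%E.
Proof.
move=> K0; have h0 : 0 < K / m.+1%:R by rewrite divr_gt0.
apply: (grid_exponent_mean hB h0 (q := n.+2)).
  by move=> l w; exact: levels_passed_lt.
by move=> l k lk j; exact: measurable_levels_passed.
Qed.

Lemma measurable_grid_level (a mu : nat -> R) n K m : 0 < K ->
  measurable_fun [set: T] (grid_exponent B (K / m.+1%:R)
    (levels_passed B (K / m.+1%:R) a n) (coefficient mu n) m.+1).
Proof.
move=> K0; have h0 : 0 < K / m.+1%:R by rewrite divr_gt0.
apply: (measurable_filt hB h0 (k := m.+1)).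
apply: (@measurable_grid_exponent _ _ _ B _ h0 _ n.+2).
  by move=> l w; exact: levels_passed_lt.
by move=> l k lk j; exact: measurable_levels_passed.
Qed.

Let one_level (x : R) : nat -> R := fun j => if j is 0 then 0 else x.

Let expR_natmul_le0 (x y : R) : (forall mu, 0 < mu -> expR (mu * x) * y <= 1) ->
  0 < x -> y <= 0.
Proof.
move=> H x0; rewrite leNgt; apply/negP => y0.
have mu0 : 0 < (x * y)^-1 by rewrite invr_gt0 mulr_gt0.
have := H _ mu0; apply/negP; rewrite -ltNge.
have -> : (x * y)^-1 * x = y^-1 by rewrite invfM mulrC mulrA divff ?mul1r ?gt_eqF.
rewrite -ltr_pdivrMr// div1r (lt_le_trans _ (expR_ge1Dx _))//.
by rewrite ltrDr.
Qed.

(** On the event that the passage time is 0, the grid passage times tend to 0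
    while the grid values there exceed the level, so the stopped exponential
    martingale is at least about [exp(mu a)]. Its mean being 1, the event has
    probability at most [exp(- mu a)], for every [mu]. *)
Lemma ae_immediately_below : {ae P, forall w, immediately_below w}.
Proof.
pose a k : R := k.+1%:R^-1.
have a0 k : 0 < a k by rewrite invr_gt0.
suff H k : {ae P, forall w, 0 < passage (path w) (a k) 1}.
  apply: filterS (ae_foralln H) => w Hw x x0.
  pose k := Num.truncn x^-1.
  apply: (lt_le_trans (Hw k)); apply: passage_level_le => //.
  rewrite /a -[leRHS]invrK lef_pV2 ?posrE ?invr_gt0//.
  exact/ltW/truncnS_gt.
pose Z := [set w | passage (path w) (a k) 1 = 0].
have mZ : measurable Z.
  rewrite (_ : Z = (fun w => passage (path w) (a k) 1) @^-1` [set 0])//.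
  rewrite -[X in measurable X]setTI; apply: measurable_passage => //.
have PZ : P Z = 0%E.
  have PZ0 : 0 <= fine (P Z) by apply: fine_ge0.
  apply/eqP; rewrite eq_le measure_ge0 andbT -[P Z]fineK ?fin_num_measure// lee_fin.
  apply: (@expR_natmul_le0 (a k)) => // mu mu0.
  pose tau (m : nat) (w : T) : R := (grid_passage (path w) (1 / m.+1%:R) (a k) m.+1)%:R * (1 / m.+1%:R).
  have mtau m : measurable_fun [set: T] (tau m).
    apply: measurable_funM => //.
    by apply: measurable_grid_passage; rewrite divr_gt0.
  pose Y (m : nat) (w : T) : R := expR (mu * a k) * (\1_Z w * (\1_(`]-oo, 1[%classic : set R) (tau m w) *
     expR (- (mu ^+ 2 * tau m w / 2)))).
  have mY m : measurable_fun [set: T] (Y m).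
    apply: measurable_funM => //; apply: measurable_funM => //.
    apply: measurable_funM; first by apply: measurableT_comp.
    apply: measurableT_comp => //; apply: measurableT_comp => //.
    by apply: measurable_funM => //; exact: measurable_funM.
  have tau0 m w : 0 <= tau m w by rewrite mulr_ge0 ?divr_ge0.
  have Y0 m w : 0 <= Y m w by rewrite !mulr_ge0 ?expR_ge0.
  have Y_le m w : Y m w <= expR (grid_exponent B (1 / m.+1%:R)
      (levels_passed B (1 / m.+1%:R) (one_level (a k)) 1)
      (coefficient (fun=> mu) 1) m.+1 w).
    pose ta (j : nat) : R := (grid_passage (path w) (1 / m.+1%:R) (one_level (a k) j) m.+1)%:R *
       (1 / m.+1%:R).
    rewrite (@levels_exponentE _ _ _ _ _ _ 1%N _ (fun=> mu) ta)//; last first.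
      by move=> [|//] _ /=; exact: ltW.
    rewrite big_ord_recr big_ord0/= add0r.
    have -> : ta 0%N = 0.
      rewrite /ta /= (_ : grid_passage _ _ _ _ = 0%N) ?mul0r//.
      by apply/eqP; rewrite -leqn0; apply: grid_passage_small; rewrite /= ltxx.
    rewrite inverted0 !subr0 -/(tau m w) (_ : ta 1%N = tau m w)//.
    rewrite /Y !indicE; case: (boolP (tau m w \in _)); last first.
      by rewrite mul0r !mulr0 expR_ge0.
    rewrite inE/= in_itv/= => tau1; rewrite mul1r.
    case: (w \in Z); last by rewrite mul0r mulr0 expR_ge0.
    rewrite mul1r -expRD ler_expR lerD2r ler_pM2l//.
    have km : (grid_passage (path w) (1 / m.+1%:R) (a k) m.+1 < m.+1)%N.
      by move: tau1; rewrite /tau div1r ltr_pdivrMr// mul1r ltr_nat.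
    have := grid_passageE km; rewrite /tau.
    case kE : grid_passage => [|k'] /=; first by rewrite a0.
    have -> /= : below (path w) (1 / m.+1%:R) (a k) k'.
      by apply: (@below_grid_passage _ _ _ _ m.+1); rewrite kE.
    by rewrite -ltNge => /ltW.
  have cY : (\int[P]_w (Y m w)%:E @[m --> \oo] --> \int[P]_w (expR (mu * a k) * \1_Z w)%:E)%E.
    apply: (@bounded_cvg_integral _ _ _ _ _ _ (expR (mu * a k))) => //.
    - by apply: measurable_funM.
    - move=> m w; rewrite ger0_norm// /Y ler_piMr ?expR_ge0//.
      rewrite mulr_ile1 ?mulr_ge0 ?expR_ge0// mulr_ile1 ?expR_ge0//.
      by rewrite -expR0 ler_expR oppr_le0 divr_ge0// mulr_ge0// sqr_ge0.
    - apply: aeW => w; rewrite /Y; apply: cvgM; first exact: cvg_cst.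
      rewrite indicE; case: (boolP (w \in Z)); last first.
        by move=> _; under eq_fun do rewrite mul0r; exact: cvg_cst.
      rewrite inE => Zw; under eq_fun do rewrite mul1r.
      have ctau : tau m w @[m --> \oo] --> (0 : R).
        rewrite -Zw; apply: grid_passage_cvg => // u u0; exact: inverted_continuous.
      have c1 : \1_(`]-oo, 1[%classic : set R) (tau m w) @[m --> \oo] --> (1 : R).
        apply: cvg_near_cst; near=> m; rewrite indicE mem_set//= in_itv/=.
        near: m; exact: (cvgr_lt _ ctau).
      have c2 : expR (- (mu ^+ 2 * tau m w / 2)) @[m --> \oo] -->
          expR (- (mu ^+ 2 * 0 / 2)).
        have c3 : - (mu ^+ 2 * tau m w / 2) @[m --> \oo] --> - (mu ^+ 2 * 0 / 2).
          apply: cvgN; apply: cvgM; last exact: cvg_cst.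
          by apply: cvgM => //; exact: cvg_cst.
        exact: (cvg_comp _ _ c3 (@continuous_expR R _)).
      rewrite mulr0 mul0r oppr0 expR0 in c2.
      have c4 := cvgM c1 c2; rewrite mulr1 in c4; exact: c4.
  have : (\int[P]_w (expR (mu * a k) * \1_Z w)%:E <= 1)%E.
    apply: (cvge_to_le cY); apply: nearW => m.
    rewrite -(grid_level_mean (one_level (a k)) (fun=> mu) 1 m ltr01).
    apply: ge0_le_integral => //.
    - by move=> w _; rewrite lee_fin.
    - exact/measurable_EFinP.
    - apply/measurable_EFinP; apply: measurableT_comp => //.
      exact: measurable_grid_level.
    - by move=> w _; rewrite lee_fin.
  under eq_integral do rewrite EFinM.
  rewrite ge0_integralZl//; last exact/measurable_EFinP.
  have PZE : P Z = (fine (P Z))%:E by rewrite fineK ?fin_num_measure.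
  by rewrite integral_indic// setIT [X in (_ * X)%E]PZE -EFinM lee_fin.
exists Z; split => // w /= /negP; rewrite -leNgt => le0.
by apply/eqP; rewrite eq_le le0 passage_ge0.
Unshelve. all: by end_near. Qed.

End passage_times.

(** * Optional stopping at passage times *)

Section passage_laplace.
Context {R : realType} {d : measure_display} {T : measurableType d}.
Variable P : probability T R.
Variable B : R -> T -> R.
Hypothesis hB : standard_brownian_motion P B.
Local Notation path w := (fun u => inverted B u w).

(** This is the value of the path at its capped passage time (see [stoppedE]),
    in a form that is visibly measurable. *)
Definition stopped (a K : R) (w : T) : R :=
  if passage (path w) a K < K then a else inverted B K w.

Lemma measurable_stopped a K : 0 < K -> measurable_fun [set: T] (stopped a K).
Proof.
move=> K0; apply: measurable_fun_ifT.
- by apply: measurable_fun_ltr => //; exact: (measurable_passage hB).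
- exact: measurable_cst.
- by apply: (measurable_inverted hB); exact: ltW.
Qed.

Lemma stoppedE a K w : 0 <= a -> 0 < K -> (0 < a -> 0 < passage (path w) a K) ->
  path w (passage (path w) a K) = stopped a K w.
Proof.
move=> a0 K0 T0; have cW u : 0 < u -> {for u, continuous (path w)}.
  exact: (inverted_continuous hB).
rewrite /stopped; case: ifPn => [TK|]; last first.
  rewrite -leNgt => KT; congr inverted; apply/eqP.
  by rewrite eq_le KT passage_leK.
move: a0; rewrite le_eqVlt => /predU1P[a0|a0].
  by rewrite -a0 /passage lexx inverted0.
apply/eqP; rewrite eq_le (passage_value_le cW)//= ?T0//.
by rewrite (passage_value_ge cW)// T0.
Qed.

Lemma stopped_le a a' K w : 0 <= a -> a <= a' -> 0 < K ->
  stopped a' K w - stopped a K w <= a' - a.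
Proof.
move=> a0 aa' K0; have cW u : 0 < u -> {for u, continuous (path w)}.
  exact: (inverted_continuous hB).
have T_le : passage (path w) a K <= passage (path w) a' K by exact: passage_level_le.
have top b : 0 < b -> K <= passage (path w) b K -> inverted B K w <= b.
  move=> b0 KT; have TK : passage (path w) b K = K.
    by apply/eqP; rewrite eq_le KT passage_leK.
  by rewrite -{1}TK; apply: (passage_value_le cW) => //; rewrite TK.
rewrite /stopped; case: ifPn => [T'K|].
  by rewrite (le_lt_trans T_le T'K).
rewrite -leNgt => KT'; have [TK|KT] := ltP (passage (path w) a K) K.
  rewrite lerD2r; apply: top => //; rewrite ltNge; apply/negP => a'0.
  by move: KT'; rewrite /passage a'0 leNgt K0.
by rewrite subrr subr_ge0.
Qed.

Definition stopped_exponent (a mu : nat -> R) (n : nat) (K : R) (w : T) : R :=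
  \sum_(j < n) (mu j * (stopped (a j.+1) K w - stopped (a j) K w) -
    mu j ^+ 2 * (passage (path w) (a j.+1) K - passage (path w) (a j) K) / 2).

Lemma measurable_stopped_exponent a mu n K : 0 < K ->
  measurable_fun [set: T] (stopped_exponent a mu n K).
Proof.
move=> K0; apply: measurable_sum => j.
apply: measurable_funB.
  by apply: measurable_funM => //; apply: measurable_funB; exact: measurable_stopped.
apply: measurable_funM => //; apply: measurable_funM => //.
by apply: measurable_funB; exact: (measurable_passage hB).
Qed.

Section levels.
Variables (a mu : nat -> R) (n : nat).
Hypothesis a_nd : forall j, (j < n)%N -> a j <= a j.+1.
Hypothesis a0 : 0 <= a 0%N.
Hypothesis mu0 : forall j, 0 <= mu j.

Lemma level_ge0 j : (j <= n)%N -> 0 <= a j.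
Proof.
by elim: j => [//|j IH] jn; rewrite (le_trans (IH (ltnW jn)))// a_nd.
Qed.

Lemma level_le_last j : (j <= n)%N -> a j <= a n.
Proof.
suff H m : (m <= n)%N -> (j <= m)%N -> a j <= a m by move=> jn; exact: H.
elim: m => [_|m IH mn]; first by rewrite leqn0 => /eqP ->.
rewrite leq_eqVlt => /predU1P[->//|jm].
by rewrite (le_trans (IH (ltnW mn) jm))// a_nd.
Qed.

Lemma stopped_exponent_le K w : 0 < K ->
  stopped_exponent a mu n K w <= \sum_(j < n) mu j * (a j.+1 - a j).
Proof.
move=> K0; apply: ler_sum => j _.
rewrite lerBlDr (@le_trans _ _ (mu j * (a j.+1 - a j)))//.
  by rewrite ler_wpM2l// stopped_le ?a_nd// level_ge0// ltnW.
by rewrite lerDl divr_ge0// mulr_ge0 ?sqr_ge0// subr_ge0 passage_level_le ?a_nd.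
Qed.

Lemma coefficient_le j : `|coefficient mu n j| <= \sum_(i < n) mu i.
Proof.
have s0 : 0 <= \sum_(i < n) mu i by exact: sumr_ge0.
rewrite /coefficient; case: ifPn => [|_]; last by rewrite normr0.
case: j => [//|j] /= jn; rewrite ger0_norm//.
by rewrite (bigD1 (Ordinal jn))//= lerDl sumr_ge0.
Qed.

(** Optional stopping: the mean is 1 on every grid, and the grid exponents
    converge. The exponentials are bounded in L2 because the coefficients are
    bounded and the time is at most [K]; their limit is bounded because the
    stopped path rises by at most [a j.+1 - a j] between two passages. *)
Lemma stopped_exponent_mean K : 0 < K ->
  (\int[P]_w (expR (stopped_exponent a mu n K w))%:E = 1)%E.
Proof.
move=> K0; apply: (@L2_bounded_cvg_integral _ _ _ P (fun m w =>
  expR (grid_exponent B (K / m.+1%:R) (levels_passed B (K / m.+1%:R) a n)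
    (coefficient mu n) m.+1 w)) _ (expR (\sum_(j < n) mu j * (a j.+1 - a j)))
  (expR ((\sum_(i < n) mu i) ^+ 2 * K))).
- by move=> m; apply: measurableT_comp => //; exact: (measurable_grid_level hB).
- by apply: measurableT_comp => //; exact: measurable_stopped_exponent.
- by move=> m w; exact: expR_ge0.
- by move=> w; rewrite ler_expR stopped_exponent_le.
- apply: filterS (ae_immediately_below hB) => w iw.
  have := @grid_level_exponent_cvg _ _ _ _ _ hB a mu n K w iw K0 a_nd.
  rewrite (_ : level_exponent B a mu n K w = stopped_exponent a mu n K w).
    by move=> c; exact: (cvg_comp _ _ c (@continuous_expR R _)).
  apply: eq_bigr => j _; rewrite !stoppedE//.
  + by rewrite level_ge0// ltnW.
  + by move=> aj0; exact: (passage_gt0 iw).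
  + by rewrite level_ge0.
  + by move=> aj0; exact: (passage_gt0 iw).
- by move=> m; exact: (grid_level_mean hB).
- move=> m; have h0 : 0 < K / m.+1%:R by rewrite divr_gt0.
  rewrite [in leRHS](_ : K = m.+1%:R * (K / m.+1%:R)); last by rewrite mulrC divfK.
  apply: (grid_exponent_square_le hB h0 (q := n.+2)).
  + by move=> l w; exact: levels_passed_lt.
  + by move=> l k lk j; exact: measurable_levels_passed.
  + exact: coefficient_le.
Qed.

End levels.

Definition unbounded_above (w : T) := forall a, exists2 u, 0 < u & a < path w u.

(** For the level [a] alone, optional stopping bounds the probability of not
    reaching [a] before [K] by [mu a + 2 / (mu^2 K)], for every [mu > 0]. *)
Lemma ae_unbounded_above : {ae P, forall w, unbounded_above w}.
Proof.
suff H (k : nat) : {ae P, forall w, exists2 u, 0 < u & k.+1%:R < path w u}.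
  apply: filterS (ae_foralln H) => w Hw a.
  have [u u0 ku] := Hw (Num.truncn `|a|); exists u => //.
  by rewrite (le_lt_trans (ler_norm a))// (lt_trans _ ku)// truncnS_gt.
set b : R := k.+1%:R; have b0 : 0 < b by [].
pose A m := [set w | passage (path w) b m.+1%:R < m.+1%:R].
have mA m : measurable (A m).
  rewrite -[X in measurable X]setTI.
  have mp : measurable_fun [set: T] (fun w => passage (path w) b m.+1%:R).
    exact: (measurable_passage hB).
  have := mp measurableT `]-oo, m.+1%:R[%classic (measurable_itv _).
  by congr (measurable (_ `&` _)); apply/seteqP; split => w /=; rewrite in_itv.
pose D := \bigcup_m A m.
have mD : measurable D by exact: bigcupT_measurable.
have est m mu : 0 < mu -> 1 - mu * b - 2 / (mu ^+ 2 * m.+1%:R) <= fine (P D).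
  move=> mu0; have K0 : 0 < m.+1%:R :> R by [].
  pose la j : R := if j is 0 then 0 else b.
  have m1 := @stopped_exponent_mean la (fun=> mu) 1%N _ (lexx _) _ _ K0.
  have {}m1 : (\int[P]_w (expR (stopped_exponent la (fun=> mu) 1 m.+1%:R w))%:E = 1)%E.
    by apply: m1 => [[|//] _ /=|_]; exact: ltW.
  have le1 : (1 <= \int[P]_w ((expR (mu * b))%:E * (\1_(A m) w)%:E +
      (expR (mu * b - mu ^+ 2 * m.+1%:R / 2))%:E))%E.
    rewrite -[leLHS]m1; apply: ge0_le_integral => //.
    - apply/measurable_EFinP; apply: measurableT_comp => //.
      exact: measurable_stopped_exponent.
    - apply: emeasurable_funD => //; apply: emeasurable_funM => //.
      exact/measurable_EFinP.
    - move=> w _; rewrite -EFinM -EFinD lee_fin.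
      rewrite /stopped_exponent big_ord_recr big_ord0/= add0r.
      have p0 : passage (path w) 0 m.+1%:R = 0 by rewrite /passage lexx.
      rewrite p0 {2}/stopped p0 K0 !subr0 indicE.
      have [TK|KT] := ltP (passage (path w) b m.+1%:R) m.+1%:R.
        rewrite mem_set// mulr1 ler_wpDr ?expR_ge0// /stopped TK ler_expR.
        rewrite lerBlDr lerDl divr_ge0// mulr_ge0 ?sqr_ge0// passage_ge0//.
      rewrite memNset; last by rewrite /A/= ltNge KT.
      rewrite mulr0 add0r ler_expR lerB//.
        rewrite ler_pM2l//; have := @stopped_le 0 b m.+1%:R w (lexx _) (ltW b0) K0.
        by rewrite {2}/stopped p0 K0 !subr0.
      by rewrite ler_pM2r// ler_wpM2l ?sqr_ge0.
  rewrite ge0_integralD// in le1; last first.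
    by apply: emeasurable_funM => //; exact/measurable_EFinP.
  rewrite ge0_integralZl// in le1; last exact/measurable_EFinP.
  rewrite integral_indic// setIT integral_cst//= probability_setT mule1 in le1.
  have PA : (P (A m) <= P D)%E by apply: le_measure; rewrite ?inE//; exact: bigcup_sup.
  have {}le1 : 1 <= expR (mu * b) * fine (P D) + expR (mu * b - mu ^+ 2 * m.+1%:R / 2).
    rewrite -lee_fin (le_trans le1)// EFinD EFinM fineK ?fin_num_measure//.
    by rewrite leeD2r// lee_wpmul2l// lee_fin expR_ge0.
  have x0 : 0 < mu ^+ 2 * m.+1%:R / 2 by rewrite divr_gt0// mulr_gt0// exprn_gt0.
  have : expR (- (mu * b)) <= fine (P D) + expR (- (mu ^+ 2 * m.+1%:R / 2)).
    rewrite -(ler_pM2l (expR_gt0 (mu * b))) -expRD subrr expR0 mulrDr -expRD.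
    exact: le1.
  have e1 := expR_ge1Dx (- (mu * b)).
  have e2 : expR (- (mu ^+ 2 * m.+1%:R / 2)) <= 2 / (mu ^+ 2 * m.+1%:R).
    rewrite expRN -[leRHS]invf_div lef_pV2 ?posrE ?expR_gt0//.
    by rewrite (le_trans _ (expR_ge1Dx _))// lerDr.
  by move=> e0; rewrite lerBlDr (le_trans e1)// (le_trans e0)// lerD2l.
have PD1 : 1 <= fine (P D).
  rewrite leNgt; apply/negP => D1.
  pose de := 1 - fine (P D).
  have de0 : 0 < de by rewrite subr_gt0.
  pose mu := de / (4 * b).
  have mu0 : 0 < mu by apply: divr_gt0 => //; apply: mulr_gt0.
  have mub : mu * b = de / 4 by rewrite /mu; field; rewrite gt_eqF.
  clearbody mu.
  have mu2 : 0 < mu ^+ 2 by exact: exprn_gt0.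
  have xlt := truncnS_gt (8 / (mu ^+ 2 * de)).
  have := est (Num.truncn (8 / (mu ^+ 2 * de))) mu mu0; rewrite mub.
  set N := (Num.truncn _).+1%:R in xlt *.
  have N0 : 0 < N by [].
  have e1 : 2 / (mu ^+ 2 * N) <= de / 4.
    rewrite ler_pdivrMr ?mulr_gt0//.
    rewrite ltr_pdivrMr ?mulr_gt0// in xlt.
    rewrite [leRHS](_ : _ = N * (mu ^+ 2 * de) / 4); last by field.
    by rewrite ler_pdivlMr// (le_trans _ (ltW xlt))//; lra.
  move=> e2; have : 1 - de / 4 - de / 4 <= fine (P D).
    by apply: le_trans e2; rewrite lerD2l lerN2.
  by rewrite /de; lra.
have PD : P D = 1%E.
  apply/eqP; rewrite eq_le probability_le1//=.
  by move: PD1; rewrite -lee_fin fineK ?fin_num_measure.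
exists (~` D); split; first exact: measurableC.
  by rewrite probability_setC// PD subee.
move=> w /= Hw Dw; apply: Hw; case: Dw => m _ Am.
have K0 : 0 < m.+1%:R :> R by [].
move: Am; rewrite /A/= passageE// => inflt.
have hi : has_inf ([set u | 0 < u < m.+1%:R /\ b < path w u] `|` [set m.+1%:R]).
  split; first by exists m.+1%:R; right.
  by exists 0 => u [[/andP[/ltW]]|->].
move: inflt; rewrite -subr_gt0 => /inf_adherent /(_ hi) [u +].
rewrite addrC subrK => -[[/andP[u0 _] bu]|/= uE] um.
  by exists u.
by move: um; rewrite uE ltxx.
Qed.

End passage_laplace.

Section passage_oo_laplace.
Context {R : realType} {d : measure_display} {T : measurableType d}.
Variable P : probability T R.
Variable B : R -> T -> R.
Hypothesis hB : standard_brownian_motion P B.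
Local Notation path w := (fun u => inverted B u w).

Lemma passage_oo_ge0 (W : R -> R) a : 0 <= passage_oo W a.
Proof.
rewrite /passage_oo; case: ifPn => // _.
have [[u0 S0]|S0] := pselect ([set u | 0 < u /\ a < W u] !=set0).
  by apply: lb_le_inf; [exists u0|move=> u [/ltW]].
rewrite (_ : [set u | _] = set0) ?inf0//; apply/seteqP; split => // u Su.
by apply: S0; exists u.
Qed.

(** The test against the cap gives the limit 0, the value of [passage_oo],
    on the paths that do not exceed [a]. *)
Lemma passage_oo_cvg w a : 0 < a ->
  (if passage (path w) a k.+1%:R < k.+1%:R then passage (path w) a k.+1%:R else 0)
    @[k --> \oo] --> passage_oo (path w) a.
Proof.
move=> a0; have [[u0 [u00 au0]]|S0] := pselect ([set u | 0 < u /\ a < path w u] !=set0).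
  apply: cvg_near_cst; near=> k.
  have uk : u0 < k.+1%:R.
    by rewrite (@lt_trans _ _ k%:R) ?ltr_nat//; near: k; exact: nbhs_infty_gtr.
  rewrite ifT; first exact: (passage_oo_eq u00 uk au0).
  by rewrite (le_lt_trans (passage_le _ u00 uk au0)).
have S0' : [set u | 0 < u /\ a < path w u] = set0.
  by apply/seteqP; split => // u Su; apply: S0; exists u.
rewrite passage_ooE// S0' inf0; apply: cvg_near_cst; near=> k.
rewrite passageE// (_ : [set u | _] = set0); first by rewrite set0U inf1 ltxx.
apply/seteqP; split => // u [/andP[u0 _] au].
by have : [set u | 0 < u /\ a < path w u] u by []; rewrite S0'.
Unshelve. all: by end_near. Qed.

Lemma measurable_passage_oo a : measurable_fun [set: T] (fun w => passage_oo (path w) a).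
Proof.
have [a0|a0] := leP a 0.
  by rewrite /passage_oo a0; exact: measurable_cst.
apply: (@measurable_fun_cvg _ _ _ _ (fun k w =>
  if passage (path w) a k.+1%:R < k.+1%:R then passage (path w) a k.+1%:R else 0)).
  move=> k; apply: measurable_fun_ifT.
  - by apply: measurable_fun_ltr => //; exact: (measurable_passage hB).
  - exact: (measurable_passage hB).
  - exact: measurable_cst.
by move=> w _; exact: passage_oo_cvg.
Qed.

Lemma passage_oo_gt0 w a : immediately_below B w -> unbounded_above B w -> 0 < a ->
  0 < passage_oo (path w) a.
Proof.
move=> iw uw a0; have [u u0 au] := uw a.
have uu1 : u < u + 1 by rewrite ltrDl.
rewrite -(passage_oo_eq u0 uu1 au); apply: passage_gt0 => //.
by rewrite addr_gt0.
Qed.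

Lemma passage_oo_le w a u : 0 < u -> a < path w u -> passage_oo (path w) a <= u.
Proof.
move=> u0 au; rewrite /passage_oo; case: ifPn => _; first exact: ltW.
by apply: ge_inf => //; exists 0 => v [/ltW].
Qed.

Lemma below_passage_oo w a u : 0 < u -> u < passage_oo (path w) a -> path w u <= a.
Proof.
by move=> u0 uT; rewrite leNgt; apply/negP => /(passage_oo_le u0); rewrite leNgt uT.
Qed.

Lemma near_passage_oo w a e : unbounded_above B w -> 0 < a -> 0 < e ->
  exists u, [/\ 0 < u, u < passage_oo (path w) a + e & a < path w u].
Proof.
move=> uw a0 e0; have [v v0 av] := uw a.
have hi : has_inf [set u | 0 < u /\ a < path w u].
  by split; [exists v|exists 0 => u [/ltW]].
by have [u [u0 au] ue] := inf_adherent e0 hi; exists u; rewrite passage_ooE.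
Qed.

(** Almost every path passes all the levels, so the capped passages are the
    uncapped ones as soon as the cap is large. *)
Lemma passage_oo_exponential (a mu : nat -> R) n :
  (forall j, (j < n)%N -> a j <= a j.+1) -> 0 <= a 0%N -> (forall j, 0 <= mu j) ->
  (\int[P]_w (expR (\sum_(j < n) (mu j * (a j.+1 - a j) -
     mu j ^+ 2 * (passage_oo (path w) (a j.+1) - passage_oo (path w) (a j)) / 2)))%:E
   = 1)%E.
Proof.
move=> a_nd a0 mu0.
pose X w := expR (\sum_(j < n) (mu j * (a j.+1 - a j) -
     mu j ^+ 2 * (passage_oo (path w) (a j.+1) - passage_oo (path w) (a j)) / 2)).
have c : (\int[P]_w (expR (stopped_exponent B a mu n k.+1%:R w))%:E @[k --> \oo] -->
    \int[P]_w (X w)%:E)%E.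
  apply: (@bounded_cvg_integral _ _ _ _ _ _ (expR (\sum_(j < n) mu j * (a j.+1 - a j)))).
  - move=> k; apply: measurableT_comp => //.
    exact: (measurable_stopped_exponent hB).
  - apply: measurableT_comp => //; apply: measurable_sum => j.
    apply: measurable_funB => //; apply: measurable_funM => //.
    by apply: measurable_funM => //; apply: measurable_funB; exact: measurable_passage_oo.
  - move=> k w; rewrite ger0_norm ?expR_ge0// ler_expR.
    exact: (stopped_exponent_le hB).
  - apply: filterS2 (ae_immediately_below hB) (ae_unbounded_above hB) => w iw uw.
    have [u u0 anu] := uw (a n).
    apply: cvg_near_cst; near=> k; congr expR.
    have uk : u < k.+1%:R.
      by rewrite (@lt_trans _ _ k%:R) ?ltr_nat//; near: k; exact: nbhs_infty_gtr.
    have au j : (j <= n)%N -> a j < path w u.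
      by move=> jn; apply: le_lt_trans anu; apply: (level_le_last a_nd).
    have st j : (j <= n)%N -> stopped B (a j) k.+1%:R w = a j.
      by move=> jn; rewrite /stopped (le_lt_trans (passage_le _ u0 uk (au j jn))).
    apply: eq_bigr => j _; rewrite !st//; last exact: ltnW.
    rewrite (passage_oo_eq u0 uk (au j.+1 (ltn_ord j))).
    by rewrite (passage_oo_eq u0 uk (au j (ltnW (ltn_ord j)))).
rewrite -/(X _); apply: (cvg_unique _ c) => //.
rewrite (_ : (fun k => _) = cst 1%E); first exact: cvg_cst.
by apply/funext => k; rewrite (stopped_exponent_mean hB).
Unshelve. all: by end_near. Qed.

(** The choice [mu j = sqrt(2 l j)] turns [mu j ^ 2 / 2] into [l j]. The product
    form of the right-hand side is the independence of the increments. *)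
Lemma passage_oo_laplace (a l : nat -> R) n :
  (forall j, (j < n)%N -> a j <= a j.+1) -> 0 <= a 0%N -> (forall j, 0 <= l j) ->
  (\int[P]_w (expR (- \sum_(j < n)
     l j * (passage_oo (path w) (a j.+1) - passage_oo (path w) (a j))))%:E
   = (expR (- \sum_(j < n) Num.sqrt (2 * l j) * (a j.+1 - a j)))%:E)%E.
Proof.
move=> a_nd a0 l0; pose mu j := Num.sqrt (2 * l j).
have m1 := @passage_oo_exponential a mu n a_nd a0 (fun j => sqrtr_ge0 _).
pose s := \sum_(j < n) mu j * (a j.+1 - a j).
have E w : \sum_(j < n) (mu j * (a j.+1 - a j) -
     mu j ^+ 2 * (passage_oo (path w) (a j.+1) - passage_oo (path w) (a j)) / 2) =
   s + - \sum_(j < n)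
     l j * (passage_oo (path w) (a j.+1) - passage_oo (path w) (a j)).
  rewrite /s -sumrB; apply: eq_bigr => j _; rewrite sqr_sqrtr ?mulr_ge0//.
  by congr (_ - _); field.
have mL : measurable_fun [set: T] (fun w => expR (- \sum_(j < n)
     l j * (passage_oo (path w) (a j.+1) - passage_oo (path w) (a j)))).
  apply: measurableT_comp => //; apply: measurableT_comp => //.
  apply: measurable_sum => j; apply: measurable_funM => //.
  by apply: measurable_funB; exact: measurable_passage_oo.
move: m1; under eq_integral do rewrite E expRD EFinM.
rewrite ge0_integralZl//; last exact/measurable_EFinP.
move=> m1; rewrite -[LHS]mul1e -[X in (X * _)%E = _](_ : (expR (- s))%:E * (expR s)%:E = 1)%E.
  by rewrite -muleA m1 mule1.
by rewrite -EFinM -expRD addNr expR0.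
Qed.

Lemma passage_oo_laplace1 a : 0 <= a ->
  (\int[P]_w (expR (- passage_oo (path w) a))%:E = (expR (- (Num.sqrt 2 * a)))%:E)%E.
Proof.
move=> a0; pose la (j : nat) : R := if j is 0 then 0 else a.
have L := @passage_oo_laplace la (fun=> 1) 1%N _ (lexx _) (fun=> ler01).
rewrite -[in RHS](mulr1 2) -[X in Num.sqrt (2 * 1) * X]subr0.
have := L _; rewrite big_ord_recr big_ord0/= add0r => <-; last by move=> [|//].
apply: eq_integral => w _; rewrite big_ord_recr big_ord0/= add0r mul1r.
by have -> : passage_oo (path w) 0 = 0; rewrite ?subr0// /passage_oo lexx.
Qed.

End passage_oo_laplace.

(** * The fragmentation time *)

Section fragmentation_time.
Context {R : realType}.
Implicit Types (x : R -> R) (th : R).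

Local Notation tau x th := (tau_frag x (reflect_path th x)).

(** The two paths differ at all times after the last crossing. *)
Lemma tau_fragE x th : tau x th = maxe 0%E (last_crossing th x).
Proof.
set L := last_crossing th x.
have DE : [set t : R | 0 <= t /\ x t != reflect_path th x t] =
    [set t | 0 <= t /\ (L < t%:E)%E].
  apply/seteqP; split => t /= [t0]; rewrite /reflect_path -/L.
    by case: ifPn => [_|]; [rewrite eqxx|rewrite -ltNge].
  move=> Lt; split => //; case: ifPn => [tL|_].
    by move: Lt; rewrite ltNge tL.
  apply/eqP => E; move: Lt; apply/negP; rewrite -leNgt; apply: ereal_sup_ubound.
  by exists t => //=; split => //; lra.
rewrite /tau_frag DE; apply/eqP; rewrite eq_le; apply/andP; split.
  case LE : L => [r||]; last 2 first.
  - by rewrite /maxe ltry leey.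
  - rewrite max_l ?leNye//; apply: ereal_inf_lbound; exists 0 => //=.
    by split => //; rewrite ltNyr.
  apply/lee_addgt0Pr => e e0; apply: ereal_inf_lbound.
  exists (Num.max 0 r + e) => /=.
    rewrite lte_fin; split; last by rewrite ltr_pwDr// le_max lexx orbT.
    by rewrite addr_ge0 ?(ltW e0)// le_max lexx.
  by rewrite EFinD EFin_max.
apply: le_ereal_inf_tmp => _ [t [t0 Lt] <-].
by rewrite ge_max lee_fin t0 ltW.
Qed.

Lemma tau_frag_ge0 x th : (0 <= tau x th)%E.
Proof. by rewrite tau_fragE le_max lexx. Qed.

Lemma tau_frag_crossing x th s : 0 <= s -> x s = 2^-1 * th * s ->
  (s%:E <= tau x th)%E.
Proof.
move=> s0 xs; rewrite tau_fragE le_max; apply/orP; right.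
by apply: ereal_sup_ubound; exists s.
Qed.

Lemma tau_frag_le x th c : (0 <= c)%E ->
  (forall s, 0 < s -> x s = 2^-1 * th * s -> (s%:E <= c)%E) -> (tau x th <= c)%E.
Proof.
move=> c0 H; rewrite tau_fragE ge_max c0/=; apply: ge_ereal_sup => _ [s [s0 xs] <-].
have [->//|sn0] := eqVneq s 0.
by apply: H => //; rewrite lt_neqAle eq_sym sn0.
Qed.

Lemma tau_frag_gt x th t : 0 <= t ->
  ((t%:E < tau x th)%E <-> exists2 s, t < s & x s = 2^-1 * th * s).
Proof.
move=> t0; split => [tt|[s ts xs]]; last first.
  rewrite (lt_le_trans _ (tau_frag_crossing _ xs))//.
  by rewrite (le_trans t0)// ltW.
move: tt; rewrite tau_fragE lt_max => /orP[|/ereal_sup_gt[_ [s [s0 xs] <-]]].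
  by rewrite lte_fin ltNge t0.
by rewrite lte_fin => ts; exists s.
Qed.

(** The crossings after time [t], in countable terms: a continuous function
    with arbitrarily small values at rational points of a compact interval
    vanishes somewhere in it. *)
Lemma crossing_rational x th t : 0 <= t -> continuous_path x ->
  ((exists2 s, t < s & x s = 2^-1 * th * s) <->
   exists N : nat, forall k : nat, exists q : rat,
     [/\ t + N.+1%:R^-1 <= ratr q :> R, ratr q <= N.+1%:R :> R &
      `|x (ratr q) - 2^-1 * th * ratr q| < k.+1%:R^-1 ]).
Proof.
move=> t0 cx; pose f s := `|x s - 2^-1 * th * s|.
have cf : {within [set t : R | 0 <= t], continuous f}.
  have cl : {within [set t : R | 0 <= t], continuous (fun s : R => 2^-1 * th * s)}.
    by apply: continuous_subspaceT; exact: mulrl_continuous.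
  by move=> s; apply: cvg_norm; apply: cvgB; [exact: cx|exact: cl].
split=> [[s ts xs]|[N HN]].
  have st0 : 0 < s - t by rewrite subr_gt0.
  pose N := maxn (Num.truncn (s - t)^-1) (Num.truncn s).
  have N1 : t + N.+1%:R^-1 < s.
    rewrite -ltrBrDl -[ltRHS]invrK ltf_pV2 ?posrE ?invr_gt0//.
    by rewrite (lt_le_trans (truncnS_gt _))// ler_nat ltnS leq_maxl.
  have N2 : s < N.+1%:R.
    by rewrite (lt_le_trans (truncnS_gt _))// ler_nat ltnS leq_maxr.
  exists N => k.
  have s0 : 0 < s by exact: le_lt_trans ts.
  have fs : f s < k.+1%:R^-1 by rewrite /f xs subrr normr0.
  have cfs : {for s, continuous f} by exact: (continuous_path_pos cf).
  have /cvgr_lt /(_ _ fs) /nbhs_ballP[e /= e0 He] := cfs.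
  have lt1 : Num.max (s - e) (t + N.+1%:R^-1) < s.
    by rewrite gt_max N1 ltrBlDr ltrDl e0.
  have [q] := rat_in_itvoo lt1; rewrite in_itv/= gt_max => /andP[/andP[q1 q2] q3].
  exists q; split; [exact: ltW|by rewrite ltW// (lt_trans q3)|].
  by apply: He; rewrite /ball/= ger0_norm ?subr_ge0 ?(ltW q3)//; lra.
have Nt : t + N.+1%:R^-1 <= N.+1%:R.
  by have [q [q1 q2 _]] := HN 0%N; exact: le_trans q2.
have tN : t < t + N.+1%:R^-1 by rewrite ltrDl.
have sub : `[t + N.+1%:R^-1, N.+1%:R]%classic `<=` [set t : R | 0 <= t].
  by move=> z /=; rewrite in_itv/= => /andP[+ _]; apply/le_trans/ltW/(le_lt_trans t0).
have [c cin cmin] := EVT_min Nt (continuous_subspaceW sub cf).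
exists c; first by move: cin; rewrite in_itv/= => /andP[+ _]; exact: lt_le_trans.
apply/eqP; rewrite -subr_eq0 -normr_eq0 eq_le normr_ge0 andbT leNgt; apply/negP => fc.
have [q [q1 q2 fq]] := HN (Num.truncn (f c)^-1).
have := cmin (ratr q); rewrite in_itv/= q1 q2 => /(_ isT); apply/negP; rewrite -ltNge.
rewrite (lt_trans fq)// -[ltRHS]invrK ltf_pV2 ?posrE ?invr_gt0//.
exact: truncnS_gt.
Qed.

End fragmentation_time.

Section fragmentation_time_measurable.
Context {R : realType} {d : measure_display} {T : measurableType d}.
Variable B : R -> T -> R.
Hypothesis mB : process B.
Hypothesis cB : forall w, continuous_path (B ^~ w).

Lemma measurable_tau_frag th : measurable_fun [set: T]
  (fun w => tau_frag (B ^~ w) (reflect_path th (B ^~ w))).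
Proof.
apply: (measurability _ (ErealGenOInfty.measurableE R)) => //.
move=> _ [_ [t ->] <-]; rewrite setTI.
have [t0|t0] := ltP t 0.
  rewrite (_ : _ @^-1` _ = setT)//; apply/seteqP; split => // w _ /=.
  by rewrite in_itv/= andbT (lt_le_trans _ (tau_frag_ge0 _ _)).
rewrite (_ : _ @^-1` _ = \bigcup_(N : nat) \bigcap_(k : nat) \bigcup_(q : rat)
    [set w | [/\ t + N.+1%:R^-1 <= ratr q :> R, ratr q <= N.+1%:R :> R &
      `|B (ratr q) w - 2^-1 * th * ratr q| < k.+1%:R^-1 ]]); last first.
  apply/seteqP; split => w /=; rewrite in_itv/= andbT.
    move/(tau_frag_gt _ _ t0)/(crossing_rational _ t0 (@cB w)) => [N HN].
    by exists N => // k _; have [q Hq] := HN k; exists q.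
  move=> [N _ HN]; apply/(tau_frag_gt _ _ t0)/(crossing_rational _ t0 (@cB w)).
  by exists N => k; have [q _ Hq] := HN k I; exists q.
apply: bigcupT_measurable => N; apply: bigcapT_measurable => k.
apply: bigcupT_measurable_rat => q.
have [q1|q1] := boolP ((t + N.+1%:R^-1 <= ratr q :> R) && (ratr q <= N.+1%:R :> R)); last first.
  rewrite (_ : [set w | _] = set0)//; apply/seteqP; split => // w [h1 h2 _].
  by move/negP: q1; apply; rewrite h1 h2.
rewrite (_ : [set w | _] = (fun w => `|B (ratr q) w - 2^-1 * th * ratr q|) @^-1`
  `]-oo, k.+1%:R^-1[); last first.
  apply/seteqP; split => w /=; rewrite in_itv/=; first by case.
  by move: q1 => /andP[h1 h2] h3.
rewrite -[X in measurable X]setTI.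
suff mf : measurable_fun [set: T] (fun w => `|B (ratr q) w - 2^-1 * th * ratr q|).
  by apply: mf.
apply: measurableT_comp => //; apply: measurable_funB => //; apply: mB.
move: q1 => /andP[h1 _]; rewrite (le_trans _ h1)// addr_ge0//.
Qed.

End fragmentation_time_measurable.

Section tau_and_passage.
Context {R : realType} {d : measure_display} {T : measurableType d}.
Variable P : probability T R.
Variable B : R -> T -> R.
Hypothesis hB : standard_brownian_motion P B.
Local Notation path w := (fun u => inverted B u w).
Local Notation tau th w := (tau_frag (B ^~ w) (reflect_path th (B ^~ w))).

Let cB w : continuous_path (B ^~ w). Proof. by case: hB. Qed.

Lemma path_invertedE w s : B 0 w = 0 -> 0 < s -> B s w = s * path w s^-1.
Proof.
by move=> B0 s0; rewrite /inverted B0 subr0 invrK mulrA divff ?mul1r// gt_eqF.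
Qed.

Lemma crossing_between w a s s' : 0 <= s -> s <= s' ->
  Num.min (B s w - a * s) (B s' w - a * s') <= 0 <=
  Num.max (B s w - a * s) (B s' w - a * s') ->
  exists2 c, s <= c & B c w = a * c.
Proof.
move=> s0 ss' mM; have cf : {within `[s, s'], continuous (fun c => B c w - a * c)}.
  have sub : `[s, s']%classic `<=` [set t : R | 0 <= t].
    by move=> z /=; rewrite in_itv/= => /andP[+ _]; exact: le_trans.
  have cl : {within `[s, s'], continuous (fun c : R => a * c)}.
    by apply: continuous_subspaceT; exact: mulrl_continuous.
  have cx := continuous_subspaceW sub (@cB w).
  by move=> c; apply: cvgB; [exact: cx|exact: cl].
have [c + fc] := IVT ss' cf mM; rewrite in_itv/= => /andP[sc _].
by exists c => //; apply/eqP; rewrite -subr_eq0 fc.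
Qed.

(** A crossing of the line of slope [a] at time [s] is a visit of the inverted
    path to [a] at time [1/s], hence follows the passages above lower levels. *)
Lemma tau_le_passage w a a' : B 0 w = 0 -> immediately_below B w ->
  unbounded_above B w -> 0 < a' -> a' < a ->
  (tau (2 * a) w <= ((passage_oo (path w) a')^-1)%:E)%E.
Proof.
move=> B0 iw uw a'0 a'a; have T0 := passage_oo_gt0 iw uw a'0.
apply: tau_frag_le; first by rewrite lee_fin invr_ge0 ltW.
move=> s s0; rewrite mulrA mulVf// mul1r => Bs.
rewrite lee_fin -[leLHS]invrK lef_pV2 ?posrE ?invr_gt0//.
apply: passage_oo_le; first by rewrite invr_gt0.
apply: lt_le_trans a'a _; rewrite /inverted B0 subr0 invrK Bs mulrC mulfK//.
by rewrite gt_eqF.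
Qed.

(** After a passage above level [a] at time [u] in inverted time, the path is
    above the line of slope [a] at time [1/u], and it is below that line at all
    large times: it crosses the line after [1/u]. *)
Lemma passage_le_tau w a : B 0 w = 0 -> immediately_below B w ->
  unbounded_above B w -> 0 < a ->
  (((passage_oo (path w) a)^-1)%:E <= tau (2 * a) w)%E.
Proof.
move=> B0 iw uw a0; have T0 := passage_oo_gt0 iw uw a0.
set t := passage_oo (path w) a in T0 *.
have step u : 0 < u -> a < path w u -> ((u^-1)%:E <= tau (2 * a) w)%E.
  move=> u0 au; have a20 : 0 < a / 2 by rewrite divr_gt0.
  have T20 := passage_oo_gt0 iw uw a20.
  pose v := Num.min u (passage_oo (path w) (a / 2) / 2).
  have v0 : 0 < v by rewrite lt_min u0 divr_gt0.
  have vu : v <= u by rewrite ge_min lexx.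
  have vT : v < passage_oo (path w) (a / 2).
    by rewrite gt_min; apply/orP; right; lra.
  have av : path w v < a.
    by apply: (le_lt_trans (below_passage_oo v0 vT)); lra.
  have uv : u^-1 <= v^-1 by rewrite lef_pV2.
  have Bu : 0 <= B u^-1 w - a * u^-1.
    rewrite (path_invertedE B0) ?invr_gt0// invrK [a * _]mulrC -mulrBr.
    by apply: mulr_ge0; rewrite ?invr_ge0 ?subr_ge0; exact: ltW.
  have Bv : B v^-1 w - a * v^-1 <= 0.
    rewrite (path_invertedE B0) ?invr_gt0// invrK [a * _]mulrC -mulrBr.
    by apply: mulr_ge0_le0; rewrite ?invr_ge0 ?subr_le0; exact: ltW.
  have u'0 : 0 <= u^-1 by rewrite invr_ge0 ltW.
  have [|c uc Bc] := @crossing_between w a _ _ u'0 uv.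
    by rewrite ge_min le_max Bu Bv orbT.
  apply: (@le_trans _ _ c%:E); first by rewrite lee_fin.
  apply: tau_frag_crossing; first exact: le_trans uc.
  by rewrite mulrA mulVf// mul1r.
rewrite leNgt; apply/negP => lt.
have := tau_frag_ge0 (B ^~ w) (2 * a).
move: lt step; case: (tau (2 * a) w) => [r| |]; last 2 first.
- by rewrite ltNge leey.
- by move=> _ _; rewrite leeNy_eq.
rewrite lte_fin => rt step; rewrite lee_fin => r0.
pose r' := (r + t^-1) / 2.
have r'0 : 0 < r' by rewrite /r'; lra.
have r't : r' < t^-1 by rewrite /r'; lra.
have e0 : 0 < r'^-1 - t by rewrite subr_gt0 -[ltLHS]invrK ltf_pV2 ?posrE ?invr_gt0.
have [u [u0 ut au]] := near_passage_oo uw a0 e0.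
have := step u u0 au; rewrite lee_fin => ur.
have : r' <= u^-1 by rewrite -[leLHS]invrK lef_pV2 ?posrE ?invr_gt0// -/t in ut *; lra.
by rewrite /r'; lra.
Qed.

(** The passage times above small levels tend to 0, since their Laplace
    transforms tend to 1: the inverted path takes positive values at
    arbitrarily small times. *)
Lemma ae_positive_near0 : {ae P, forall w, forall e, 0 < e ->
  exists u, [/\ 0 < u, u < e & 0 < path w u]}.
Proof.
suff H (k : nat) : {ae P, forall w, exists2 m : nat,
    passage_oo (path w) m.+1%:R^-1 < k.+1%:R^-1 & True}.
  apply: filterS2 (ae_unbounded_above hB) (ae_foralln H) => w uw Hw e e0.
  have [m Tm _] := Hw (Num.truncn e^-1).
  have m0 : 0 < m.+1%:R^-1 :> R by rewrite invr_gt0.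
  have ke : (Num.truncn e^-1).+1%:R^-1 <= e.
    rewrite -[leRHS]invrK lef_pV2 ?posrE ?invr_gt0//.
    exact/ltW/truncnS_gt.
  have d0 : 0 < e - passage_oo (path w) m.+1%:R^-1.
    by rewrite subr_gt0 (lt_le_trans Tm).
  have [u [u0 ue mu]] := near_passage_oo uw m0 d0.
  by exists u; split => //; [lra|exact: lt_trans mu].
set de : R := k.+1%:R^-1; have de0 : 0 < de by rewrite invr_gt0.
pose Z := \bigcap_(m : nat) [set w | de <= passage_oo (path w) m.+1%:R^-1].
have mZ : measurable Z.
  apply: bigcapT_measurable => m.
  have := @measurable_passage_oo _ _ _ _ _ hB m.+1%:R^-1 measurableT
    `[de, +oo[%classic (measurable_itv _).
  by rewrite setTI; congr measurable; apply/seteqP; split => w /=; rewrite in_itv/= andbT.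
suff PZ : P Z = 0%E.
  exists Z; split => // w /= Hw m _ /=; rewrite leNgt; apply/negP => lt.
  by apply: Hw; exists m.
have e1 : expR (- de) < 1 by rewrite -expR0 ltr_expR oppr_lt0.
have est (m : nat) : (1 - expR (- de)) * fine (P Z) <= Num.sqrt 2 * m.+1%:R^-1.
  have m0 : 0 <= m.+1%:R^-1 :> R by rewrite invr_ge0.
  have L := passage_oo_laplace1 hB m0.
  have mI : measurable_fun [set: T] (fun w => expR (- passage_oo (path w) m.+1%:R^-1)).
    apply: measurableT_comp => //; apply: measurableT_comp => //.
    exact: (measurable_passage_oo hB).
  have le1 : (\int[P]_w ((expR (- passage_oo (path w) m.+1%:R^-1))%:E +
      (1 - expR (- de))%:E * (\1_Z w)%:E) <= 1)%E.
    apply: (@le_trans _ _ (\int[P]_w cst 1 w)%E); last first.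
      by rewrite integral_cst// mul1e probability_le1.
    apply: ge0_le_integral => //.
    - by move=> w _; rewrite adde_ge0 ?mule_ge0// lee_fin ?expR_ge0// subr_ge0 ltW.
    - apply: emeasurable_funD; first exact/measurable_EFinP.
      by apply: emeasurable_funM => //; exact/measurable_EFinP.
    - move=> w _; rewrite -EFinM -EFinD lee_fin indicE.
      case: (boolP (w \in Z)) => [/set_mem /(_ m I) /= dT|_].
        have : expR (- passage_oo (path w) m.+1%:R^-1) <= expR (- de).
          by rewrite ler_expR lerN2.
        by rewrite mulr1; lra.
      rewrite mulr0 addr0 -expR0 ler_expR oppr_le0; exact: passage_oo_ge0.
  rewrite ge0_integralD// in le1; last 3 first.
  - exact/measurable_EFinP.
  - by move=> w _; rewrite mule_ge0// lee_fin subr_ge0 ltW.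
  - by apply: emeasurable_funM => //; exact/measurable_EFinP.
  rewrite ge0_integralZl// in le1; last 2 first.
  - exact/measurable_EFinP.
  - by rewrite lee_fin subr_ge0 ltW.
  have PZE : P Z = (fine (P Z))%:E by rewrite fineK ?fin_num_measure.
  rewrite L integral_indic// setIT [X in (_ * X)%E]PZE -EFinM -EFinD in le1.
  rewrite lee_fin in le1; have := expR_ge1Dx (- (Num.sqrt 2 * m.+1%:R^-1)).
  move: le1; set y := (1 - _) * _; set z := Num.sqrt 2 * _; set e := expR (- z).
  move=> le1 h; rewrite -(lerD2l e) (le_trans le1)// -lerBlDr.
  exact: h.
have PZ0 : 0 <= fine (P Z) by exact: fine_ge0.
suff PZ1 : fine (P Z) <= 0.
  by rewrite -[P Z]fineK ?fin_num_measure//; congr EFin; apply/eqP; rewrite eq_le PZ1.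
rewrite leNgt; apply/negP => PZ1.
pose x := (1 - expR (- de)) * fine (P Z).
have x0 : 0 < x by rewrite mulr_gt0// subr_gt0.
have := est (Num.truncn (Num.sqrt 2 / x)); apply/negP; rewrite -ltNge -/x.
by rewrite ltr_pdivrMr// mulrC -ltr_pdivrMr// truncnS_gt.
Qed.

(** Both signs are taken at arbitrarily large times, hence zeros occur there. *)
Lemma tau0_oo w : B 0 w = 0 ->
  (forall e, 0 < e -> exists u, [/\ 0 < u, u < e & 0 < path w u]) ->
  (forall e, 0 < e -> exists u, [/\ 0 < u, u < e & path w u < 0]) ->
  tau 0 w = +oo%E.
Proof.
move=> B0 pos neg; apply/eqyP => r r0.
have ri0 : 0 < r^-1 by rewrite invr_gt0.
have [u [u0 ur Wu]] := pos _ ri0; have [v [v0 vr Wv]] := neg _ ri0.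
have ui0 : 0 < u^-1 by rewrite invr_gt0.
have vi0 : 0 < v^-1 by rewrite invr_gt0.
have Bu : 0 <= B u^-1 w - 0 * u^-1.
  rewrite (path_invertedE B0)// invrK mul0r subr0.
  by apply: mulr_ge0; exact: ltW.
have Bv : B v^-1 w - 0 * v^-1 <= 0.
  rewrite (path_invertedE B0)// invrK mul0r subr0.
  by apply: mulr_ge0_le0; exact: ltW.
have ru : r < u^-1 by rewrite -[ltLHS]invrK ltf_pV2 ?posrE ?invr_gt0.
have rv : r < v^-1 by rewrite -[ltLHS]invrK ltf_pV2 ?posrE ?invr_gt0.
have done c : r <= c -> B c w = 0 * c -> (r%:E <= tau 0 w)%E.
  move=> rc Bc; apply: (@le_trans _ _ c%:E); first by rewrite lee_fin.
  apply: tau_frag_crossing; first by rewrite (le_trans (ltW r0)).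
  by rewrite mulr0 Bc.
have [uv|vu] := leP u^-1 v^-1.
  have [|c uc Bc] := @crossing_between w 0 _ _ (ltW ui0) uv.
    by rewrite ge_min le_max Bu Bv orbT.
  by apply: (done c) => //; rewrite (le_trans (ltW ru)).
have [|c vc Bc] := @crossing_between w 0 _ _ (ltW vi0) (ltW vu).
  by rewrite ge_min le_max Bu Bv orbT.
by apply: (done c) => //; rewrite (le_trans (ltW rv)).
Qed.

End tau_and_passage.

(** * The subordinator of reciprocal fragmentation times *)

Lemma measurable_inv {R : realType} : measurable_fun [set: R] (@GRing.inv R).
Proof.
rewrite (_ : setT = `]-oo, 0[ `|` ([set 0] `|` `]0, +oo[)).
  apply/measurable_funU => //; first exact: measurableU.
  split; last (apply/measurable_funU => //; split); last 2 first.
  - exact: measurable_fun_set1.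
  - apply: open_continuous_measurable_fun; first exact: interval_open.
    by move=> x; rewrite inE/= in_itv/= andbT => x0; apply: inv_continuous; rewrite gt_eqF.
  - apply: open_continuous_measurable_fun; first exact: interval_open.
    by move=> x; rewrite inE/= in_itv/= => x0; apply: inv_continuous; rewrite lt_eqF.
apply/seteqP; split => // x _ /=; rewrite !in_itv/= andbT.
by have [x0|x0|->] := ltgtP x 0; [left|right; right|right; left].
Qed.

Section brownian_symmetries.
Context {R : realType} {d : measure_display} {T : measurableType d}.
Variable P : probability T R.
Variable B : R -> T -> R.
Hypothesis hB : standard_brownian_motion P B.

Lemma opp_brownian : standard_brownian_motion P (fun t w => - B t w).
Proof.
case: hB => mB cB B0 indep normal; split.
- by move=> t t0; apply: measurableT_comp => //; exact: mB.
- by move=> w t; apply: cvgN; exact: cB.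
- by apply: filterS B0 => w ->; rewrite oppr0.
- move=> n t t0 tn A mA.
  pose A' i := [set x : R | A i (- x)].
  have mA' i : measurable (A' i).
    have mo : measurable_fun [set: R] (-%R : R -> R) by exact: oppr_measurable.
    by rewrite -[A' i]setTI; exact: (mo measurableT).
  have E (i : 'I_n) : (fun w => - B (t i.+1) w - - B (t i) w) @^-1` A i =
      (fun w => B (t i.+1) w - B (t i) w) @^-1` A' i.
    by apply/seteqP; split => w /=; rewrite /A' /= opprB opprK addrC.
  under eq_bigcapr do rewrite E.
  under [RHS]eq_bigr do rewrite E.
  exact: indep.
- move=> s t s0 st A mA; rewrite -normal_probN//; last first.
    by rewrite gt_eqF// sqrtr_gt0 subr_gt0.
  rewrite -normal//.
    by congr (P _); apply/seteqP; split => w /=; rewrite opprB opprK addrC.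
  have mo : measurable_fun [set: R] (-%R : R -> R) by exact: oppr_measurable.
  by rewrite -[X in measurable X]setTI; exact: (mo measurableT).
Qed.

Lemma shift_brownian (u : R) : 0 <= u ->
  standard_brownian_motion P (fun t w => B (u + t) w - B u w).
Proof.
move=> u0; case: hB => mB cB B0 indep normal; split.
- by move=> t t0; apply: measurable_funB; apply: mB => //; rewrite addr_ge0.
- move=> w; have sub : continuous_path (fun t => B (u + t) w).
    apply/subspace_continuousP => x x0.
    have ux0 : 0 <= u + x by rewrite addr_ge0.
    have /subspace_continuousP /(_ _ ux0) cx := cB w.
    apply: cvg_trans cx => U /= [e /= e0 He]; exists e => //= t xt t0.
    apply: He => /=; last by rewrite addr_ge0.
    by rewrite opprD addrACA subrr add0r.
  by move=> t; apply: cvgB; [exact: sub|exact: cvg_cst].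
- by apply: aeW => w; rewrite addr0 subrr.
- move=> n t t0 tn A mA.
  have E (i : 'I_n) : (fun w => B (u + t i.+1) w - B u w - (B (u + t i) w - B u w)) @^-1` A i =
      (fun w => B (u + t i.+1) w - B (u + t i) w) @^-1` A i.
    by apply/seteqP; split => w /=; rewrite opprB addrA subrK.
  under eq_bigcapr do rewrite E.
  under [RHS]eq_bigr do rewrite E.
  apply: (indep n (fun i => u + t i)) => //; first by rewrite addr_ge0.
  by move=> i ni; rewrite lerD2l tn.
- move=> s t s0 st A mA.
  rewrite (_ : t - s = (u + t) - (u + s)); last by rewrite opprD addrACA subrr add0r.
  rewrite -normal ?addr_ge0 ?ltrD2l//.
  by congr (P _); apply/seteqP; split => w /=; rewrite opprB addrA subrK.
Qed.

End brownian_symmetries.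

Section half_stable.
Context {R : realType} {d : measure_display} {T : measurableType d}.
Variable P : probability T R.
Variable B : R -> T -> R.
Hypothesis hB : standard_brownian_motion P B.
Local Notation path w := (fun u => inverted B u w).
Local Notation tau th w := (tau_frag (B ^~ w) (reflect_path th (B ^~ w))).

Record regular (w : T) : Prop := Regular {
  regular0 : B 0 w = 0;
  regular_below : immediately_below B w;
  regular_unbounded : unbounded_above B w;
  regular_tau0 : tau 0 w = +oo%E }.

Lemma ae_regular : {ae P, forall w, regular w}.
Proof.
have hN := opp_brownian hB.
have B0 : {ae P, forall w, B 0 w = 0} by case: hB.
have pos := ae_positive_near0 hB; have neg := ae_positive_near0 hN.
have H1 : {ae P, forall w, B 0 w = 0 /\ immediately_below B w}.
  by apply: filterS2 B0 (ae_immediately_below hB) => w.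
have H2 : {ae P, forall w, (B 0 w = 0 /\ immediately_below B w) /\ unbounded_above B w}.
  by apply: filterS2 H1 (ae_unbounded_above hB) => w.
apply: filterS3 H2 pos neg => w [[w0 iw] uw] posw negw; split => //.
apply: (tau0_oo hB w0 posw) => e e0; have [u [u0 ue Wu]] := negw e e0.
exists u; split => //; move: Wu; rewrite /inverted.
by rewrite -opprD mulrN oppr_gt0.
Qed.

Lemma tau_regular w th : regular w -> 0 < th -> exists2 r, 0 < r & tau th w = r%:E.
Proof.
move=> [B0 iw uw _] th0; have a0 : 0 < th / 2 by rewrite divr_gt0.
have a'0 : 0 < th / 4 by rewrite divr_gt0.
have aa : th / 4 < th / 2 by lra.
have := tau_le_passage B0 iw uw a'0 aa; have := passage_le_tau hB B0 iw uw a0.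
have -> : 2 * (th / 2) = th by rewrite mulrC divfK.
have T0 := passage_oo_gt0 iw uw a0.
case: (tau th w) => [r| |]//.
by rewrite lee_fin => Tr _; exists r => //; apply: lt_le_trans Tr; rewrite invr_gt0.
Qed.

Lemma tau_regular_le w s t : regular w -> 0 < s -> s <= t -> (tau t w <= tau s w)%E.
Proof.
move=> [B0 iw uw _] s0; rewrite le_eqVlt => /predU1P[->//|st].
have a0 : 0 < s / 2 by rewrite divr_gt0.
have aa : s / 2 < t / 2 by lra.
have := tau_le_passage B0 iw uw a0 aa; have := passage_le_tau hB B0 iw uw a0.
have E (x : R) : 2 * (x / 2) = x by rewrite mulrC divfK.
by rewrite !E => h1 h2; exact: le_trans h1.
Qed.

Section subordinator.
Variables (N : set T) (mN : measurable N) (PN : P N = 0%E).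
Hypothesis N_regular : forall w, ~ N w -> regular w.

(** The value 0 on the negligible set [N] makes every path nondecreasing and
    every value measurable. *)
Definition subordinator (th : R) (w : T) : R :=
  if (0 < th) && (w \notin N) then (fine (tau th w))^-1 else 0.

Lemma measurable_subordinator th : measurable_fun [set: T] (subordinator th).
Proof.
rewrite /subordinator; have [th0|th0] /= := ltP 0 th; last exact: measurable_cst.
apply: measurable_fun_ifT; last exact: measurable_cst.
- apply: (measurable_fun_bool true) => /=.
  rewrite setTI (_ : _ @^-1` _ = ~` N); first exact: measurableC.
  apply/seteqP; split => w /=; first by move/negP => h Nw; apply: h; rewrite inE.
  by move=> Nw; apply/negP; rewrite inE.
- case: hB => mB cB _ _ _.
  have mt : measurable_fun [set: T] (fun w => fine (tau th w)).
    apply: measurableT_comp => //; exact: measurable_tau_frag.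
  exact: measurableT_comp measurable_inv mt.
Qed.

End subordinator.
End half_stable.

Section laplace_independence.
Context {R : realType} {d : measure_display} {T : measurableType d}.
Variable P : probability T R.
Variables (n : nat) (X : 'I_n -> T -> R) (phi : 'I_n -> R -> R).
Hypothesis mX : forall i, measurable_fun [set: T] (X i).
Hypothesis X0 : forall i w, 0 <= X i w.
Hypothesis phiE : forall i l, 0 <= l ->
  (\int[P]_w (expR (- (l * X i w)))%:E = (phi i l)%:E)%E.
Hypothesis joint : forall l : 'I_n -> R, (forall i, 0 <= l i) ->
  (\int[P]_w (expR (- \sum_(i < n) l i * X i w))%:E = (\prod_(i < n) phi i (l i))%:E)%E.

Let phi01 i l : 0 <= l -> 0 <= phi i l <= 1.
Proof.
move=> l0; rewrite -!lee_fin -(phiE i l0); apply/andP; split.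
  by apply: integral_ge0 => w _; rewrite lee_fin expR_ge0.
apply: (@le_trans _ _ (\int[P]_w cst 1%E w)%E); last first.
  by rewrite integral_cst// mul1e probability_le1.
apply: ge0_le_integral => //.
- apply/measurable_EFinP; apply: measurableT_comp => //; apply: measurableT_comp => //.
  exact: measurable_funM.
- by move=> w _; rewrite lee_fin -expR0 ler_expR oppr_le0 mulr_ge0.
Qed.

(** The factors are turned one at a time from exponentials into indicators:
    with the other factors as weight, uniqueness of the Laplace transform
    applies to the next one. *)
Let laplace_prefix (A : 'I_n -> set R) (mA : forall i, measurable (A i)) k :
  (k <= n)%N -> forall l : 'I_n -> R, (forall i, 0 <= l i) ->
  (\int[P]_w (\prod_(i < n)
      (if (i < k)%N then \1_(A i) (X i w) else expR (- (l i * X i w))))%:E =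
   (\prod_(i < n) (if (i < k)%N then fine (P (X i @^-1` A i)) else phi i (l i)))%:E)%E.
Proof.
elim: k => [_|k IH kn] l l0.
  rewrite -joint//; apply: eq_integral => w _; congr EFin.
  by rewrite -sumrN expR_sum.
pose K := Ordinal kn.
pose Z w := \prod_(i < n | i != K)
  (if (i < k)%N then \1_(A i) (X i w) else expR (- (l i * X i w))).
pose c := \prod_(i < n | i != K)
  (if (i < k)%N then fine (P (X i @^-1` A i)) else phi i (l i)).
have neqK (i : 'I_n) : i != K -> (i < k.+1)%N = (i < k)%N.
  by move=> iK; rewrite ltnS leq_eqVlt; move: iK; rewrite -val_eqE/= => /negPf ->.
have mprei i : measurable (X i @^-1` A i).
  by rewrite -[X in measurable X]setTI; exact: mX.
have mZ : measurable_fun [set: T] Z.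
  rewrite (_ : Z = fun w => \prod_(i <- [seq i <- index_enum 'I_n | i != K])
      (if (i < k)%N then \1_(A i) (X i w) else expR (- (l i * X i w)))); last first.
    by apply/funext => w; rewrite big_filter.
  apply: measurable_prod => i _; case: (ltnP i k) => _.
    exact: (measurableT_comp (measurable_indic (mA i))).
  by apply: measurableT_comp => //; apply: measurableT_comp => //; exact: measurable_funM.
have Z01 w : 0 <= Z w <= 1.
  have Zi (i : 'I_n) : 0 <= (if (i < k)%N then \1_(A i) (X i w) else expR (- (l i * X i w))) <= 1.
    case: ifPn => _; first by rewrite indicE ler0n lern1 leq_b1.
    by rewrite expR_ge0/= -expR0 ler_expR oppr_le0 mulr_ge0.
  apply/andP; split; first by apply: prodr_ge0 => i _; have /andP[] := Zi i.
  by apply: prodr_ile1 => i _; exact: Zi.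
have c01 : 0 <= c <= 1.
  have m01 (i : 'I_n) : 0 <= (if (i < k)%N then fine (P (X i @^-1` A i)) else phi i (l i)) <= 1.
    case: ifPn => _; last exact: phi01.
    rewrite fine_ge0//= -lee_fin fineK ?fin_num_measure//; exact: probability_le1.
  apply/andP; split; first by apply: prodr_ge0 => i _; have /andP[] := m01 i.
  by apply: prodr_ile1 => i _; exact: m01.
have E : (\int[P]_(w in X K @^-1` A K) (Z w)%:E = \int[P]_(w in X K @^-1` A K) c%:E)%E.
  apply: (laplace_unique (X := X K) (X' := X K) (Z' := fun=> c)) => // la la0.
  pose l' i := if i == K then la else l i.
  have l'0 i : 0 <= l' i by rewrite /l'; case: ifP.
  have lK : l' K = la by rewrite /l' eqxx.
  have lN i : i != K -> l' i = l i by rewrite /l' => /negPf ->.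
  have := IH (ltnW kn) l' l'0.
  rewrite (bigD1 K)//= ltnn lK.
  rewrite (eq_bigr (fun i : 'I_n =>
    if (i < k)%N then fine (P (X i @^-1` A i)) else phi i (l i))); last first.
    by move=> i iK; rewrite lN.
  rewrite -/c => IHE; transitivity ((phi K la * c)%:E).
    rewrite -IHE; apply: eq_integral => w _; congr EFin.
    rewrite [RHS](bigD1 K)//= ltnn lK mulrC; congr (_ * _).
    by apply: eq_bigr => i iK; rewrite lN.
  rewrite mulrC EFinM -phiE// -ge0_integralZl//.
  - by apply/measurable_EFinP; apply: measurableT_comp => //;
      apply: measurableT_comp => //; exact: measurable_funM.
  - by case/andP: c01.
rewrite [in RHS](bigD1 K)//= ltnSn.
rewrite (eq_bigr (fun i : 'I_n =>
    if (i < k)%N then fine (P (X i @^-1` A i)) else phi i (l i))); last first.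
  by move=> i iK; rewrite neqK.
rewrite -/c mulrC EFinM fineK ?fin_num_measure//.
transitivity (\int[P]_(w in X K @^-1` A K) (Z w)%:E)%E; last first.
  by rewrite E integral_cst.
rewrite [RHS]integral_mkcond; apply: eq_integral => w _.
rewrite patchE (bigD1 K)//= ltnSn.
under eq_bigr => i iK do rewrite (neqK _ iK).
rewrite -/(Z w) indicE.
have -> : (X K w \in A K) = (w \in X K @^-1` A K) by apply/idP/idP; rewrite !inE.
by case: ifP; rewrite ?mul1r ?mul0r.
Qed.

Lemma laplace_mutually_independent : mutually_independent P X.
Proof.
move=> A mA.
have mprei i : measurable (X i @^-1` A i).
  by rewrite -[X in measurable X]setTI; exact: mX.
have := laplace_prefix mA (leqnn n) (l := fun=> 0) (fun=> lexx _).
under eq_integral do under eq_bigr => i _ do rewrite ltn_ord.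
under [in RHS]eq_bigr => i _ do rewrite ltn_ord.
rewrite -prodEFin; under [X in _ = X -> _]eq_bigr do rewrite fineK ?fin_num_measure//.
move=> <-; rewrite -[X in P X = _]setIT -integral_indic//; last first.
  by apply: fin_bigcap_measurable => // i _; exact: finite_finset.
apply: eq_integral => w _; congr EFin; rewrite indicE.
have [/set_mem wA|wA] := boolP (w \in _).
  by rewrite big1// => i _; rewrite indicE mem_set//; exact: wA.
apply/esym/eqP; rewrite prodf_seq_eq0; apply/hasP.
apply: contrapT => H; move/negP: wA; apply; rewrite inE => i _ /=.
apply: contrapT => nA; apply: H; exists i; first exact: mem_index_enum.
by rewrite /= indicE memNset.
Qed.

End laplace_independence.

Section subordinator_law.
Context {R : realType} {d : measure_display} {T : measurableType d}.
Variable P : probability T R.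
Variable B : R -> T -> R.
Hypothesis hB : standard_brownian_motion P B.
Local Notation path w := (fun u => inverted B u w).
Local Notation tau th w := (tau_frag (B ^~ w) (reflect_path th (B ^~ w))).
Variables (N : set T) (mN : measurable N) (PN : P N = 0%E).
Hypothesis N_regular : forall w, ~ N w -> regular B w.
Local Notation S := (subordinator B N).

Lemma subordinator_ge0 th w : 0 <= S th w.
Proof.
rewrite /subordinator; case: ifP => // _; rewrite invr_ge0.
exact/fine_ge0/tau_frag_ge0.
Qed.

Lemma subordinator0 w : S 0 w = 0.
Proof. by rewrite /subordinator ltxx. Qed.

Lemma tau_subordinator th w : ~ N w -> 0 < th ->
  0 < S th w /\ tau th w = ((S th w)^-1)%:E.
Proof.
move=> Nw th0; have [r r0 tE] := tau_regular hB (N_regular Nw) th0.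
by rewrite /subordinator th0/= memNset//= tE/= invrK invr_gt0.
Qed.

Lemma subordinator_le s t w : s <= t -> S s w <= S t w.
Proof.
move=> st; have [s0|s0] := leP s 0.
  by rewrite [leLHS]/subordinator ltNge s0/= subordinator_ge0.
have t0 := lt_le_trans s0 st.
have [Nw|Nw] := pselect (N w).
  by rewrite /subordinator mem_set//= !andbF.
have [Ss0 sE] := tau_subordinator Nw s0.
have [St0 tE] := tau_subordinator Nw t0.
have := tau_regular_le hB (N_regular Nw) s0 st.
by rewrite sE tE lee_fin lef_pV2.
Qed.

Lemma passage_le_subordinator w a a' : ~ N w -> 0 < a' -> a' < a ->
  passage_oo (path w) a' <= S (2 * a) w.
Proof.
move=> Nw a'0 a'a; have a0 := lt_trans a'0 a'a.
have [B0 iw uw _] := N_regular Nw.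
have th0 : 0 < 2 * a by rewrite mulr_gt0.
have [S0 SE] := tau_subordinator Nw th0.
have := tau_le_passage B0 iw uw a'0 a'a; rewrite SE lee_fin lef_pV2//.
by rewrite posrE; exact: passage_oo_gt0.
Qed.

Lemma subordinator_le_passage w a : ~ N w -> 0 < a ->
  S (2 * a) w <= passage_oo (path w) a.
Proof.
move=> Nw a0; have [B0 iw uw _] := N_regular Nw.
have th0 : 0 < 2 * a by rewrite mulr_gt0.
have [S0 SE] := tau_subordinator Nw th0.
have := passage_le_tau hB B0 iw uw a0; rewrite SE lee_fin lef_pV2//.
by rewrite posrE; exact: passage_oo_gt0.
Qed.

(** The process [S] is caught between the passage times above all levels
    [a' < a] and above [a]. As [a'] tends to [a], their Laplace transforms at 1
    converge to one another, so the upper bound is attained almost surely. *)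
Lemma ae_subordinator_passage a : 0 <= a ->
  {ae P, forall w, S (2 * a) w = passage_oo (path w) a}.
Proof.
rewrite le_eqVlt => /predU1P[<-|a0].
  by apply: aeW => w; rewrite mulr0 subordinator0 /passage_oo lexx.
pose f w := expR (- S (2 * a) w) - expR (- passage_oo (path w) a).
have mexp (g : T -> R) : measurable_fun [set: T] g -> measurable_fun [set: T] (fun w => expR (- g w)).
  by move=> mg; apply: measurableT_comp => //; exact: measurableT_comp.
have mT b : measurable_fun [set: T] (fun w => expR (- passage_oo (path w) b)).
  by apply: mexp; exact: (measurable_passage_oo hB).
have mf : measurable_fun [set: T] f.
  by apply: measurable_funB => //; apply: mexp; exact: (measurable_subordinator hB).
have mabs : measurable_fun [set: T] (fun w => (`|f w|)%:E).
  by apply/measurable_EFinP; exact: measurableT_comp.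
have est a' : 0 < a' -> a' < a ->
    (\int[P]_w (`|f w|)%:E <= (expR (- (Num.sqrt 2 * a')) - expR (- (Num.sqrt 2 * a)))%:E)%E.
  move=> a'0 a'a; rewrite EFinB leeBrDr// -(passage_oo_laplace1 hB (ltW a'0)) -(passage_oo_laplace1 hB (ltW a0)).
  rewrite -ge0_integralD//; last exact/measurable_EFinP.
  apply: ae_ge0_le_integral => //. 
  - by move=> w _; rewrite adde_ge0// lee_fin expR_ge0.
  - apply: emeasurable_funD => //; exact/measurable_EFinP.
  - exact/measurable_EFinP.
  exists N; split => // w /= Hw; apply: contrapT => Nw; apply: Hw => _.
  rewrite -EFinD lee_fin /f ger0_norm ?subrK.
    by rewrite ler_expR lerN2; exact: passage_le_subordinator.
  by rewrite subr_ge0 ler_expR lerN2; exact: subordinator_le_passage.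
have f0 : (\int[P]_w (`|f w|)%:E = 0)%E.
  apply/eqP; rewrite eq_le integral_ge0// andbT.
  have a20 : 0 < a / 2 by rewrite divr_gt0.
  have a2a : a / 2 < a by lra.
  have := est _ a20 a2a; have := @integral_ge0 _ _ _ P setT (fun w => (`|f w|)%:E).
  move=> /(_ (fun _ _ => normr_ge0 _)).
  move: est; case: (\int[P]_w _)%E => [v| |]// est v0 _; rewrite lee_fin.
  have cg : (expR (- (Num.sqrt 2 * b)) - expR (- (Num.sqrt 2 * a))) @[b --> a^'-] -->
      (expR (- (Num.sqrt 2 * a)) - expR (- (Num.sqrt 2 * a)) : R).
    apply: cvg_at_left_filter; apply: cvgB; last exact: cvg_cst.
    have c1 : (- (Num.sqrt 2 * b)) @[b --> a] --> (- (Num.sqrt 2 * a) : R).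
      by apply: cvgN; exact: mulrl_continuous.
    exact: (cvg_comp _ _ c1 (@continuous_expR R _)).
  rewrite subrr in cg; apply: (cvgr_to_ge cg); near=> b.
  rewrite -lee_fin; apply: est; near: b; first exact: nbhs_left_gt.
  exact: nbhs_left_lt.
have /(ae_eq_integral_abs P measurableT) : measurable_fun [set: T] (EFin \o f).
  exact/measurable_EFinP.
case=> /(_ f0) + _; apply: filterS => w /(_ I) [] /eqP.
by rewrite subr_eq0 => /eqP /expR_inj /oppr_inj.
Unshelve. all: by end_near. Qed.

Lemma subordinator_laplace (t l : nat -> R) n :
  (forall j, (j < n)%N -> t j <= t j.+1) -> 0 <= t 0%N -> (forall j, 0 <= l j) ->
  (\int[P]_w (expR (- \sum_(j < n) l j * (S (t j.+1) w - S (t j) w)))%:E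
   = (expR (- \sum_(j < n) Num.sqrt 2 / 2 * (t j.+1 - t j) * Num.sqrt (l j)))%:E)%E.
Proof.
move=> t_nd t0 l0; pose a j := t j / 2.
have tj0 j : (j <= n)%N -> 0 <= t j.
  by elim: j => // j IH jn; exact: le_trans (IH (ltnW jn)) (t_nd _ jn).
have a_nd j : (j < n)%N -> a j <= a j.+1 by move=> jn; rewrite ler_pM2r// t_nd.
have a0 : 0 <= a 0%N by rewrite divr_ge0.
transitivity (\int[P]_w (expR (- \sum_(j < n)
     l j * (passage_oo (path w) (a j.+1) - passage_oo (path w) (a j))))%:E)%E; last first.
  rewrite (passage_oo_laplace hB)//; congr (expR (- _))%:E; apply: eq_bigr => j _.
  by rewrite sqrtrM// /a; field.
have mS := @measurable_subordinator _ _ _ _ _ hB N mN.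
apply: ge0_ae_eq_integral => //.
- apply/measurable_EFinP; apply: measurableT_comp => //; apply: measurableT_comp => //.
  apply: measurable_sum => j; apply: measurable_funM => //.
  exact: measurable_funB.
- apply/measurable_EFinP; apply: measurableT_comp => //; apply: measurableT_comp => //.
  apply: measurable_sum => j; apply: measurable_funM => //.
  by apply: measurable_funB; exact: (measurable_passage_oo hB).
have H j : {ae P, forall w, (j <= n)%N -> S (t j) w = passage_oo (path w) (a j)}.
  have [jn|jn] := leqP j n; last by apply: aeW.
  have aj0 : 0 <= a j by rewrite divr_ge0// tj0.
  have := ae_subordinator_passage aj0.
  by rewrite mulrC divfK//; apply: filterS => w ->.
apply: filterS (ae_foralln H) => w Hw _ /=; congr (expR (- _))%:E.
by apply: eq_bigr => j _; rewrite !Hw// ltnW.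
Qed.

Let laplace1 (s t l : R) : 0 <= s -> s <= t -> 0 <= l ->
  (\int[P]_w (expR (- (l * (S t w - S s w))))%:E
   = (expR (- (Num.sqrt 2 / 2 * (t - s) * Num.sqrt l)))%:E)%E.
Proof.
move=> s0 st l0; pose u (j : nat) := if j is 0 then s else t.
have := @subordinator_laplace u (fun=> l) 1%N.
by under eq_integral do rewrite big_ord1; rewrite big_ord1; apply=> // -[|//].
Qed.

Lemma half_stable_subordinatorP : half_stable_subordinator P S.
Proof.
have mS := @measurable_subordinator _ _ _ _ _ hB N mN.
have S0 := subordinator0.
have Sle s t w : s <= t -> 0 <= S t w - S s w.
  by move=> st; rewrite subr_ge0 subordinator_le.
split => //.
- by move=> w s t _; exact: subordinator_le.
- split.
    move=> s h s0 h0 A mA.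
    have := @laplace_unique _ _ _ _ _ P P (fun w => S (s + h) w - S s w) (fun=> 1)
      (fun w => S h w - S 0 w) (fun=> 1).
    move=> /(_ _ _ _ _ _ _ _ _ _ _ mA).
    rewrite !integral_cst; last 2 first.
    + by rewrite -[X in measurable X]setTI; apply: measurable_funB.
    + by rewrite -[X in measurable X]setTI; apply: measurable_funB.
    rewrite !mul1e; apply.
    + exact: measurable_funB.
    + exact: measurable_cst.
    + exact: measurable_funB.
    + exact: measurable_cst.
    + by move=> w; apply: Sle; rewrite lerDl.
    + by move=> w; apply: Sle.
    + by move=> w; rewrite ler01 lexx.
    + by move=> w; rewrite ler01 lexx.
    move=> l l0; have sh : s <= s + h by rewrite lerDl.
    have E1 := laplace1 s0 sh l0; have := laplace1 (lexx 0) h0 l0.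
    rewrite subr0 addrAC subrr add0r in E1 *; rewrite -E1 => E2.
    transitivity (\int[P]_w (expR (- (l * (S (s + h) w - S s w))))%:E)%E.
      by apply: eq_integral => w _; rewrite mul1r.
    by rewrite -E2; apply: eq_integral => w _; rewrite mul1r.
  move=> n t t0 t_nd; have tj0 j : (j <= n)%N -> 0 <= t j.
    by elim: j => // j IH jn; exact: le_trans (IH (ltnW jn)) (t_nd _ jn).
  apply: (@laplace_mutually_independent _ _ _ _ _ _
    (fun i l => expR (- (Num.sqrt 2 / 2 * (t i.+1 - t i) * Num.sqrt l)))).
  + by move=> i; exact: measurable_funB.
  + by move=> i w; apply: Sle; exact: t_nd.
  + by move=> i l l0; rewrite laplace1// ?tj0 ?t_nd// ltnW.
  move=> l l0; pose l' j := if insub j is Some i then l i else 0.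
  have l'0 j : 0 <= l' j by rewrite /l'; case: insubP.
  have l'E (i : 'I_n) : l' i = l i by rewrite /l' valK.
  have := subordinator_laplace t_nd t0 l'0.
  under eq_integral do under eq_bigr do rewrite l'E.
  by under [in X in _ = X -> _]eq_bigr do rewrite l'E; rewrite -sumrN expR_sum.
- exists (Num.sqrt 2 / 2); first by rewrite divr_gt0// sqrtr_gt0.
  move=> l th l0 th0; rewrite unlock.
  have := laplace1 (lexx 0) th0 l0; rewrite subr0 => <-.
  by apply: eq_integral => w _; rewrite S0 subr0.
Qed.

End subordinator_law.

Section same_distribution.
Context {R : realType} {d : measure_display} {T : measurableType d}.
Variable P : probability T R.
Variable B : R -> T -> R.
Hypothesis hB : standard_brownian_motion P B.
Local Notation tau th w := (tau_frag (B ^~ w) (reflect_path th (B ^~ w))).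
Variables (N : set T) (mN : measurable N) (PN : P N = 0%E).
Hypothesis N_regular : forall w, ~ N w -> regular B w.
Local Notation S := (subordinator B N).

Lemma tau_inve_subordinator th w : ~ N w -> 0 <= th ->
  tau th w = ((S th w)%:E^-1)%E.
Proof.
move=> Nw; rewrite le_eqVlt => /predU1P[<-|th0].
  by rewrite subordinator0 inve0; case: (N_regular Nw).
have [S0 ->] := tau_subordinator hB N_regular Nw th0.
by rewrite inver gt_eqF.
Qed.

Lemma same_distribution_subordinator :
  same_process_distribution P (fun th w => tau th w) P (fun th w => ((S th w)%:E^-1)%E).
Proof.
have mS := @measurable_subordinator _ _ _ _ _ hB N mN.
have mt th : measurable_fun [set: T] (fun w => tau th w).
  by case: hB => mB cB _ _ _; exact: measurable_tau_frag.
have mSV th : measurable_fun [set: T] (fun w => ((S th w)%:E^-1)%E).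
  under eq_fun do rewrite inver.
  apply: measurable_fun_ifT => //.
    by apply: measurable_fun_eqr => //; exact: measurable_cst.
  by apply/measurable_EFinP; exact: measurableT_comp measurable_inv (mS th).
split; [by move=> th _|by move=> th _|] => n t t0 A mA.
have mpre (X : R -> T -> \bar R) : (forall th, measurable_fun [set: T] (X th)) ->
    measurable [set w | A [tuple X (t i) w | i < n]].
  move=> mX; rewrite -[X in measurable X]setTI.
  suff mf : measurable_fun [set: T] (fun w => [tuple X (t i) w | i < n]) by exact: mf.
  apply/measurable_fun_tnthP => i; rewrite [X in measurable_fun _ X](_ : _ = X (t i)) => //.
  by apply/funext => w /=; rewrite tnth_mktuple.
have E w : ~ N w ->
    [tuple tau (t i) w | i < n] = [tuple ((S (t i) w)%:E^-1)%E | i < n].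
  by move=> Nw; apply: eq_from_tnth => i; rewrite !tnth_mktuple tau_inve_subordinator.
have le C D : measurable C -> measurable D -> C `<=` D `|` N -> (P C <= P D)%E.
  move=> mC mD CD; rewrite -(measureU0 mD mN PN).
  by apply: le_measure => //; rewrite inE//; exact: measurableU.
have mtA := mpre _ mt; have mSA := mpre _ mSV.
apply/eqP; rewrite eq_le; apply/andP; split.
- apply: le => // w /= Aw; have [Nw|Nw] := pselect (N w); first by right.
  by left => /=; rewrite -E.
- apply: le => // w /= Aw; have [Nw|Nw] := pselect (N w); first by right.
  by left => /=; rewrite E.
Qed.

Lemma nonincreasing_tau w : regular B w -> nonincreasing_path (fun th => tau th w).
Proof.
move=> rw s t s0 st; have [s0'|s0'] := ltP 0 s; first exact: (tau_regular_le hB).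
have -> : s = 0 by apply/eqP; rewrite eq_le s0 s0'.
by case: rw => _ _ _ ->; rewrite leey.
Qed.

Lemma finite_tau w : regular B w -> finite_path (fun th => tau th w).
Proof. by move=> rw t t0; have [r _ ->] := tau_regular hB rw t0. Qed.

End same_distribution.

(** * Nonincreasing paths whose one-sided limits are negligible *)

Lemma measure_bigcup_countable {d} {T : sigmaRingType d} {R : realType}
    (mu : {measure set T -> \bar R}) {I : pointedType} (D : set I) (F : I -> set T) :
  countable D -> (forall i, D i -> measurable (F i)) -> trivIset D F ->
  mu (\bigcup_(i in D) F i) = (\esum_(i in D) mu (F i))%E.
Proof.
move=> /countable_bijP[A]; rewrite card_eq_sym => /card_set_bijP[e eb] mF tF.
have [eD einj esurj] := eb.
rewrite (reindex_esum _ _ _ _ eb).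
rewrite -[in RHS](set_mem_set A) -nneseries_esum// -measure_bigcup; last 2 first.
- by move=> i Ai; apply: mF; exact: eD.
- move=> i j Ai Aj ne; have := tF _ _ (eD _ Ai) (eD _ Aj) ne.
  by apply: einj; rewrite inE.
congr (mu _); apply/seteqP; split => x /=.
  by move=> [i /esurj[k Ak <-] Fx]; exists k.
by move=> [k Ak Fx]; exists (e k) => //; exact: eD.
Qed.

Section nonincreasing_jumps.
Context {R : realType}.
Variable f : R -> R.
Hypothesis f_ni : forall s t, 0 < s -> s <= t -> f t <= f s.

Lemma right_limit u : 0 < u ->
  exists2 l, f s @[s --> u^'+] --> l & forall t, u < t -> f t <= l.
Proof.
move=> u0; have ub : has_ubound (f @` [set` Interval (BRight u) +oo%O]).
  exists (f u) => _ [s + <-]; rewrite /= in_itv/= andbT => us.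
  by apply: f_ni => //; exact: ltW.
exists (sup (f @` [set` Interval (BRight u) +oo%O])).
  apply: nonincreasing_at_right_cvgr => // s t.
  rewrite !in_itv/= !andbT => us ut st; apply: f_ni => //.
  exact: lt_trans us.
by move=> t ut; apply: ub_le_sup => //; exists t => //=; rewrite ?in_itv/= ut.
Qed.

Lemma left_limit u : 0 < u ->
  exists2 l, f s @[s --> u^'-] --> l & forall t, 0 < t -> t < u -> l <= f t.
Proof.
move=> u0; have cN : cvg ((\- f) s @[s --> u^'-]).
  apply: nondecreasing_at_left_is_cvgr.
    near=> x => s t; rewrite !in_itv/= => /andP[xs _] /andP[xt tu] st.
    rewrite lerN2; apply: f_ni => //; rewrite (le_lt_trans _ xs)//.
    near: x; exact: nbhs_left_ge.
  near=> x; exists (- f u) => _ [s + <-]; rewrite /= in_itv/= => /andP[xs su].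
  rewrite lerN2; apply: f_ni; last exact: ltW.
  by rewrite (le_lt_trans _ xs)//; near: x; exact: nbhs_left_ge.
have cf : f s @[s --> u^'-] --> - lim ((\- f) s @[s --> u^'-]).
  have /cvgN := cN; apply: cvg_trans; apply: near_eq_cvg; near=> s.
  by rewrite /= opprK.
exists (- lim ((\- f) s @[s --> u^'-])) => // t t0 tu.
apply: (cvgr_to_le cf); near=> s; apply: f_ni => //.
by near: s; exact: nbhs_left_ge.
Unshelve. all: by end_near. Qed.

Variable Z : set R.
Hypothesis right_Z : forall u l, 0 < u -> f s @[s --> u^'+] --> l -> Z l.
Hypothesis left_Z : forall u l, 0 < u -> f s @[s --> u^'-] --> l -> Z l.
Hypothesis Z0 : lebesgue_measure.-negligible (Z : set (measurableTypeR R)).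

(** A value between two values of the path lies in the open interval of some
    jump or is a one-sided limit of the path. The one-sided limits being
    negligible, the disjoint jump intervals fill the range up to a null set. *)
Lemma pure_jump_of_negligible (x : R -> \bar R) :
  (forall t, 0 < t -> x t = (f t)%:E) -> pure_jump_path x.
Proof.
move=> xE a b a0 ab.
pose lo u := lim (f s @[s --> u^'+]); pose hi u := lim (f s @[s --> u^'-]).
have loP u : 0 < u -> f s @[s --> u^'+] --> lo u /\ forall t, u < t -> f t <= lo u.
  by move=> u0; have [l cl lP] := right_limit u0; rewrite /lo (cvg_lim _ cl).
have hiP u : 0 < u -> f s @[s --> u^'-] --> hi u /\ forall t, 0 < t -> t < u -> hi u <= f t.
  by move=> u0; have [l cl lP] := left_limit u0; rewrite /hi (cvg_lim _ cl).
have limR u : 0 < u -> lim (x t @[t --> u^'+]) = (lo u)%:E.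
  move=> u0; have [cu _] := loP u u0; apply: cvg_lim => //.
  have E : \forall t \near u^'+, (f t)%:E = x t.
    near=> t; rewrite xE//; apply: (lt_trans u0); near: t; exact: nbhs_right_gt.
  have ce : (f t)%:E @[t --> u^'+] --> (lo u)%:E by apply: cvg_EFin => //; exact: nearW.
  by apply: cvg_trans ce; exact: near_eq_cvg.
have limL u : 0 < u -> lim (x t @[t --> u^'-]) = (hi u)%:E.
  move=> u0; have [cu _] := hiP u u0; apply: cvg_lim => //.
  have E : \forall t \near u^'-, (f t)%:E = x t.
    by near=> t; rewrite xE//; near: t; exact: nbhs_left_gt.
  have ce : (f t)%:E @[t --> u^'-] --> (hi u)%:E by apply: cvg_EFin => //; exact: nearW.
  by apply: cvg_trans ce; exact: near_eq_cvg.
have b0 := lt_trans a0 ab.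
have lo_hi u : 0 < u -> lo u <= hi u.
  move=> u0; have [cl _] := loP u u0; have [ch _] := hiP u u0.
  apply: (@le_trans _ _ (f u)).
    apply: (cvgr_to_le cl); near=> s; apply: (f_ni u0).
    by near: s; exact: nbhs_right_ge.
  apply: (cvgr_to_ge ch); near=> s; apply: f_ni.
    by near: s; exact: nbhs_left_gt.
  by near: s; exact: nbhs_left_le.
have hi_lo u v : 0 < u -> u < v -> hi v <= lo u.
  move=> u0 uv; have [_ hl] := loP u u0; have [_ hh] := hiP v (lt_trans u0 uv).
  apply: (@le_trans _ _ (f ((u + v) / 2))).
    by apply: hh; rewrite ?midf_lt// divr_gt0// addr_gt0// (lt_trans u0).
  by apply: hl; rewrite midf_lt.
pose J u : set (measurableTypeR R) := `]lo u, hi u[%classic.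
have mJ u : measurable (J u) by exact: measurable_itv.
have JE u : 0 < u -> lebesgue_measure (J u) = (hi u - lo u)%:E.
  move=> u0; rewrite /J lebesgue_measure_itv/= lte_fin; case: ltP => // hl.
  by have -> : hi u = lo u; [apply/eqP; rewrite eq_le hl lo_hi|rewrite subrr].
rewrite limR// limL//.
rewrite (eq_esum (b := fun u => lebesgue_measure (J u))); last first.
  move=> u /= /andP[au ub]; have u0 := lt_trans a0 au.
  by rewrite limR// limL// JE.
pose D := [set u : R | a < u < b /\ lo u < hi u].
have J_disj u v z : 0 < u -> u < v -> J u z -> J v z -> False.
  rewrite /J/= !in_itv/= => u0 uv /andP[uz _] /andP[_ zv].
  by have := lt_trans uz (lt_le_trans zv (hi_lo _ _ u0 uv)); rewrite ltxx.
have tJ : trivIset D J.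
  move=> u v [/andP[au _] _] [/andP[av _] _] [z [Ju Jv]].
  have u0 := lt_trans a0 au; have v0 := lt_trans a0 av.
  have [uv|vu|//] := ltgtP u v; first by have := J_disj _ _ _ u0 uv Ju Jv.
  by have := J_disj _ _ _ v0 vu Jv Ju.
have cD : countable D.
  pose q (u : R) : rat := xget 0 [set q : rat | lo u < ratr q < hi u].
  have qP u : D u -> lo u < ratr (q u) < hi u.
    move=> [_ lh]; have [r] := rat_in_itvoo lh; rewrite in_itv/= => rlh.
    exact: (@xgetPex _ 0 [set q : rat | lo u < ratr q < hi u]) (ex_intro _ r rlh).
  apply/countable_injP; exists (pickle \o q) => u v /set_mem Du /set_mem Dv.
  move=> /(pcan_inj pickleK) quv; apply: tJ => //; exists (ratr (q u)).
  by split; [|rewrite quv]; rewrite /J/= in_itv/=; exact: qP.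
have -> : (\esum_(u in [set u | (a < u < b)%R]) lebesgue_measure (J u) =
    \esum_(u in D) lebesgue_measure (J u))%E.
  rewrite esum_mkcond [RHS]esum_mkcond; apply: eq_esum => u _.
  case: ifPn => [/set_mem/= uab|uab]; case: ifPn => // uD.
    have /andP[au _] := uab; rewrite JE ?(lt_trans a0)//.
    move/negP: uD; rewrite inE /D/= uab => uD.
    suff -> : hi u = lo u by rewrite subrr.
    apply/eqP; rewrite eq_le lo_hi ?(lt_trans a0)// andbT leNgt.
    by apply/negP => lh; apply: uD.
  by exfalso; move/negP: uab; apply; move: uD; rewrite !inE => -[].
rewrite -measure_bigcup_countable//.
have hb_la : hi b <= lo a by exact: hi_lo.
have -> : ((lo a)%:E - (hi b)%:E = lebesgue_measure (`]hi b, lo a[%classic : set (measurableTypeR R)))%E.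
  rewrite lebesgue_measure_itv/= lte_fin -EFinB; case: ltP => // hl.
  by have -> : lo a = hi b; [apply/eqP; rewrite eq_le hl hb_la|rewrite subrr].
have mU : measurable (\bigcup_(u in D) J u).
  by apply: open_measurable; apply: bigcup_open => u _; exact: interval_open.
have [Z' [mZ' Z'0 ZZ']] := Z0.
apply/eqP; rewrite eq_le; apply/andP; split; last first.
  apply: le_measure; rewrite ?inE//.
  move=> z [u [/andP[au ub] _]]; rewrite /J/= !in_itv/= => /andP[uz zu].
  by rewrite (le_lt_trans (hi_lo _ _ (lt_trans a0 au) ub) uz) (lt_le_trans zu (hi_lo _ _ a0 au)).
rewrite -(measureU0 mU mZ' Z'0); apply: le_measure; rewrite ?inE//.
  exact: measurableU.
move=> t; rewrite /= in_itv/= => /andP[bt ta].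
pose A := [set s | a < s < b /\ t < f s].
have [ca _] := loP a a0; have [cb _] := hiP b b0.
have [s1 [as1 s1b ts1]] : exists s, [/\ a < s, s < b & t < f s].
  near a^'+ => s; exists s; split; near: s; first exact: nbhs_right_gt.
    exact: nbhs_right_lt.
  exact: (cvgr_gt _ ca).
have [s2 [as2 s2b ts2]] : exists s, [/\ a < s, s < b & f s < t].
  near b^'- => s; exists s; split; near: s; first exact: nbhs_left_gt.
    exact: nbhs_left_lt.
  exact: (cvgr_lt _ cb).
have A_ub : ubound A s2.
  move=> s [/andP[as_ _] ts]; rewrite leNgt; apply/negP => s2s.
  have := lt_trans (le_lt_trans (f_ni (lt_trans a0 as2) (ltW s2s)) ts2) ts.
  by rewrite ltxx.
have hA : has_sup A by split; [exists s1; split => //; exact/andP|exists s2].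
pose u := sup A.
have au : a < u by apply: (lt_le_trans as1); apply: ub_le_sup; [exists s2|split => //; exact/andP].
have ub : u < b by apply: le_lt_trans s2b; apply: ge_sup => //; exists s1; split => //; exact/andP.
have u0 := lt_trans a0 au.
have [cl _] := loP u u0; have [ch _] := hiP u u0.
have lot : lo u <= t.
  apply: (cvgr_to_le cl); near=> s; rewrite leNgt; apply/negP => ts.
  have us : u < s by near: s; exact: nbhs_right_gt.
  have sb : s < b by near: s; exact: nbhs_right_lt.
  have : s <= u by apply: ub_le_sup; [exists s2|split; rewrite // (lt_trans au us)].
  by rewrite leNgt us.
have thi : t <= hi u.
  apply: (cvgr_to_ge ch); near=> s.
  have su : s < u by near: s; exact: nbhs_left_lt.
  have s0 : 0 < s by near: s; exact: nbhs_left_gt.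
  have [s' [/andP[_ _] ts'] ss'] := sup_gt (proj1 hA) su.
  exact: le_trans (ltW ts') (f_ni s0 (ltW ss')).
move: lot; rewrite le_eqVlt => /predU1P[lt|lot].
  by right; apply: ZZ'; rewrite -lt; exact: right_Z cl.
move: thi; rewrite le_eqVlt => /predU1P[th|thi].
  by right; apply: ZZ'; rewrite th; exact: left_Z ch.
left; exists u; first by rewrite /D/= au ub (lt_trans lot thi).
by rewrite /J/= in_itv/= lot thi.
Unshelve. all: by end_near. Qed.

End nonincreasing_jumps.

(** * Records of the slope *)

Section path_minima.
Context {R : realType} {d : measure_display} {T : measurableType d}.
Variable P : probability T R.
Variable B : R -> T -> R.
Hypothesis hB : standard_brownian_motion P B.

Let cB w : continuous_path (B ^~ w). Proof. by case: hB. Qed.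
Let mB t : 0 <= t -> measurable_fun [set: T] (B t). Proof. by case: hB => + _ _ _ _; apply. Qed.

(** Joint measurability in time and chance, by approximation with the values
    at the grid point of mesh 1/(n+1) to the left. *)
Lemma measurable_time_chance : measurable_fun [set: measurableTypeR R * T]
  (fun z => if 0 <= z.1 then B z.1 z.2 else 0).
Proof.
pose I n (k : nat) : set (measurableTypeR R) := `[k%:R / n.+1%:R, k.+1%:R / n.+1%:R[%classic.
pose g n (z : measurableTypeR R * T) : R :=
  \sum_(k < (n.+1 ^ 2)%N) \1_(I n k) z.1 * B (k%:R / n.+1%:R) z.2.
apply: (@measurable_fun_cvg _ _ _ _ g).
  move=> n; apply: measurable_sum => k; apply: measurable_funM.
    have mI : measurable_fun [set: measurableTypeR R] (\1_(I n k) : measurableTypeR R -> R).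
      by apply: measurable_indic; exact: measurable_itv.
    exact: measurableT_comp mI measurable_fst.
  have mBk : measurable_fun [set: T] (B (k%:R / n.+1%:R)) by apply: mB; rewrite divr_ge0.
  exact: measurableT_comp mBk measurable_snd.
move=> [t w] _ /=; case: ifPn => [t0|t0]; last first.
  apply: cvg_near_cst; apply: nearW => n; rewrite /g big1// => k _.
  rewrite indicE memNset ?mul0r// /I/= in_itv/= => /andP[kt _].
  by move/negP: t0; apply; apply: le_trans kt; rewrite divr_ge0.
have gE n : t < n.+1%:R -> exists s, [/\ g n (t, w) = B s w, 0 <= s, s <= t & t < s + n.+1%:R^-1].
  move=> tn; pose k := Num.truncn (t * n.+1%:R).
  have tn0 : 0 <= t * n.+1%:R by rewrite mulr_ge0.
  have /andP[kt tk] := truncn_itv tn0.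
  have kn : (k < n.+1 ^ 2)%N.
    rewrite -(@ltr_nat R) (le_lt_trans kt)// natrX expr2 ltr_pM2r//.
  have k1 : k%:R / n.+1%:R <= t by rewrite ler_pdivrMr.
  have k2 : t < k.+1%:R / n.+1%:R by rewrite ltr_pdivlMr.
  exists (k%:R / n.+1%:R); split => //; last first.
    by rewrite (lt_le_trans k2)// -natr1 mulrDl mul1r.
  rewrite /g (bigD1 (Ordinal kn))//= big1 ?addr0.
    by rewrite indicE mem_set ?mul1r// /I/= in_itv/= k1 k2.
  move=> j jk; rewrite indicE memNset ?mul0r// /I/= in_itv/= => /andP[jt tj].
  move/eqP: jk; apply; apply/val_inj => /=; apply/eqP; rewrite eqn_leq.
  rewrite -ltnS -[X in _ && X]ltnS -!(@ltr_nat R).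
  have n0 : 0 < n.+1%:R :> R by [].
  apply/andP; split.
    by rewrite -(@ltr_pM2r _ n.+1%:R^-1) ?invr_gt0// (le_lt_trans jt k2).
  by rewrite -(@ltr_pM2r _ n.+1%:R^-1) ?invr_gt0// (le_lt_trans k1 tj).
have /subspace_continuousP /(_ _ t0) ct := @cB w.
apply/cvgrPdist_lt => e e0.
have /cvgrPdist_lt /(_ _ e0) [de /= de0 Hde] := ct.
near=> n; have [|s [-> s0 st ts]] := gE n.
  by rewrite (@lt_trans _ _ n%:R) ?ltr_nat//; near: n; exact: nbhs_infty_gtr.
apply: Hde => //=; rewrite ger0_norm ?subr_ge0//.
rewrite ltrBlDl (lt_le_trans ts)// lerD2l -[leRHS]invrK lef_pV2 ?posrE ?invr_gt0//.
rewrite (@le_trans _ _ n%:R) ?ler_nat//; apply: ltW; near: n; exact: nbhs_infty_gtr.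
Unshelve. all: by end_near. Qed.

(** The slope [B t / t] of the chord from the origin is not exceeded after such
    a time [t]. Fragmentation times, and their one-sided limits in the
    parameter, are of this kind. *)
Definition slope_records w : set R :=
  [set t | 0 < t /\ forall s, t < s -> B s w * t <= B t w * s].

(** The path restarted at time [t] is above lines of any slope at some times,
    because its time inversion is unbounded above. *)
Lemma ae_not_slope_record t : 0 < t -> {ae P, forall w,
  ~ forall q : rat, t < ratr q -> B (ratr q) w * t <= B t w * ratr q}.
Proof.
move=> t0; have := ae_unbounded_above (shift_brownian hB (ltW t0)).
apply: filterS => w uw Hq; have [u u0] := uw (B t w / t).
rewrite /inverted addr0 subrr subr0 => Wu.
pose s := t + u^-1.
have ts : t < s by rewrite /s ltrDl invr_gt0.
have s0 := lt_trans t0 ts.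
have fs : 0 < B s w * t - B t w * s.
  move: Wu; rewrite -/s -ltr_pdivrMl// ltrBrDr.
  rewrite -(ltr_pM2r t0) mulrDl mulrA mulfVK ?gt_eqF//= => h.
  by rewrite subr_gt0; apply: le_lt_trans h; rewrite /s mulrDr [B t w * u^-1]mulrC addrC.
have cfs : {for s, continuous (fun s => B s w * t - B t w * s)}.
  apply: cvgB; first exact: (cvgMl (continuous_path_pos (@cB w) s0)).
  exact: mulrl_continuous.
have /cvgr_gt /(_ _ fs) /nbhs_ballP[e /= e0 He] := cfs.
have lt1 : Num.max (s - e) t < s by rewrite gt_max ts andbT ltrBlDr ltrDl.
have [q] := rat_in_itvoo lt1; rewrite in_itv/= gt_max => /andP[/andP[q1 q2] q3].
have : 0 < B (ratr q) w * t - B t w * ratr q.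
  by apply: He; rewrite /ball/= ger0_norm ?subr_ge0 ?(ltW q3)//; lra.
by apply/negP; rewrite -leNgt subr_le0; exact: Hq.
Qed.

(** Fubini: each time is almost surely not a record, so almost surely almost
    every time is not a record. Rational times suffice in the definition of a
    record and make the set of pairs measurable. *)
Lemma ae_negligible_slope_records : {ae P, forall w,
  lebesgue_measure.-negligible (slope_records w : set (measurableTypeR R))}.
Proof.
pose X (z : measurableTypeR R * T) : R := if 0 <= z.1 then B z.1 z.2 else 0.
pose test (q : rat) (z : measurableTypeR R * T) : bool := (ratr q <= 0 :> R) ||
  ((ratr q <= z.1) || (B (ratr q) z.2 * z.1 <= X z * ratr q)).
have m1 : measurable_fun [set: measurableTypeR R * T] (fun z => z.1 : R) by exact: measurable_fst.
have mtest q : measurable_fun setT (test q).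
  rewrite /test; have [q0|q0] /= := leP (ratr q : R) 0; first exact: measurable_cst.
  apply: measurable_or; first by apply: measurable_fun_ler => //; exact: measurable_cst.
  apply: measurable_fun_ler; apply: measurable_funM => //.
    exact: measurableT_comp (mB (ltW q0)) measurable_snd.
  exact: measurable_time_chance.
pose G := [set z : measurableTypeR R * T | 0 < z.1] `&` ~` \bigcup_(q : rat) [set z | ~~ test q z].
have mG : measurable G.
  apply: measurableI.
    have m0 : measurable_fun [set: measurableTypeR R * T] (fun z => 0 < (z.1 : R)).
      by apply: measurable_fun_ltr => //; exact: measurable_cst.
    by have := m0 measurableT [set true] I; rewrite setTI.
  apply: measurableC; apply: bigcupT_measurable_rat => q.
  have := mtest q measurableT [set false] I; rewrite setTI.
  by congr measurable; apply/seteqP; split => z /= => [->|/negPf].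
have GP t w : G (t, w) <-> 0 < t /\ forall q : rat, t < ratr q -> B (ratr q) w * t <= B t w * ratr q.
  split => -[/= t0 H]; split => //.
    move=> q tq; rewrite leNgt; apply/negP => lt; apply: H; exists q => //=.
    have q0 := lt_trans t0 tq.
    by rewrite /test /X/= (ltW t0) !negb_or -!ltNge q0 tq lt.
  move=> [q _ /=]; apply/negP; rewrite negbK /test /X/= (ltW t0).
  have [//|q0] /= := leP (ratr q : R) 0; have [//|tq] /= := leP (ratr q) t.
  exact: H.
have PG (t : measurableTypeR R) : P (xsection G t) = 0%E.
  have [t0|t0] := ltP 0 (t : R); last first.
    rewrite (_ : xsection G t = set0) ?measure0//.
    by apply/seteqP; split => // w /xsectionP /GP[]; rewrite ltNge t0.
  apply: measure_negligible; first exact: measurable_xsection.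
  have := ae_not_slope_record t0; apply: negligibleS => w /xsectionP /GP[_ H] /=.
  by apply.
have LG : (\int[P]_w lebesgue_measure (ysection G w) = 0)%E.
  have := indic_fubini_tonelli lebesgue_measure P mG.
  rewrite indic_fubini_tonelli_FE// indic_fubini_tonelli_GE// => <-.
  by apply: integral0_eq => t _ /=; rewrite PG.
have mL := measurable_fun_ysection lebesgue_measure mG.
have : (\int[P]_w `|(lebesgue_measure \o ysection G) w| = 0)%E.
  by rewrite -[RHS]LG; apply: eq_integral => w _; rewrite gee0_abs.
move=> /(ae_eq_integral_abs P measurableT mL); apply: filterS => w /(_ I) /= Lw.
exists (ysection G w); split => //; first exact: measurable_ysection.
move=> t [t0 Ht]; apply/ysectionP/GP; split => // q tq.
exact: Ht.
Qed.

End path_minima.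

(** * Pure jumps and the theorem *)

Section pure_jump_tau.
Context {R : realType} {d : measure_display} {T : measurableType d}.
Variable P : probability T R.
Variable B : R -> T -> R.
Hypothesis hB : standard_brownian_motion P B.
Local Notation path w := (fun u => inverted B u w).
Local Notation tau th w := (tau_frag (B ^~ w) (reflect_path th (B ^~ w))).

Let cB w : continuous_path (B ^~ w). Proof. by case: hB. Qed.

Let cB_pos w s : 0 < s -> {for s, continuous (B ^~ w)}.
Proof. exact: continuous_path_pos. Qed.

Lemma tau_crossing w th r : 0 < r -> tau th w = r%:E -> B r w = 2^-1 * th * r.
Proof.
move=> r0 tr; pose f s := B s w - 2^-1 * th * s.
have cf : {for r, continuous f}.
  by apply: cvgB; [exact: cB_pos|exact: mulrl_continuous].
apply: contrapT => /eqP; rewrite -subr_eq0 -/(f r) -normr_gt0 => fr.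
have cnf : {for r, continuous (fun s => `|f s|)} by exact: cvg_norm cf.
have /cvgr_gt /(_ _ fr) /nbhs_ballP[e /= e0 He] := cnf.
have lt : ((Num.max 0 (r - e))%:E < tau th w)%E.
  by rewrite tr lte_fin gt_max r0 ltrBlDr ltrDl.
have m0 : 0 <= Num.max 0 (r - e) by rewrite le_max lexx.
have [s + Bs] := (tau_frag_gt _ th m0).1 lt.
rewrite gt_max => /andP[s0 res].
have sr : s <= r by have := @tau_frag_crossing _ (B ^~ w) _ _ (ltW s0) Bs; rewrite tr lee_fin.
have : 0 < `|f s| by apply: He; rewrite /ball/= ger0_norm ?subr_ge0//; lra.
by rewrite /f Bs subrr normr0 ltxx.
Qed.

(** Being above the line at time [s] is a passage of the inverted path above
    [th / 2] by time [1/s], which forces a crossing after [s]. *)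
Lemma below_after_tau w th r s : regular B w -> 0 < th -> tau th w = r%:E -> r < s ->
  B s w <= 2^-1 * th * s.
Proof.
move=> [B0 iw uw _] th0 tr rs; have a0 : 0 < th / 2 by rewrite divr_gt0.
have r0 : 0 <= r by rewrite -lee_fin -tr; exact: tau_frag_ge0.
have s0 := le_lt_trans r0 rs.
have T0 := passage_oo_gt0 iw uw a0.
have := passage_le_tau hB B0 iw uw a0.
rewrite [2 * _]mulrC divfK// tr lee_fin => Tr.
rewrite (path_invertedE B0 s0) [leRHS]mulrC [2^-1 * _]mulrC ler_pM2l//.
apply: below_passage_oo; first by rewrite invr_gt0.
by rewrite -[ltRHS]invrK ltf_pV2 ?posrE ?invr_gt0// (le_lt_trans Tr).
Qed.

(** At a limit of the fragmentation times the path is on the limiting line,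
    and below it ever after. *)
Lemma tau_limit_slope_record w (F : set_system R) (FF : ProperFilter F) (th l : R) :
  regular B w -> 0 < th -> F --> th ->
  fine (tau s w) @[s --> F] --> l -> slope_records B w l.
Proof.
move=> rw th0 Fth Fl; pose f s := fine (tau s w).
have fE s : 0 < s -> 0 < f s /\ tau s w = (f s)%:E.
  by move=> s0; have [r r0 tE] := tau_regular hB rw s0; rewrite /f tE.
have F0 : \forall s \near F, 0 < s by exact: (cvgr_gt _ Fth).
have l0 : 0 < l.
  have th2 : 0 < 2 * th by rewrite mulr_gt0.
  have [f2 _] := fE _ th2; apply: (lt_le_trans f2).
  apply: (cvgr_to_ge Fl).
  have F2 : \forall s \near F, s < 2 * th by apply: (cvgr_lt _ Fth); lra.
  apply: filterS2 F0 F2 => s s0 s2; rewrite fine_le//.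
  - by have [_ ->] := fE _ th2.
  - by have [_ ->] := fE _ s0.
  - exact: (tau_regular_le hB rw s0 (ltW s2)).
have line s : (2^-1 * x * s : R) @[x --> F] --> 2^-1 * th * s.
  by apply: cvgMl; exact: cvgMr Fth.
split=> // s ls; have s0 := lt_trans l0 ls.
have Bl : B l w = 2^-1 * th * l.
  have c1 : B (f x) w @[x --> F] --> B l w by exact: (cvg_comp _ _ Fl (@cB_pos w _ l0)).
  have c2 : (2^-1 * x * f x) @[x --> F] --> 2^-1 * th * l.
    by apply: cvgM => //; exact: cvgMr Fth.
  apply: (cvg_unique _ c1) => //; apply: cvg_trans c2; apply: near_eq_cvg.
  apply: filterS F0 => x x0; have [fx0 fx] := fE _ x0.
  by rewrite (tau_crossing fx0 fx).
have Bs : B s w <= 2^-1 * th * s.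
  apply: (cvgr_to_ge (line s)); apply: filterS2 F0 (cvgr_lt _ Fl _ ls) => x x0 xs.
  by have [_ fx] := fE _ x0; exact: (below_after_tau rw x0 fx xs).
by rewrite Bl mulrAC ler_pM2r.
Qed.

Lemma pure_jump_tau w : regular B w ->
  lebesgue_measure.-negligible (slope_records B w : set (measurableTypeR R)) ->
  pure_jump_path (fun th => tau th w).
Proof.
move=> rw Zw; pose f s := fine (tau s w).
have fE s : 0 < s -> tau s w = (f s)%:E.
  by move=> s0; have [r _ tE] := tau_regular hB rw s0; rewrite /f tE.
apply: (@pure_jump_of_negligible _ f _ (slope_records B w)) => //.
- move=> s t s0 st; have t0 := lt_le_trans s0 st.
  by rewrite -lee_fin -!fE//; exact: (tau_regular_le hB).
- by move=> u l u0 ul; apply: (tau_limit_slope_record _ rw u0 _ ul); exact: cvg_at_right_filter.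
- by move=> u l u0 ul; apply: (tau_limit_slope_record _ rw u0 _ ul); exact: cvg_at_left_filter.
Qed.

End pure_jump_tau.

Theorem theorem2p3 (R : realType) (d : measure_display) (T : measurableType d)
    (P : probability T R) (B : R -> T -> R) :
  standard_brownian_motion P B ->
  let tau : R -> T -> \bar R :=
    fun theta w => tau_frag (B ^~ w) (reflect_path theta (B ^~ w)) in
  (exists (d' : measure_display) (T' : measurableType d')
          (P' : probability T' R) (S : R -> T' -> R),
      half_stable_subordinator P' S /\
      same_process_distribution P tau P'
        (fun theta w => ((S theta w)%:E^-1)%E)) /\
  {ae P, forall w, [/\ nonincreasing_path (tau ^~ w),
                       finite_path (tau ^~ w) &
                       pure_jump_path (tau ^~ w)]}.
Proof.
move=> hB tau; split.
  have [N [mN PN NP]] := ae_regular hB.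
  have N_regular w : ~ N w -> regular B w.
    by move=> Nw; apply: contrapT => rw; apply: Nw; exact: NP.
  exists d, T, P, (subordinator B N); split.
    exact: (half_stable_subordinatorP hB mN PN N_regular).
  exact: (same_distribution_subordinator hB mN PN N_regular).
apply: filterS2 (ae_regular hB) (ae_negligible_slope_records hB) => w rw Zw; split.
- exact: (nonincreasing_tau hB rw).
- exact: (finite_tau hB rw).
- exact: (pure_jump_tau hB rw Zw).
Qed.
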